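(* Let $p\geq 2$ and let $X_N=I_p(f_N)$, $N\geq 1$, with $f_N\in H^{\odot p}$ for all $N\geq 1$. Assume that $X_N\xrightarrow[N\to\infty]{(d)}N(0,\sigma^2)$ with $\sigma^2>0$. Let $\mathbb Y_N=(Y_{1,N},\ldots,Y_{d,N})$, $N\geq 1$, be a $d$-dimensional random sequence such that for every $j=1,\ldots,d$, $Y_{j,N}$ belongs to the $q_j$-th Wiener chaos with $q_j<p$ (for every $N\ge 1$). Assume that $\mathbb Y_N\xrightarrow[N\to\infty]{(d)}\mathbb Y=(Y_1,\ldots,Y_d)$. Then $$(X_N,\mathbb Y_N)\xrightarrow[N\to\infty]{(d)}(Z,\mathbb Y),$$ where $Z\sim N(0,\sigma^2)$ and $Z$ is independent of $\mathbb Y$.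
   Context: $H$ is a real separable Hilbert space, $H^{\odot n}$ is the symmetric $n$-th tensor power of $H$ (symmetric elements of $H^{\otimes n}$), $(W(h),h\in H)$ is an isonormal Gaussian process on a probability space $(\Omega,\mathcal A,P)$, and $I_n$ is the multiple Wiener–Itô integral of order $n$ with respect to $W$, normalized so that $\mathbf E[I_n(f)I_m(g)]=n!\langle f,g\rangle_{H^{\otimes n}}$ if $n=m$ and $0$ otherwise, for symmetric $f,g$. The $n$-th Wiener chaos is $\{I_n(f): f\in H^{\odot n}\}$. $\xrightarrow{(d)}$ denotes convergence in distribution. *)

(* Defs.v *)
From HB Require Import structures.
From mathcomp Require Import all_boot all_order all_fingroup all_algebra.
From mathcomp Require Import all_classical all_reals all_analysis.

Set Implicit Arguments.
Unset Strict Implicit.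
Unset Printing Implicit Defensive.

Import Order.TTheory GRing.Theory Num.Theory.
Import numFieldNormedType.Exports.

Local Open Scope classical_set_scope.
Local Open Scope ring_scope.

(* Completeness is carried by the type [H]. *)
Definition separable_hilbert (R : realType) (H : completeNormedModType R)
    (dot : {dot H for idfun}) : Prop :=
  (forall h : H, `|h| ^+ 2 = dot h h) /\
  (exists D : set H, countable D /\ dense D).

(* The Hilbert-space tensor power of H of order n is realized as the space of
   Hilbert-Schmidt n-linear forms on H: the elementary tensor x_1 (x) ... (x) x_n
   is the form y |-> \prod_i <x_i, y_i>. *)
Definition multilinear (R : realType) (H : completeNormedModType R) (n : nat)
    (f : ('I_n -> H) -> R) : Prop :=
  forall (i : 'I_n) (x : 'I_n -> H) (a : R) (u v : H),
    f (dfwith x i (a *: u + v)) = a * f (dfwith x i u) + f (dfwith x i v).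

Definition orthonormal_family (R : realType) (H : completeNormedModType R)
    (dot : {dot H for idfun}) (m : nat) (e : 'I_m -> H) : Prop :=
  forall i j : 'I_m, dot (e i) (e j) = (i == j)%:R.

(* Squared norm of the tensor power: for an orthonormal basis (e_k)_k of H, the
   sum of f(e_{i_1}, ..., e_{i_n})^2 over all indices does not depend on the
   basis and is the supremum below over finite orthonormal families. *)
Definition tensor_norm2 (R : realType) (H : completeNormedModType R)
    (dot : {dot H for idfun}) (n : nat) (f : ('I_n -> H) -> R) : \bar R :=
  ereal_sup [set s | exists (m : nat) (e : 'I_m -> H),
    orthonormal_family dot e /\
    s = (\sum_(i : {ffun 'I_n -> 'I_m}) f (fun k => e (i k)) ^+ 2)%:E].

Definition tensor (R : realType) (H : completeNormedModType R)
    (dot : {dot H for idfun}) (n : nat) (f : ('I_n -> H) -> R) : Prop :=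
  multilinear f /\ (tensor_norm2 dot f < +oo)%E.

Definition sym_tensor (R : realType) (H : completeNormedModType R)
    (dot : {dot H for idfun}) (n : nat) (f : ('I_n -> H) -> R) : Prop :=
  tensor dot f /\
  (forall (s : 'S_n) (x : 'I_n -> H), f (fun k => x (s k)) = f x).

Definition pow_tensor (R : realType) (H : completeNormedModType R)
    (dot : {dot H for idfun}) (n : nat) (h : H) : ('I_n -> H) -> R :=
  fun x => \prod_(k < n) dot h (x k).

(* Probabilists' (monic) Hermite polynomials. *)
Fixpoint hermite (R : realType) (n : nat) : {poly R} :=
  if n is n'.+1 then 'X * hermite R n' - (hermite R n')^`() else 1.

(* Centered Gaussian law of standard deviation s; [normal_prob 0 0] is not the
   degenerate law, whence the case distinction. *)
Definition centered_gaussian_law (R : realType) (s : R) (A : set R) : \bar R :=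
  if s == 0 then \d_(0 : R) A else normal_prob 0 s A.

Definition isonormal (R : realType) (H : completeNormedModType R)
    (dot : {dot H for idfun}) (dT : measure_display) (T : measurableType dT)
    (P : probability T R) (W : H -> {RV P >-> R}) : Prop :=
  (forall c : seq (R * H), exists s : R, forall A : set R, measurable A ->
     P ((fun w => \sum_(a <- c) a.1 * W a.2 w) @^-1` A)
     = centered_gaussian_law s A) /\
  (forall g h : H, 'E_P[fun w => (W g w * W h w)%R]%E = (dot g h)%:E).

(* I_n(h^{(x) n}) = He_n(W(h)) if |h| = 1, extended to all h by
   I_n((a h)^{(x) n}) = a^n I_n(h^{(x) n}); for h = 0 the value is 0 if n > 0,
   and 1 if n = 0. *)
Definition integral_pow_tensor (R : realType) (H : completeNormedModType R)
    (dT : measure_display) (T : measurableType dT)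
    (P : probability T R) (W : H -> {RV P >-> R}) (n : nat) (h : H) : T -> R :=
  fun w => `|h| ^+ n * (hermite R n).[W h w / `|h|].

(* [multiple_integral dot W n f X] means X = I_n(f) almost surely. I_n is the
   linear extension of [integral_pow_tensor] to the finite combinations of
   powers h^{(x) n}, which are dense in the symmetric tensors, continuously
   extended with values in L^2(P); these powers satisfy
   E[I_n(g^{(x) n}) I_n(h^{(x) n})] = n! <g, h>^n, so that
   E[I_n(f) I_n(g)] = n! <f, g>. *)
Definition multiple_integral (R : realType) (H : completeNormedModType R)
    (dot : {dot H for idfun}) (dT : measure_display) (T : measurableType dT)
    (P : probability T R) (W : H -> {RV P >-> R}) (n : nat)
    (f : ('I_n -> H) -> R) (X : {RV P >-> R}) : Prop :=
  exists c : nat -> seq (R * H),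
    tensor_norm2 dot
      (fun x => f x - \sum_(a <- c k) a.1 * pow_tensor dot a.2 x)
      @[k --> \oo] --> 0%E /\
    'E_P[fun w =>
          ((X w - \sum_(a <- c k) a.1 * integral_pow_tensor W n a.2 w) ^+ 2)%R]%E
      @[k --> \oo] --> 0%E.

Definition wiener_chaos (R : realType) (H : completeNormedModType R)
    (dot : {dot H for idfun}) (dT : measure_display) (T : measurableType dT)
    (P : probability T R) (W : H -> {RV P >-> R}) (n : nat)
    (X : {RV P >-> R}) : Prop :=
  exists f : ('I_n -> H) -> R, sym_tensor dot f /\ multiple_integral dot W f X.

(* The limit may live on another probability space. *)
Definition cvg_in_distribution (R : realType) (E : topologicalType)
    (dT : measure_display) (T : measurableType dT) (P : probability T R)
    (X : nat -> T -> E)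
    (dT' : measure_display) (T' : measurableType dT') (P' : probability T' R)
    (X' : T' -> E) : Prop :=
  forall phi : E -> R, continuous phi ->
    (exists M : R, forall x : E, `|phi x| <= M) ->
    'E_P[phi \o X N]%E @[N --> \oo] --> 'E_P'[phi \o X']%E.

Definition independent_rv_vector (R : realType) (dT : measure_display)
    (T : measurableType dT) (P : probability T R) (Z : T -> R)
    (d : nat) (Y : T -> 'rV[R]_d) : Prop :=
  forall (A : set R) (B : set 'rV[R]_d),
    measurable A -> <<s [set U : set 'rV[R]_d | open U] >> B ->
    P (Z @^-1` A `&` Y @^-1` B) = (P (Z @^-1` A) * P (Y @^-1` B))%E.

(* Main.v *)
(** For a unit vector e the variable W(e) is standard Gaussian, and the variables
    of an orthonormal family are independent, so every element of a finite sum of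
    chaoses is an L^2 limit of polynomials in finitely many independent standard
    Gaussian variables. On such polynomials let L be the Ornstein-Uhlenbeck
    operator and Gamma(a, b) = sum_i d_i a * d_i b; a polynomial representing an
    element of the n-th chaos is an eigenvector of L for -n, and Gaussian
    integration by parts reads E[a L b] = - E[Gamma(a, b)].

    Convergence in law makes the X_N tight; by hypercontractivity their moments are
    then bounded, so E X_N^2 -> sigma^2 and E X_N^4 -> 3 sigma^4. The spectral form
    of the fourth moment theorem gives Gamma(X_N, X_N) -> p sigma^2 in L^2, and the
    strict inequality q_j < p lets the same defect control Gamma(X_N, Y_(j,N)),
    which therefore tends to 0. For test functions B of Y_N and u of X_N,
    integration by parts shows that
    E[(sigma^2 u'(X_N) - X_N u(X_N)) B(Y_N)] -> 0. Solving Stein's equation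
    a = sigma^2 u' - x u for centered a yields
    E[a(X_N) B(Y_N)] - E[a(Z)] E[B(Y_N)] -> 0, and products of such test functions
    determine the joint limit. *)

Require Import Defs.
From HB Require Import structures.
From mathcomp Require Import all_boot all_order all_fingroup all_algebra.
From mathcomp Require Import all_classical all_reals all_analysis.
From mathcomp Require Import measurable_realfun.
From mathcomp Require mpoly.
From mathcomp Require Import ring lra.
Import -(notations) mpoly.

Set Implicit Arguments.
Unset Strict Implicit.
Unset Printing Implicit Defensive.

Import Order.TTheory GRing.Theory Num.Theory.
Import numFieldNormedType.Exports.

Local Open Scope classical_set_scope.
Local Open Scope ring_scope.

(** The Gaussian variables that approximate the chaoses at rank N change with N and their number is
    not bounded. Every estimate on polynomials must therefore be free of the dimension: its
    constants may depend only on degrees and on the test functions. Hence the spectral style of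
    proof, in which quadratic forms are compared eigenspace by eigenspace of L, and a
    hypercontractive inequality drawn from Poincaré's inequality by induction on the degree, whose
    constant is far from sharp but depends on the degree alone. The algebra sees the expectation
    only as a positive normalized linear functional that satisfies integration by parts. To provide
    it, isonormality is used as stated, through the laws of single linear combinations: they give
    the joint characteristic function of an orthonormal family, in real form, and independence is
    recovered from it one coordinate at a time. At the other end, Stein's equation is solved only
    for compactly supported functions with Gaussian mean zero, whereas the conclusion concerns all
    bounded continuous functions. Smooth cutoffs and a partition of unity into products bridge this
    gap. *)

Lemma quadratic_discriminant (R : rcfType) (x y z : R) :
  (forall t, 0 <= x - 2 * t * y + t ^+ 2 * z) -> y ^+ 2 <= x * z.
Proof.
(* The polynomial is only known to have size at most 3, which covers [z = 0]. With [x], [y], [z] the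
   expectations of [a ^+ 2], [a * b], [b ^+ 2], this gives Cauchy-Schwarz, for polynomials and later
   for integrals. *)
move=> h; have := @deg_le2_poly_ge0 R (Poly [:: x; - (2 * y); z]) (size_Poly _).
rewrite !coef_Poly /= => D; rewrite -subr_ge0.
have -> : x * z - y ^+ 2 = - ((- (2 * y)) ^+ 2 - 4 * z * x) / 4 by field.
rewrite divr_ge0 ?oppr_ge0// D// => t.
apply: le_trans (h t) _; rewrite !horner_cons horner0 le_eqVlt; apply/orP; left; apply/eqP; ring.
Qed.

(** * The Ornstein-Uhlenbeck operator on polynomials *)

Section OrnsteinUhlenbeck.
Variables (R : rcfType) (n : nat).
Local Notation A := (mpoly n R).
Implicit Types (a b : A) (i : 'I_n) (m k : nat).

Definition mvar i : A := mpolyX R (mnm1 i).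

Definition ou a : A :=
  \sum_(i < n) (mderiv i (mderiv i a) - mvar i * mderiv i a).

Definition gam a b : A := \sum_(i < n) mderiv i a * mderiv i b.

(** Total degree at most [m], presented by closure rules so that each degree estimate is an
    induction on a derivation. *)
Inductive pdeg : nat -> A -> Prop :=
| pdeg_cst m (c : R) : pdeg m (c *: 1)
| pdeg_var m i a : pdeg m a -> pdeg m.+1 (mvar i * a)
| pdeg_add m a b : pdeg m a -> pdeg m b -> pdeg m (a + b).

Lemma mderiv_cst i (c : R) : mderiv i (c *: 1 : A) = 0.
Proof. by rewrite linearZ/= -mpolyC1 mderivC scaler0. Qed.

Lemma mderiv_mvar i j : mderiv i (mvar j) = ((i == j)%:R : A).
Proof.
rewrite /mvar mderivX mnmE eq_sym.
have [->|_] := eqVneq; last by rewrite mulr0n scale0r.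
rewrite (_ : mnm_sub _ _ = mnm0) ?mpolyX0 ?scale1r//.
by apply/mnmP => k; rewrite mnmBE mnm0E subnn.
Qed.

Lemma mderivMvar i j a :
  mderiv i (mvar j * a) = (i == j)%:R * a + mvar j * mderiv i a.
Proof. by rewrite mderivM mderiv_mvar. Qed.

Lemma gamC a b : gam a b = gam b a.
Proof. by apply: eq_bigr => i _; rewrite mulrC. Qed.

Lemma gam_cst (c : R) b : gam (c *: 1) b = 0.
Proof. by rewrite /gam big1// => i _; rewrite mderiv_cst mul0r. Qed.

Lemma gamMl a b c : gam (a * b) c = a * gam b c + b * gam a c.
Proof.
rewrite /gam !mulr_sumr -big_split/=; apply: eq_bigr => i _.
by rewrite mderivM; ring.
Qed.

Lemma ouD a b : ou (a + b) = ou a + ou b.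
Proof.
rewrite /ou -big_split/=; apply: eq_bigr => i _.
by rewrite !mderivD; ring.
Qed.

Lemma ouZ (c : R) a : ou (c *: a) = c *: ou a.
Proof.
rewrite /ou scaler_sumr; apply: eq_bigr => i _.
by rewrite !mderivZ -scalerAr scalerBr.
Qed.

Lemma ou_cst (c : R) : ou (c *: 1) = 0.
Proof.
by rewrite /ou big1// => i _; rewrite mderiv_cst mulr0 raddf0 subr0.
Qed.

Lemma ou_sum I (r : seq I) (F : I -> A) :
  ou (\sum_(i <- r) F i) = \sum_(i <- r) ou (F i).
Proof.
elim: r => [|i r ih]; last by rewrite !big_cons ouD ih.
rewrite !big_nil (_ : 0 = 0 *: 1) ?ou_cst ?scale0r//.
Qed.

(** The defect of Leibniz's rule for a second-order operator is twice the carré du champ. For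
    eigenvectors this makes [gam a b] the image of [a * b] under a shift of [ou]. *)
Lemma ouM a b : ou (a * b) = a * ou b + b * ou a + 2 *: gam a b.
Proof.
rewrite /ou /gam !mulr_sumr scaler_sumr -!big_split/=; apply: eq_bigr => i _.
rewrite !mderivM !mderivD !mderivM scaler_nat; ring.
Qed.

Lemma gam_mvar i a : gam (mvar i) a = mderiv i a.
Proof.
rewrite /gam (bigD1 i)//= mderiv_mvar eqxx mul1r big1 ?addr0// => j ji.
by rewrite mderiv_mvar (negbTE ji) mul0r.
Qed.

Lemma ou_mvar i : ou (mvar i) = - mvar i.
Proof.
rewrite /ou (bigD1 i)//= big1 ?addr0 => [|j ji].
  by rewrite mderiv_mvar eqxx mulr1 -[1]scale1r mderiv_cst sub0r.
by rewrite mderiv_mvar (negbTE ji) mulr0 subr0 raddf0.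
Qed.

Lemma pdegW m a : pdeg m a -> forall k, (m <= k)%N -> pdeg k a.
Proof.
elim=> [? c k _|{}m i b _ ih [//|k] mk|{}m b b' _ ihb _ ihb' k mk].
- exact: pdeg_cst.
- exact/pdeg_var/ih.
- by apply: pdeg_add; [exact: ihb|exact: ihb'].
Qed.

Lemma pdeg0P m a : pdeg m a -> m = 0%N -> exists c, a = c *: 1.
Proof.
elim=> [? c _|//|? b b' _ ihb _ ihb' m0]; first by exists c.
have [c ->] := ihb m0; have [c' ->] := ihb' m0.
by exists (c + c'); rewrite scalerDl.
Qed.

Lemma pdegZ m a (c : R) : pdeg m a -> pdeg m (c *: a).
Proof.
elim=> [? c'|{}m i b _ ih|? b b' _ ihb _ ihb'].
- by rewrite scalerA; exact: pdeg_cst.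
- by rewrite scalerAr; exact: pdeg_var.
- by rewrite scalerDr; exact: pdeg_add.
Qed.

Lemma pdegB m a b : pdeg m a -> pdeg m b -> pdeg m (a - b).
Proof. by move=> ma mb; rewrite -scaleN1r; exact/pdeg_add/pdegZ. Qed.

Lemma pdegM m k a b : pdeg m a -> pdeg k b -> pdeg (m + k) (a * b).
Proof.
move=> ma kb; elim: ma => [m' c|m' i a' _ ih|m' a' a'' _ ih' _ ih''].
- rewrite -scalerAl mul1r; apply/pdegZ/(pdegW kb); exact: leq_addl.
- by rewrite -mulrA addSn; exact: pdeg_var.
- by rewrite mulrDl; exact: pdeg_add.
Qed.

Lemma pdeg_sum m I (r : seq I) (P : pred I) (F : I -> A) :
  (forall j, P j -> pdeg m (F j)) -> pdeg m (\sum_(j <- r | P j) F j).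
Proof.
move=> mF; elim/big_rec: _ => [|j a Pj ma]; last by apply: pdeg_add => //; exact: mF.
by rewrite -(scale0r 1); exact: pdeg_cst.
Qed.

Lemma pdeg_mderiv m i a : pdeg m a -> pdeg m.-1 (mderiv i a).
Proof.
elim=> [? c|{}m j b mb ih|? b b' _ ihb _ ihb'].
- by rewrite mderiv_cst -(scale0r 1); exact: pdeg_cst.
- rewrite mderivMvar /=; apply: pdeg_add.
    case: eqP => _; first by rewrite mul1r.
    by rewrite mul0r -(scale0r 1); exact: pdeg_cst.
  case: m mb ih => [|m] mb ih; last exact: pdeg_var.
  have [c ->] := pdeg0P mb erefl.
  by rewrite mderiv_cst mulr0 -(scale0r 1); exact: pdeg_cst.
- by rewrite mderivD; exact: pdeg_add.
Qed.

(* On the homogeneous part of degree m the operator x.grad acts as m, by Euler's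
   identity, so [ou + m] lowers the degree. *)
Lemma pdeg_ou m a : pdeg m a ->
  if m is k.+1 then pdeg k (ou a + m%:R *: a) else ou a = 0.
Proof.
elim=> [[|k] c|{}m i b mb ih|[|k] b b' _ ihb _ ihb'].
- exact: ou_cst.
- by rewrite ou_cst add0r scalerA; exact: pdeg_cst.
- have -> : ou (mvar i * b) + m.+1%:R *: (mvar i * b) =
     mvar i * (ou b + m%:R *: b) + 2 *: mderiv i b.
    by rewrite ouM ou_mvar gam_mvar -natr1 !scaler_nat -scaler_nat scaler_nat; ring.
  apply: pdeg_add; last by apply/pdegZ/(pdegW (pdeg_mderiv _ mb))/leq_pred.
  case: m mb ih => [|m] mb ih; last exact: pdeg_var.
  by rewrite ih scale0r addr0 mulr0 -(scale0r 1); exact: pdeg_cst.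
- by rewrite ouD ihb ihb' addr0.
- by rewrite ouD scalerDr addrACA; exact: pdeg_add.
Qed.

(** The chaos decomposition of a polynomial. The operator [ou + m.+1] lowers the degree, so the
    induction hypothesis decomposes its image. On the k-th eigenspace it is multiplication by
    [m.+1 - k]; dividing by this factor recovers the lower components of [a], and the remainder is
    the top one. *)
Lemma ou_decomp m a : pdeg m a -> exists J : nat -> A,
  [/\ a = \sum_(k < m.+1) J k, forall k, ou (J k) = - (k%:R *: J k) &
   exists c, J 0 = c *: 1].
Proof.
elim: m a => [|m ih] a ma; have := pdeg_ou ma.
  move=> a0; exists (fun k => if k == 0%N then a else 0).
  rewrite big_ord_recl big_ord0 addr0; split=> //; last exact: pdeg0P ma _.
  move=> [|k] /=; first by rewrite a0 scale0r oppr0.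
  by rewrite -(scale0r 1) ou_cst scale0r scaler0 oppr0.
move=> /ih[J [aJ eJ [c J0]]].
pose J' k := (m.+1%:R - k%:R)^-1 *: J k.
exists (fun k => if (k < m.+1)%N then J' k else
  if k == m.+1 then a - \sum_(l < m.+1) J' l else 0); split=> [|k|]; last first.
- by exists ((m.+1%:R - 0%:R)^-1 * c); rewrite /= /J' J0 scalerA.
- case: ifPn => [km|_].
  by rewrite /J' ouZ eJ scalerN !scalerA mulrC.
case: eqP => [->{k}|_]; last first.
  by rewrite -(scale0r 1) ou_cst scale0r scaler0 oppr0.
rewrite -scaleN1r ouD ouZ ou_sum.
(* Summed over [i], the terms [J i] give back [ou a + m.+1 a], which leaves exactly the eigenvalue
   [- m.+1] on the remainder. *)
have -> : \sum_(i < m.+1) ou (J' i) =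
    \sum_(i < m.+1) (J i - m.+1%:R *: J' i).
  apply: eq_bigr => i _; rewrite /J' ouZ eJ scalerN !scalerA.
  rewrite -[X in _ = X - _]scale1r -scalerBl -scaleNr; congr (_ *: _).
  have im : (m.+1%:R - i%:R : R) != 0.
    by rewrite subr_eq0 eqr_nat gtn_eqF.
  by move: im; move: (m.+1%:R : R) (i%:R : R) => x y xy; field.
rewrite sumrB -aJ -scaler_sumr !scaleN1r scalerBr; ring.
- rewrite big_ord_recr /= ltnn eqxx (eq_bigr (fun k : 'I_m.+1 => J' k)).
    by rewrite addrC subrK.
  by move=> k _; rewrite ltn_ord.
Qed.

End OrnsteinUhlenbeck.

(** The interface between algebra and probability: all polynomial inequalities use only these four
    properties, which [gaussian_expectation_meval] establishes for an actual Gaussian family. *)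
Record gaussian_expectation (R : rcfType) n (E : mpoly n R -> R) : Prop := {
  gexp_lin : forall (c : R) a b, E (c *: a + b) = c * E a + E b;
  gexp1 : E 1 = 1;
  gexp_sqr : forall a, 0 <= E (a ^+ 2);
  gexp_ibp : forall i a, E (mvar R i * a) = E (mderiv i a) }.

(** * Spectral inequalities and hypercontractivity for polynomials *)

Section GaussianExpectation.
Variables (R : rcfType) (n : nat) (E : mpoly n R -> R).
Hypothesis gE : gaussian_expectation E.
Local Notation A := (mpoly n R).
Implicit Types (a b : A) (c : R).

Let ED a b : E (a + b) = E a + E b.
Proof. by rewrite -[a]scale1r (gexp_lin gE) mul1r scale1r. Qed.

Let E0 : E 0 = 0.
Proof. by have := ED 0 0; rewrite addr0 => /eqP; rewrite -subr_eq0 opprD addrA subrr sub0r oppr_eq0 => /eqP. Qed.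

Let EZ c a : E (c *: a) = c * E a.
Proof. by rewrite -[c *: a]addr0 (gexp_lin gE) E0 addr0. Qed.

Let EN a : E (- a) = - E a.
Proof. by rewrite -scaleN1r EZ mulN1r. Qed.

Let EB a b : E (a - b) = E a - E b.
Proof. by rewrite ED EN. Qed.

Let Esum I (r : seq I) (P : pred I) (F : I -> A) :
  E (\sum_(i <- r | P i) F i) = \sum_(i <- r | P i) E (F i).
Proof. by elim/big_rec2: _ => [|i x y _ <-]; rewrite ?ED. Qed.

Let Ec c : E (c *: 1) = c.
Proof. by rewrite EZ (gexp1 gE) mulr1. Qed.

Lemma gexp_CS a b : E (a * b) ^+ 2 <= E (a ^+ 2) * E (b ^+ 2).
Proof.
apply: quadratic_discriminant => t; have := gexp_sqr gE (a - t *: b).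
have -> : (a - t *: b) ^+ 2 = a ^+ 2 - (2 * t) *: (a * b) + t ^+ 2 *: (b ^+ 2).
  by rewrite sqrrB exprZn -scalerAr -[_ *+ 2]scaler_nat scalerA.
by rewrite ED EB !EZ.
Qed.

Lemma gexp_ou a b : E (a * ou b) = - E (gam a b).
Proof.
rewrite /ou /gam mulr_sumr !Esum -sumrN; apply: eq_bigr => i _.
have -> : a * (mderiv i (mderiv i b) - mvar R i * mderiv i b) =
   mderiv i (a * mderiv i b) - mderiv i a * mderiv i b -
     mvar R i * (a * mderiv i b).
  by rewrite mderivM; ring.
rewrite !EB (gexp_ibp gE); ring.
Qed.

Lemma gexp_ouC a b : E (a * ou b) = E (b * ou a).
Proof. by rewrite !gexp_ou gamC. Qed.

Lemma gexp_eigen0 k a : ou a = - (k.+1%:R *: a) -> E a = 0.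
Proof.
move=> eJ; have := gexp_ou 1 a.
rewrite -[1]scale1r gam_cst scale1r mul1r eJ EN EZ E0 oppr0 => /eqP.
by rewrite oppr_eq0 mulf_eq0 pnatr_eq0 => /eqP.
Qed.

Lemma gexp_orth (k l : nat) a b : ou a = - (k%:R *: a) ->
  ou b = - (l%:R *: b) -> k != l -> E (a * b) = 0.
Proof.
move=> ea eb kl; have := gexp_ouC a b.
rewrite ea eb !mulrN -!scalerAr !EN !EZ (mulrC b) => /eqP.
rewrite eqr_opp -subr_eq0 -mulrBl mulf_eq0 subr_eq0 eqr_nat eq_sym.
by rewrite (negbTE kl) => /eqP.
Qed.

Let comb m (s : nat -> R) (J : nat -> A) := \sum_(k < m) s k *: J k.

(** Parseval's identity, by orthogonality of eigenvectors with distinct eigenvalues. It reduces an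
    inequality between spectral multipliers to a comparison of real coefficients. *)
Lemma gexp_comb m (J : nat -> A) (s t : nat -> R) :
  (forall k, ou (J k) = - (k%:R *: J k)) ->
  E (comb m s J * comb m t J) =
  \sum_(k < m) s k * t k * E (J k ^+ 2).
Proof.
move=> eJ; rewrite mulr_suml Esum; apply: eq_bigr => k _.
rewrite mulr_sumr Esum (bigD1 k)//= big1 ?addr0 => [|l lk].
  by rewrite -scalerAl -scalerAr scalerA EZ.
by rewrite -scalerAl -scalerAr !EZ (gexp_orth (eJ k) (eJ l)) ?mulr0// eq_sym.
Qed.

Lemma ou_comb m (J : nat -> A) (s : nat -> R) :
  (forall k, ou (J k) = - (k%:R *: J k)) ->
  ou (comb m s J) = comb m (fun k => - (s k * k%:R)) J.
Proof.
move=> eJ; rewrite ou_sum; apply: eq_bigr => k _.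
by rewrite ouZ eJ scalerN scalerA scaleNr.
Qed.

Let sum1Z m (J : nat -> A) :
  \sum_(k < m) J k = comb m (fun=> 1) J.
Proof. by apply: eq_bigr => k _; rewrite scale1r. Qed.

(** On the k-th component this is [(m - k) ^+ 2 <= m * (m - k)], valid because only [0 <= k <= m]
    occurs. *)
Lemma gexp_spec m a : pdeg m a ->
  E ((ou a + m%:R *: a) ^+ 2) <= m%:R * E (a * (ou a + m%:R *: a)).
Proof.
move=> /ou_decomp[J [aJ eJ _]].
have -> : ou a + m%:R *: a =
    comb m.+1 (fun k => m%:R - k%:R) J.
  rewrite aJ sum1Z ou_comb// /comb scaler_sumr -big_split/=.
  by apply: eq_bigr => k _; rewrite scalerA -scalerDl; congr (_ *: _); ring.
rewrite expr2 aJ sum1Z !gexp_comb// mulr_sumr; apply: ler_sum => k _.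
rewrite mul1r mulrA ler_wpM2r ?(gexp_sqr gE)//.
by rewrite ler_wpM2r ?subr_ge0 ?ler_nat ?leq_ord// lerBlDr lerDl.
Qed.

(** Removing the mean removes the component [k = 0]; on the others the right-hand side carries the
    weight [k >= 1]. *)
Lemma gexp_poincare m a : pdeg m a ->
  E (a ^+ 2) - E a ^+ 2 <= E (gam a a).
Proof.
move=> /ou_decomp[J [aJ eJ [c J0]]].
have Ea : E a = c.
  rewrite aJ big_ord_recl ED J0 Ec Esum big1 ?addr0// => k _.
  exact/gexp_eigen0/eJ.
rewrite -[E (gam _ _)]opprK -gexp_ou Ea expr2 aJ sum1Z ou_comb// !gexp_comb//.
rewrite big_ord_recl /= J0 exprZn expr1n Ec !mul1r addrAC subrr add0r.
rewrite [X in - X]big_ord_recl /= mulr0 oppr0 mulr0 mul0r add0r -sumrN.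
apply: ler_sum => k _; rewrite !mul1r mulNr opprK /bump add1n.
by rewrite ler_peMl ?(gexp_sqr gE)// ler1n.
Qed.

Lemma gexp_gam_le m a : pdeg m a -> E (gam a a) <= m%:R * E (a ^+ 2).
Proof.
move=> /ou_decomp[J [aJ eJ _]].
rewrite -[E (gam _ _)]opprK -gexp_ou expr2 aJ sum1Z ou_comb// !gexp_comb//.
rewrite -sumrN mulr_sumr; apply: ler_sum => k _.
rewrite !mul1r mulNr opprK ler_wpM2r ?(gexp_sqr gE)//.
by rewrite ler_nat leq_ord.
Qed.

(** The recurrence comes from the inductive step of hypercontractivity: with [s ^+ 2 = E (S ^+ 2)]
    and [e = E S] it yields [s ^+ 2 - e ^+ 2 <= K * e * s] for [K = 4 * hyper_const k * k.+1], and
    this forces [s <= (1 + K) * e]. *)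
Fixpoint hyper_const (m : nat) : R :=
  if m is k.+1 then 1 + 4 * hyper_const k * m%:R else 1.

Lemma hyper_const_ge0 m : 0 <= hyper_const m.
Proof. by elim: m => //= m ih; rewrite addr_ge0// !mulr_ge0. Qed.

Let sqr_sum_ge0 I (r : seq I) (F : I -> A) : 0 <= E (\sum_(i <- r) F i ^+ 2).
Proof. by rewrite Esum sumr_ge0// => i _; exact: gexp_sqr. Qed.

(* Lagrange's identity exhibits the defect as a sum of squares. *)
Let sum_CS (I : finType) (a b : I -> A) :
  E ((\sum_i a i * b i) ^+ 2) <=
  E ((\sum_i a i ^+ 2) * (\sum_i b i ^+ 2)).
Proof.
rewrite -subr_ge0 -EB.
have -> : (\sum_i a i ^+ 2) * (\sum_i b i ^+ 2) - (\sum_i a i * b i) ^+ 2 =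
    2^-1 *: \sum_i \sum_j (a i * b j - a j * b i) ^+ 2.
  have e : \sum_i \sum_j (a i * b j - a j * b i) ^+ 2 =
      2 * ((\sum_i a i ^+ 2) * (\sum_i b i ^+ 2) - (\sum_i a i * b i) ^+ 2).
    transitivity (\sum_i \sum_j (a i ^+ 2 * b j ^+ 2) +
      \sum_i \sum_j (b i ^+ 2 * a j ^+ 2) -
      2 * \sum_i \sum_j ((a i * b i) * (a j * b j))).
      rewrite mulr_sumr -sumrN -!big_split/=; apply: eq_bigr => i _.
      rewrite mulr_sumr -sumrN -!big_split/=; apply: eq_bigr => j _; ring.
    have dbl (f g : I -> A) :
        \sum_i \sum_j f i * g j = (\sum_i f i) * (\sum_i g i).
      by rewrite mulr_suml; apply: eq_bigr => i _; rewrite mulr_sumr.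
    rewrite !dbl; ring.
  by rewrite e mulr_natl -(scaler_nat 2 (_ - _)) scalerA mulVf ?pnatr_eq0// scale1r.
rewrite EZ mulr_ge0 ?invr_ge0// Esum sumr_ge0// => i _; exact: sqr_sum_ge0.
Qed.

(* The degree of the polynomials decreases under differentiation, which is why
   the estimate is stated for families: the inductive step applies it to the
   whole family of partial derivatives. *)
Lemma hypercontractivity_family m (I : finType) (a : I -> A) :
  (forall i, pdeg m (a i)) ->
  E ((\sum_i a i ^+ 2) ^+ 2) <=
    hyper_const m ^+ 2 * E (\sum_i a i ^+ 2) ^+ 2.
Proof.
elim: m I a => [|m ih] I a ma.
  have /fin_all_exists[c ac] : forall i, exists c, a i = c *: 1.
    by move=> i; exact: pdeg0P (ma i) _.
  have -> : \sum_i a i ^+ 2 = (\sum_i c i ^+ 2) *: 1.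
    by rewrite scaler_suml; apply: eq_bigr => i _; rewrite ac exprZn expr1n.
  by rewrite exprZn expr1n !Ec expr1n mul1r.
set S := \sum_i a i ^+ 2.
pose b (u : I * 'I_n) := mderiv u.2 (a u.1).
set T := \sum_u b u ^+ 2.
have degb u : pdeg m (b u) by exact: (pdeg_mderiv _ (ma u.1)).
have {ih} hT := ih _ b degb; rewrite -/T in hT.
have ET : E T = \sum_i E (gam (a i) (a i)).
  rewrite /T -(pair_bigA _ (fun i k => b (i, k) ^+ 2))/= Esum.
  by apply: eq_bigr => i _.
have leT : E T <= m.+1%:R * E S.
  rewrite ET Esum mulr_sumr; apply: ler_sum => i _; exact: gexp_gam_le.
have S0 : 0 <= E S by exact: sqr_sum_ge0.
have T0 : 0 <= E T by exact: sqr_sum_ge0.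
have degS : pdeg (m.+1 + m.+1) S.
  by apply: pdeg_sum => i _; rewrite expr2; exact: pdegM.
(* Each [mderiv k S] is [2 * sum_i a_i * mderiv k a_i]; Cauchy-Schwarz over [i], inside the
   expectation, bounds its square by [4 * S] times the k-th part of [T]. *)
have gamS : E (gam S S) <= 4 * E (S * T).
  have dS k : mderiv k S = 2 *: \sum_i a i * mderiv k (a i).
    rewrite /S raddf_sum scaler_sumr; apply: eq_bigr => i _ /=.
    rewrite expr2 mderivM scaler_nat; ring.
  have -> : 4 * E (S * T) = \sum_k 4 * E (S * \sum_i (mderiv k (a i)) ^+ 2).
    rewrite -mulr_sumr -Esum -mulr_sumr; congr (_ * E (_ * _)).
    by rewrite exchange_big/= /T -(pair_bigA _ (fun i k => b (i, k) ^+ 2)).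
  rewrite /gam Esum; apply: ler_sum => k _.
  rewrite dS -expr2 exprZn EZ.
  have -> : 2 ^+ 2 = 4 :> R by ring.
  by rewrite ler_wpM2l//; exact: sum_CS.
have CS := gexp_CS S T.
have poin := gexp_poincare degS.
have D0 := hyper_const_ge0 m.
set D := hyper_const m in hT D0 *.
pose s := Num.sqrt (E (S ^+ 2)).
have s0 : 0 <= s by exact: sqrtr_ge0.
have sE : E (S ^+ 2) = s ^+ 2 by rewrite sqr_sqrtr// (gexp_sqr gE).
have ST : E (S * T) <= s * (D * (m.+1%:R * E S)).
  apply: (@le_trans _ _ `|E (S * T)|); first exact: ler_norm.
  have X0 : 0 <= s * (D * (m.+1%:R * E S)) by rewrite !mulr_ge0.
  rewrite -(@ler_pXn2r _ 2) ?nnegrE// real_normK ?num_real//.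
  apply: (le_trans CS); rewrite sE exprMn ler_wpM2l ?sqr_ge0//.
  apply: (le_trans hT); rewrite exprMn ler_wpM2l ?sqr_ge0//.
  by rewrite ler_sqr ?nnegrE// mulr_ge0.
rewrite sE /= -/D -exprMn ler_sqr ?nnegrE ?mulr_ge0 ?addr_ge0 ?mulr_ge0//.
rewrite leNgt; apply/negP => lts.
have {poin gamS ST} : s ^+ 2 - E S ^+ 2 <= 4 * (s * (D * (m.+1%:R * E S))).
  by rewrite -sE; apply: (le_trans poin); apply: (le_trans gamS); rewrite ler_wpM2l.
move: lts; move: (E S) S0 => e e0; rewrite mulrDl mul1r.
set K := 4 * D * m.+1%:R => lts.
have K0 : 0 <= K by rewrite !mulr_ge0.
have -> : 4 * (s * (D * (m.+1%:R * e))) = K * e * s by rewrite /K; ring.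
have Ke : 0 <= K * e by rewrite mulr_ge0.
nra.
Qed.

Lemma hypercontractivity m a : pdeg m a ->
  E (a ^+ 4) <= hyper_const m ^+ 2 * E (a ^+ 2) ^+ 2.
Proof.
move=> ma; have := @hypercontractivity_family m 'I_1 (fun=> a) (fun=> ma).
by rewrite !big_ord1 -exprM.
Qed.

(** * The fourth moment inequality and the mixed carré du champ *)

Section FourthMoment.
Variables (p : nat) (x : A).
Hypotheses (degx : pdeg p x) (eigx : ou x = - (p%:R *: x)).

Let e := E (x ^+ 2).

Let ou_sqr : ou (x ^+ 2) + (p + p)%:R *: x ^+ 2 = 2 *: gam x x.
Proof.
by rewrite expr2 ouM eigx (natrD _ p p) (scalerDl _ p%:R) !mulrN -!scalerAr; ring.
Qed.

Lemma gexp_gam_eigen a : E (gam a x) = p%:R * E (a * x).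
Proof. by rewrite -[LHS]opprK -gexp_ou eigx mulrN EN opprK -scalerAr EZ. Qed.

(** Apply [gexp_spec] to [x ^+ 2 - e], of degree [2 p]: its image under [ou + 2 p] is twice the
    centered carré du champ. The right-hand side becomes the fourth cumulant through [E (x ^+ 2 *
    gam x x) = p / 3 * E (x ^+ 4)], which is integration by parts against [x ^+ 3]. *)
Lemma fourth_moment_gam :
  E ((gam x x - (p%:R * e) *: 1) ^+ 2) <=
    p%:R ^+ 2 / 3 * (E (x ^+ 4) - 3 * e ^+ 2).
Proof.
have deg2 : pdeg (p + p) (x ^+ 2 - e *: 1).
  by apply: pdegB; [rewrite expr2; exact: pdegM|exact: pdeg_cst].
have := gexp_spec deg2.
have -> : ou (x ^+ 2 - e *: 1) + (p + p)%:R *: (x ^+ 2 - e *: 1) =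
    2 *: (gam x x - (p%:R * e) *: 1).
  rewrite -scaleNr ouD ou_cst addr0 scalerDr addrA ou_sqr scalerBr; congr (_ + _).
  by rewrite !scalerA -scaleNr; congr (_ *: _); rewrite (natrD _ p p); ring.
rewrite exprZn -scalerAr !EZ.
have Eg : E (gam x x) = p%:R * e by rewrite gexp_gam_eigen -expr2.
have EX : E (x ^+ 2 * gam x x) = p%:R / 3 * E (x ^+ 4).
  have : E (gam (x ^+ 3) x) = 3 * E (x ^+ 2 * gam x x).
    by rewrite -EZ; congr E; rewrite !exprS expr0 mulr1 !gamMl scaler_nat; ring.
  rewrite gexp_gam_eigen -exprSr => h.
  have : E (x ^+ 2 * gam x x) = (3 * E (x ^+ 2 * gam x x)) / 3 by field.
  by rewrite -h => ->; field.
have -> : E ((x ^+ 2 - e *: 1) * (gam x x - (p%:R * e) *: 1)) =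
    p%:R / 3 * E (x ^+ 4) - p%:R * e ^+ 2.
  rewrite -EX mulrBr !mulrBl -![in LHS]scalerAr !mulr1 -![in LHS]scalerAl !mul1r.
  rewrite !EB !EZ Eg -/e (gexp1 gE); ring.
rewrite (natrD _ p p).
move: (E _) (E _) => u v; lra.
Qed.

(* [V] solves [(L + 2 p) V = - L (y ^ 2)]; it exists because [y ^ 2] has degree
   at most [2 q < 2 p], so that [2 p] is not hit by the spectrum. *)
Lemma gam_lower_order q y : (q < p)%N -> pdeg q y -> ou y = - (q%:R *: y) ->
  E (gam x y ^+ 2) ^+ 2 <= ((p + q) * q)%:R ^+ 2 * E (y ^+ 4) *
    E ((gam x x - (p%:R * e) *: 1) ^+ 2).
Proof.
move=> qp degy eigy.
have degxy : pdeg (p + q) (x * y) by exact: pdegM.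
have := gexp_spec degxy.
have -> : ou (x * y) + (p + q)%:R *: (x * y) = 2 *: gam x y.
  by rewrite ouM eigx eigy (natrD _ p q) (scalerDl _ p%:R) !mulrN -!scalerAr (mulrC y x); ring.
rewrite exprZn -scalerAr !EZ => spec.
have dq : pdeg (q + q) (y ^+ 2) by rewrite expr2; exact: pdegM.
have [J [yJ eJ _]] := ou_decomp dq.
pose t k : R := k%:R / ((p + p)%:R - k%:R).
pose V : A := comb (q + q).+1 t J.
have kp (k : 'I_(q + q).+1) : 1 <= (p + p)%:R - k%:R :> R.
  rewrite lerBrDr addrC natr1 ler_nat (leq_ltn_trans (leq_ord k))//.
  by rewrite -addSn leq_add// ltnW.
have eV : ou V + (p + p)%:R *: V = - ou (y ^+ 2).
  rewrite yJ sum1Z !ou_comb// /comb scaler_sumr -sumrN -big_split/=.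
  apply: eq_bigr => k _; rewrite mul1r -(scaleNr _ (J k)) opprK scalerA -scalerDl.
  congr (_ *: _); rewrite /t; have := kp k.
  move: ((p + p)%:R : R) (k%:R : R) => u v uv; field.
  by rewrite gt_eqF// (lt_le_trans _ uv).
have EV : E V = 0.
  rewrite /V /comb big_ord_recl ED EZ /t mul0r mul0r add0r Esum big1// => k _.
  by rewrite EZ (gexp_eigen0 (eJ _)) mulr0.
(* Every multiplier satisfies [0 <= t k <= 2 q], since its numerator is at most [2 q] and its
   denominator at least 1. *)
have EV2 : E (V ^+ 2) <= (2 * q%:R) ^+ 2 * E (y ^+ 4).
  have -> : E (y ^+ 4) = E (y ^+ 2 * y ^+ 2) by rewrite -exprD.
  rewrite expr2 yJ sum1Z !gexp_comb// mulr_sumr; apply: ler_sum => k _.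
  rewrite mul1r mul1r ler_wpM2r ?(gexp_sqr gE)// -expr2.
  have t0 : 0 <= t k by rewrite /t divr_ge0// (le_trans _ (kp k)).
  rewrite ler_sqr ?nnegrE// ?mulr_ge0// /t ler_pdivrMr ?(lt_le_trans _ (kp k))//.
  have kq : k%:R <= 2 * q%:R :> R.
    by rewrite -natrM ler_nat mul2n -addnn leq_ord.
  by apply: (le_trans kq); rewrite ler_peMr// mulr_ge0.
set c := p%:R * e in spec *; set g := gam x x - c *: 1.
(* Self-adjointness equates [E (x ^+ 2 * ou (y ^+ 2))] with [E (y ^+ 2 * ou (x ^+ 2))]. The first is
   expressed by [V] and [gam x x], the second by [x * y * gam x y] through [gam (x * y ^+ 2) x]. As
   [V] is centered, [gam x x] may be replaced by [g], whose second moment is the fourth-moment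
   defect. *)
have XYK : 2 * E (x * y * gam x y) = E (V * g).
  have h1 : 2 * E (x * y * gam x y) = p%:R * E (x ^+ 2 * y ^+ 2) - E (y ^+ 2 * gam x x).
    have : E (gam (x * y ^+ 2) x) = 2 * E (x * y * gam x y) + E (y ^+ 2 * gam x x).
      rewrite -EZ -ED; congr E; rewrite gamMl expr2 gamMl (gamC y x) scaler_nat; ring.
    rewrite gexp_gam_eigen => h; rewrite -[LHS](addrK (E (y ^+ 2 * gam x x))) -h.
    by congr (_ * E _ - _); ring.
  have h2 : E (y ^+ 2 * ou (x ^+ 2)) = 2 * E (y ^+ 2 * gam x x) - 2 * (p%:R * E (x ^+ 2 * y ^+ 2)).
    rewrite -[ou (x ^+ 2)](addrK ((p + p)%:R *: x ^+ 2)) ou_sqr mulrBr EB -!(scalerAr _ (y ^+ 2)) !EZ.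
    by rewrite (natrD _ p p) (mulrC (y ^+ 2) (x ^+ 2)); ring.
  have h3 : E (x ^+ 2 * ou (y ^+ 2)) = - (2 * E (V * gam x x)).
    rewrite -[ou (y ^+ 2)]opprK -eV mulrN EN mulrDr ED gexp_ouC -scalerAr (mulrC _ V).
    by rewrite scalerAr -ED -mulrDr ou_sqr -scalerAr EZ.
  have h4 : E (V * gam x x) = E (V * g).
    by rewrite /g mulrBr -scalerAr mulr1 EB EZ EV mulr0 subr0.
  rewrite -h4; move: h1 h2; rewrite gexp_ouC h3; lra.
have K0 := gexp_sqr gE (gam x y).
have CS := gexp_CS V g.
have bound : E (gam x y ^+ 2) <= (p + q)%:R / 4 * E (V * g).
  rewrite -XYK; move: spec; move: (E (gam x y ^+ 2)) (E _) => u v.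
  rewrite expr2; lra.
apply: (@le_trans _ _ (((p + q)%:R / 4 * E (V * g)) ^+ 2)).
  by rewrite ler_sqr ?nnegrE// (le_trans K0).
rewrite exprMn.
apply: (@le_trans _ _ (((p + q)%:R / 4) ^+ 2 * ((2 * q%:R) ^+ 2 * E (y ^+ 4) * E (g ^+ 2)))).
  rewrite ler_wpM2l ?sqr_ge0//; apply: (le_trans CS).
  by rewrite ler_wpM2r ?(gexp_sqr gE).
have y4 : 0 <= E (y ^+ 4) by rewrite (exprM y 2 2) (gexp_sqr gE).
have g2 := gexp_sqr gE g.
rewrite -subr_ge0 natrM.
have -> : ((p + q)%:R * q%:R) ^+ 2 * E (y ^+ 4) * E (g ^+ 2) -
  ((p + q)%:R / 4) ^+ 2 * ((2 * q%:R) ^+ 2 * E (y ^+ 4) * E (g ^+ 2)) =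
  3 / 4 * (((p + q)%:R * q%:R) ^+ 2 * (E (y ^+ 4) * E (g ^+ 2))).
  by move: (E _) (E _) => u v; field.
by rewrite mulr_ge0 ?divr_ge0// mulr_ge0 ?sqr_ge0// mulr_ge0.
Qed.

End FourthMoment.
End GaussianExpectation.

(** * One-dimensional Gaussian measures *)

Section Integrals.
Context d (T : measurableType d) (R : realType) (P : probability T R).
Implicit Types (f g : T -> R).

Definition intg f := P.-integrable setT (EFin \o f).

Lemma intg_meas f : intg f -> measurable_fun setT f.
Proof. by move=> /integrableP[/measurable_EFinP]. Qed.

Lemma intg_le f g : measurable_fun setT f -> (forall x, `|f x| <= g x) ->
  intg g -> intg f.
Proof.
move=> mf fg; apply: le_integrable => //; first exact/measurable_EFinP.
by move=> x _ /=; rewrite lee_fin (le_trans (fg x))// ler_norm.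
Qed.

Lemma intg_cst c : intg (fun=> c).
Proof. exact: finite_measure_integrable_cst. Qed.

Lemma intg_bounded f c : measurable_fun setT f -> (forall x, `|f x| <= c) ->
  intg f.
Proof. by move=> mf fc; exact: intg_le mf fc (intg_cst c). Qed.

Lemma intg_boundedM f g c : measurable_fun setT f -> (forall x, `|f x| <= c) ->
  measurable_fun setT g -> (forall x, `|g x| <= 1) -> intg (fun x => f x * g x).
Proof.
move=> mf fc mg g1; apply: (@intg_bounded _ c); first exact: measurable_funM.
by move=> x; rewrite normrM -[c]mulr1 ler_pM.
Qed.

Lemma intgD f g : intg f -> intg g -> intg (fun x => f x + g x).
Proof. by move=> If Ig; have := integrableD measurableT If Ig. Qed.

Lemma intgZ c f : intg f -> intg (fun x => c * f x).
Proof. by move=> If; have := integrableZl measurableT c If. Qed.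

Lemma intgB f g : intg f -> intg g -> intg (fun x => f x - g x).
Proof. by move=> If Ig; have := integrableB measurableT If Ig. Qed.

Lemma intg_norm f : intg f -> intg (fun x => `|f x|).
Proof. by move=> If; have := integrable_norm If. Qed.

Lemma intg_sum I (r : seq I) (F : I -> T -> R) :
  (forall i, intg (F i)) -> intg (fun x => \sum_(i <- r) F i x).
Proof.
move=> IF; elim: r => [|i r ih].
  by under [X in intg X]eq_fun do rewrite big_nil; exact: intg_cst.
by under [X in intg X]eq_fun do rewrite big_cons; exact: intgD.
Qed.

(** Expectations are real numbers so that field tactics apply. An infinite integral is sent to 0,
    which is why integrability travels separately as [intg]. *)
Definition Ex f : R := \int[P]_x f x.

Lemma eq_Ex f g : f =1 g -> Ex f = Ex g.
Proof. by move=> fg; apply: eq_Rintegral => x _. Qed.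

Lemma Ex_cst c : Ex (fun=> c) = c.
Proof.
rewrite /Ex Rintegral_cst//.
have -> : fine (P setT) = 1 by rewrite probability_setT.
by rewrite mulr1.
Qed.

Lemma ExD f g : intg f -> intg g -> Ex (fun x => f x + g x) = Ex f + Ex g.
Proof. exact: RintegralD. Qed.

Lemma ExB f g : intg f -> intg g -> Ex (fun x => f x - g x) = Ex f - Ex g.
Proof. exact: RintegralB. Qed.

Lemma ExZ c f : intg f -> Ex (fun x => c * f x) = c * Ex f.
Proof. by move=> If; exact: RintegralZl. Qed.

Lemma Ex_sum I (r : seq I) (F : I -> T -> R) : (forall i, intg (F i)) ->
  Ex (fun x => \sum_(i <- r) F i x) = \sum_(i <- r) Ex (F i).
Proof.
move=> IF; elim: r => [|i r ih].
  by under eq_Ex do rewrite big_nil; rewrite Ex_cst big_nil.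
under eq_Ex do rewrite big_cons.
by rewrite ExD ?big_cons ?ih//; exact: intg_sum.
Qed.

Lemma Ex_ge0 f : (forall x, 0 <= f x) -> 0 <= Ex f.
Proof. by move=> f0; exact: Rintegral_ge0. Qed.

Lemma Ex_le f g : intg f -> intg g -> (forall x, f x <= g x) -> Ex f <= Ex g.
Proof. by move=> If Ig fg; apply: le_Rintegral => // x _. Qed.

Lemma Ex_norm f : intg f -> `|Ex f| <= Ex (fun x => `|f x|).
Proof. by move=> If; exact: le_normr_Rintegral. Qed.

Lemma Ex_norm_le f g : measurable_fun setT f -> (forall x, `|f x| <= g x) ->
  intg g -> `|Ex f| <= Ex g.
Proof.
move=> mf fg Ig; have If := intg_le mf fg Ig.
by apply: (le_trans (Ex_norm If)); apply: Ex_le => //; exact: intg_norm.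
Qed.

Lemma Ex_bounded f c : measurable_fun setT f -> (forall x, `|f x| <= c) ->
  `|Ex f| <= c.
Proof. by move=> mf fc; rewrite -[c]Ex_cst; exact: Ex_norm_le (intg_cst c). Qed.

Lemma intgM2 f g : measurable_fun setT f -> measurable_fun setT g ->
  intg (fun x => f x ^+ 2) -> intg (fun x => g x ^+ 2) ->
  intg (fun x => f x * g x).
Proof.
move=> mf mg f2 g2; apply: (intg_le _ _ (intgD f2 g2)).
  exact: measurable_funM.
move=> x; rewrite ler_norml; apply/andP; split; nra.
Qed.

Lemma Ex_CS f g : measurable_fun setT f -> measurable_fun setT g ->
  intg (fun x => f x ^+ 2) -> intg (fun x => g x ^+ 2) ->
  Ex (fun x => f x * g x) ^+ 2 <= Ex (fun x => f x ^+ 2) * Ex (fun x => g x ^+ 2).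
Proof.
move=> mf mg f2 g2; have fg := intgM2 mf mg f2 g2.
apply: quadratic_discriminant => t.
rewrite -!ExZ// -ExB//; last exact: intgZ.
rewrite -ExD; [|exact/intgB/intgZ|exact: intgZ].
by apply: Ex_ge0 => x; rewrite (_ : _ + _ = (f x - t * g x) ^+ 2) ?sqr_ge0//; ring.
Qed.

Lemma Ex_sqr_le f : measurable_fun setT f -> intg (fun x => f x ^+ 2) ->
  Ex (fun x => `|f x|) <= Num.sqrt (Ex (fun x => f x ^+ 2)).
Proof.
move=> mf f2.
have c1 : intg (fun x => 1 ^+ 2) by exact: intg_cst.
have f2' : intg (fun x => `|f x| ^+ 2).
  by under [X in intg X]eq_fun do rewrite real_normK ?num_real//.
have := Ex_CS (measurableT_comp (@normr_measurable R setT) mf) (@measurable_cst _ _ _ _ setT (1 : R)) f2' c1.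
under eq_Ex do rewrite mulr1.
rewrite (_ : Ex (fun=> 1 ^+ 2) = 1); last by rewrite Ex_cst expr1n.
rewrite mulr1.
under [X in _ <= X]eq_Ex do rewrite real_normK ?num_real//.
move=> h; rewrite -[leLHS]ger0_norm; last by apply: Ex_ge0.
by rewrite -sqrtr_sqr ler_wsqrtr.
Qed.

Lemma Ex_fin f : intg f -> (Ex f)%:E = (\int[P]_x (f x)%:E)%E.
Proof. by move=> If; rewrite /Ex /Rintegral fineK//; exact: integrable_fin_num. Qed.

Lemma Ex_cvg_bounded (F : nat -> T -> R) f c :
  (forall n, measurable_fun setT (F n)) -> measurable_fun setT f ->
  (forall n x, `|F n x| <= c) -> {ae P, forall x, F n x @[n --> \oo] --> f x} ->
  Ex (F n) @[n --> \oo] --> Ex f.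
Proof.
move=> mF mf Fc Ff.
have [|||||If _ h] := @dominated_convergence _ _ _ P setT measurableT
  (fun n x => (F n x)%:E) (EFin \o f) (fun=> c%:E).
- by move=> n; exact/measurable_EFinP.
- exact/measurable_EFinP.
- by apply: filterS Ff => x Ffx _; apply: cvg_EFin => //; exact: nearW.
- exact: finite_measure_integrable_cst.
- by apply: aeW => x n _; rewrite lee_fin.
by apply: fine_cvg; rewrite fineK//; exact: integrable_fin_num.
Qed.

End Integrals.

Lemma intg_transfer {R : realType} d (T : measurableType d) (P : probability T R)
    d' (T' : measurableType d') (Q : probability T' R) (U : T -> T') (f : T' -> R) :
  measurable_fun setT U -> (forall A, measurable A -> P (U @^-1` A) = Q A) ->
  intg Q f -> intg P (f \o U) /\ Ex P (f \o U) = Ex Q f.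
Proof.
move=> mU hU If; have mf := intg_meas If.
have I : intg P (f \o U).
  apply/integrableP; split; first by apply/measurable_EFinP; exact: measurableT_comp.
  move/integrableP : If => [_].
  rewrite (eq_measure_integral
    (measure_function_pushforward__canonical__measure_function_Measure P mU)); last first.
    by move=> A mA _; rewrite /= /pushforward hU.
  rewrite /= ge0_integral_pushforward//.
  by apply/measurable_EFinP; apply: measurableT_comp.
split=> //; rewrite /Ex /Rintegral; congr fine.
rewrite [RHS](eq_measure_integral
    (measure_function_pushforward__canonical__measure_function_Measure P mU)); last first.
  by move=> A mA _; rewrite /= /pushforward hU.
rewrite integral_pushforward//.
by apply/measurable_EFinP.
Qed.

Definition gaussian (R : realType) (s : R) : probability (measurableTypeR R) R :=
  normal_prob 0 s.

Lemma cvg_Rintegral_itvT (R : realType) (h : R -> R) :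
  lebesgue_measure.-integrable setT (EFin \o h) ->
  \int[lebesgue_measure]_(x in `[- n%:R, n%:R]) h x @[n --> \oo] -->
  \int[lebesgue_measure]_x h x.
Proof.
move=> Ih; rewrite /Rintegral.
have mh : measurable_fun setT (EFin \o h) by case/integrableP : Ih.
have := @dominated_cvg _ _ _ lebesgue_measure setT measurableT
  (fun n => (EFin \o h) \_ `[- n%:R, n%:R]) (EFin \o h)
  (fun x => `|(h x)%:E|)%E.
move=> /(_ _ _ _ _ _)/wrap[].
- by move=> n; apply/measurable_restrict => //; rewrite setTI; exact: measurable_funTS.
- move=> x _; apply: cvg_near_cst; near=> n.
  rewrite patchE mem_set//= in_itv/= -ler_norml.
  near: n; exact: nbhs_infty_ger.
- by [].
- exact: integrable_abse.
- move=> n x _; rewrite patchE; case: ifPn => // _; by rewrite abse0 abse_ge0.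
move=> h1; apply: fine_cvg.
rewrite fineK; last exact: integrable_fin_num.
by under eq_fun do rewrite integral_mkcond.
Unshelve. all: by end_near. Qed.

Lemma is_derive_continuous (R : realType) (f df : R -> R) :
  (forall x : R, is_derive x 1 f (df x)) -> continuous f.
Proof.
move=> h x; apply: differentiable_continuous.
by apply/derivable1_diffP; have [] := h x.
Qed.

(** * Integrability and integration by parts for a normal law *)

Section Normal.
Context {R : realType}.
Local Notation mu := (@lebesgue_measure R).
Variable s : R.
Hypothesis s0 : s != 0.
Local Notation N := (gaussian s).
Local Notation phi := (normal_pdf 0 s).

Let mphi : measurable_fun setT (fun x => (phi x)%:E).
Proof. by apply/measurable_EFinP; exact: measurable_normal_pdf. Qed.

(** The Radon-Nikodym derivative and [normal_pdf] have equal integrals over measurable sets, hence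
    agree almost everywhere. *)
Lemma ge0_integral_normal (f : _ -> \bar R) :
  measurable_fun setT f -> (forall x, 0 <= f x)%E ->
  (\int[N]_x f x = \int[mu]_x (f x * (phi x)%:E))%E.
Proof.
move=> mf f0; have dom := normal_prob_dominates 0 s.
rewrite -(Radon_Nikodym_SigmaFinite.change_of_variables dom f0 measurableT mf).
have If := Radon_Nikodym_SigmaFinite.f_integrable dom.
apply: ae_eq_integral => //.
- by apply: emeasurable_funM => //; exact: measurable_int If.
- exact: emeasurable_funM.
apply: ae_eqe_mul2l; apply: integral_ae_eq => // A _ mA.
by rewrite -Radon_Nikodym_SigmaFinite.f_integral.
Qed.

Lemma intg_normalE (f : R -> R) : measurable_fun setT f ->
  intg N f <-> mu.-integrable setT (fun x => (f x * phi x)%:E).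
Proof.
move=> mf; have mfp : measurable_fun setT (fun x => (f x * phi x)%:E).
  by apply/measurable_EFinP/measurable_funM => //; exact: measurable_normal_pdf.
have mfE : measurable_fun setT (EFin \o f) by exact/measurable_EFinP.
have e : (\int[N]_x `|(f x)%:E| = \int[mu]_x `|(f x * phi x)%:E|)%E.
  rewrite ge0_integral_normal//; last exact: measurableT_comp.
  by apply: eq_integral => x _; rewrite -EFinM /= normrM (ger0_norm (normal_pdf_ge0 _ _ _)).
by split=> /integrableP[_ fi]; apply/integrableP; split=> //; [rewrite -e|rewrite e].
Qed.

Lemma intg_normalP (f : R -> R) : intg N f ->
  mu.-integrable setT (fun x => (f x * phi x)%:E).
Proof. by move=> If; exact/(intg_normalE (intg_meas If)). Qed.

Lemma Ex_normal (f : R -> R) : intg N f ->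
  Ex N f = \int[mu]_x (f x * phi x).
Proof.
move=> If; have mf := intg_meas If.
have mfp : measurable_fun setT (EFin \o f) by exact/measurable_EFinP.
rewrite /Ex /Rintegral; congr fine; rewrite integralE [RHS]integralE.
rewrite !ge0_integral_normal//; [|exact: measurable_funeneg|exact: measurable_funepos].
congr (_ - _)%E; apply: eq_integral => x _; rewrite ?funeposE ?funenegE /= -!EFin_max -EFinM.
all: by rewrite maxr_pMl ?normal_pdf_ge0// mul0r ?mulNr.
Qed.

Lemma is_derive_normal_pdf (x : R) :
  is_derive x 1 phi (- (x / s ^+ 2) * phi x).
Proof.
rewrite [X in is_derive _ _ X _](_ : phi =
    fun x => normal_peak s * expR (- (x - 0) ^+ 2 / (s ^+ 2 *+ 2))); last first.
  by apply/funext => y; rewrite normal_pdfE.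
rewrite normal_pdfE// /normal_fun.
apply: is_derive_eq.
rewrite /GRing.scale/=; field.
by rewrite s0.
Qed.

(** The common majorant for polynomial growth in one variable: even, at least 1, and increasing in
    [k]. *)
Definition pw k (x : R) := (1 + x ^+ 2) ^+ k.

Lemma pw_ge1 k x : 1 <= pw k x.
Proof. by rewrite exprn_ege1// lerDl sqr_ge0. Qed.

Lemma pw_ge0 k x : 0 <= pw k x.
Proof. exact: le_trans (pw_ge1 k x). Qed.

Lemma measurable_pw k : measurable_fun setT (pw k).
Proof.
apply: measurable_funX; apply: measurable_funD => //; exact: measurable_funX.
Qed.

(** A polynomial factor is absorbed by doubling the standard deviation; both integrability of
    polynomials and decay of boundary terms follow from this single bound. *)
Lemma pw_normal_le k : exists2 C, 0 <= C &
  forall x, pw k x * phi x <= C * normal_pdf 0 (2 * s) x.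
Proof.
have s20 : 0 < s ^+ 2 by rewrite exprn_even_gt0.
have s'0 : 2 * s != 0 by rewrite mulf_neq0.
(* Then [k * a] is at most [1 / (4 s ^+ 2)], below the gap [3 / (8 s ^+ 2)] between the exponents of
   the two densities; [k.+1] keeps [a] positive for [k = 0]. *)
pose a := (4 * s ^+ 2 * k.+1%:R)^-1.
have a0 : 0 < a by rewrite invr_gt0 pmulr_lgt0 ?ltr0n// pmulr_rgt0.
pose C := Num.max 1 a^-1.
have C1 : 1 <= C by rewrite le_max lexx.
have C0 : 0 <= C := le_trans ler01 C1.
exists (C ^+ k * normal_peak s / normal_peak (2 * s)).
  by rewrite divr_ge0// ?normal_peak_ge0// mulr_ge0 ?exprn_ge0// normal_peak_ge0.
move=> x; rewrite !normal_pdfE// /normal_fun subr0.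
have p0 : normal_peak (2 * s) != 0 by rewrite gt_eqF// normal_peak_gt0.
rewrite [leRHS](_ : _ = normal_peak s *
    (C ^+ k * expR (- x ^+ 2 / ((2 * s) ^+ 2 *+ 2)))); last first.
  move: p0; move: (normal_peak (2 * s)) (normal_peak s) (C ^+ k) => q r c p0.
  by rewrite mulrA divfK// (mulrC c) mulrA.
rewrite mulrCA ler_wpM2l ?normal_peak_ge0//.
have h1 : 1 + x ^+ 2 <= C * expR (a * x ^+ 2).
  apply: (@le_trans _ _ (C * (1 + a * x ^+ 2))); last first.
    by rewrite ler_wpM2l// expR_ge1Dx.
  rewrite mulrDr mulr1 lerD// mulrA ler_peMl ?sqr_ge0//.
  by rewrite -ler_pdivrMr// div1r le_max lexx orbT.
have h2 : pw k x <= C ^+ k * expR (k%:R * (a * x ^+ 2)).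
  rewrite expRM_natl -exprMn lerXn2r ?nnegrE//.
    by rewrite addr_ge0 ?sqr_ge0.
  by rewrite mulr_ge0 ?expR_ge0.
apply: (@le_trans _ _ (C ^+ k * expR (k%:R * (a * x ^+ 2)) *
   expR (- x ^+ 2 / (s ^+ 2 *+ 2)))).
  by rewrite ler_wpM2r ?expR_ge0.
rewrite -mulrA -expRD ler_wpM2l ?exprn_ge0// ler_expR.
have e : k%:R * a <= (4 * s ^+ 2)^-1.
  have kk : k%:R / k.+1%:R <= 1 :> R by rewrite ler_pdivrMr ?ltr0n// mul1r ler_nat.
  by rewrite /a invfM mulrCA ler_piMr// invr_ge0 mulr_ge0// sqr_ge0.
rewrite mulrA -lerBrDr.
apply: (@le_trans _ _ ((4 * s ^+ 2)^-1 * x ^+ 2)).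
  by rewrite ler_wpM2r ?sqr_ge0.
rewrite -subr_ge0 (_ : _ - _ = x ^+ 2 / s ^+ 2 / 8).
  by rewrite !divr_ge0 ?sqr_ge0.
by field.
Qed.

Lemma intg_pw k : intg N (pw k).
Proof.
have [C C0 hC] := pw_normal_le k.
apply/(intg_normalE (measurable_pw k)).
apply: (@le_integrable _ _ _ mu setT measurableT _
  (fun x => C%:E * (normal_pdf 0 (2 * s) x)%:E)%E).
- by apply/measurable_EFinP/measurable_funM; [exact: measurable_pw|exact: measurable_normal_pdf].
- move=> x _; rewrite -EFinM lee_fin ger0_norm.
    by rewrite (le_trans (hC x))// ler_norm.
  by rewrite mulr_ge0 ?pw_ge0 ?normal_pdf_ge0.
- by apply: integrableZl => //; exact: integrable_normal_pdf.
Qed.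

Lemma cvg_pw_normal k : exists2 C, 0 <= C &
  forall n : nat, pw k n%:R * phi n%:R <= C / n.+1%:R /\ pw k (- n%:R) * phi (- n%:R) <= C / n.+1%:R.
Proof.
have s'0 : 2 * s != 0 by rewrite mulf_neq0.
have [C C0 hC] := pw_normal_le k.+1.
pose D := C * normal_peak (2 * s).
have h x : pw k x * phi x <= D / (1 + x ^+ 2).
  have x1 : 0 < 1 + x ^+ 2 by rewrite ltr_pwDl// sqr_ge0.
  rewrite ler_pdivlMr// mulrAC -exprSr.
  apply: (le_trans (hC x)); rewrite ler_wpM2l//.
  exact: normal_pdf_ub.
have D0 : 0 <= D by rewrite mulr_ge0 ?normal_peak_ge0.
have nn (n : nat) : D / (1 + n%:R ^+ 2) <= D / n.+1%:R.
  have n0 : 0 < 1 + n%:R ^+ 2 :> R by rewrite ltr_pwDl// sqr_ge0.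
  rewrite ler_wpM2l// lef_pV2 ?posrE ?ltr0n//.
  rewrite -natr1 addrC lerD2l; case: n {n0} => [|n]; first by rewrite expr0n.
  by rewrite expr2 ler_peMl// ler1n.
by exists D => // n; split; apply: (le_trans (h _)) => //; rewrite sqrrN.
Qed.

(** The derivative of [F * phi] is [h = f * phi - s ^- 2 * x * F * phi]. By the fundamental theorem
    of calculus its integral over a growing symmetric interval is a boundary term, which tends to 0
    since [F] grows at most like [pw k]. *)
Lemma normal_ibp (F f : R -> R) C k :
  (forall x : R, is_derive x 1 F (f x)) -> continuous f ->
  (forall x, `|F x| <= C * pw k x) -> (forall x, `|f x| <= C * pw k x) ->
  [/\ intg N (fun x => x * F x), intg N f &
    Ex N (fun x => x * F x) = s ^+ 2 * Ex N f].
Proof.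
move=> dF cf bF bf.
have mf : measurable_fun setT f by exact: continuous_measurable_fun.
have cF := is_derive_continuous dF.
have mF : measurable_fun setT F by exact: continuous_measurable_fun.
have C0 : 0 <= C.
  have := le_trans (normr_ge0 _) (bF 0).
  by rewrite pmulr_lge0// (lt_le_trans _ (pw_ge1 k 0)).
have If : intg N f.
  by apply: (@intg_le _ _ _ N f (fun x => C * pw k x) mf bf); apply: intgZ; exact: intg_pw.
have IF : intg N (fun x => x * F x).
  apply: (@intg_le _ _ _ N _ (fun x => C * pw k.+1 x)).
  - exact: measurable_funM.
  - move=> x; rewrite normrM /pw exprS mulrCA ler_pM// ler_norml; apply/andP; split; nra.
  - by apply: intgZ; exact: intg_pw.
split => //.
have s20 : s ^+ 2 != 0 by rewrite expf_neq0.
pose h x := f x * phi x - s ^- 2 * (x * F x * phi x).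
have dh (x : R) : is_derive x 1 (fun x => F x * phi x) (h x).
  have := is_deriveM (dF x) (is_derive_normal_pdf x).
  move=> /is_derive_eq; apply; rewrite /h /GRing.scale/=.
  by rewrite -mulrA; move: (phi x) => y; field.
have Ih : mu.-integrable setT (EFin \o h).
  rewrite (_ : EFin \o h = (fun x => (f x * phi x)%:E - (s ^- 2)%:E * (x * F x * phi x)%:E)%E) //.
  apply: integrableB => //; first exact: intg_normalP.
  by apply: integrableZl => //; exact: intg_normalP.
have ch : continuous h.
  move=> x; apply: cvgB.
    by apply: cvgM; [exact: cf|exact: continuous_normal_pdf].
  apply: cvgM; first exact: cvg_cst.
  apply: cvgM; last exact: continuous_normal_pdf.
  by apply: cvgM; [exact: cvg_id|exact: cF].
(* The index [n.+1] keeps the interval nondegenerate; the shift is undone when the limit is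
   taken. *)
have FTC (n : nat) : \int[mu]_(x in `[- n.+1%:R, n.+1%:R]) h x =
    F n.+1%:R * phi n.+1%:R - F (- n.+1%:R) * phi (- n.+1%:R).
  rewrite /Rintegral (@continuous_FTC2 _ _ (fun x => F x * phi x))//.
  - by rewrite gtrN.
  - exact: continuous_subspaceT.
  - have cFp : continuous (fun x => F x * phi x).
      by move=> x; apply: cvgM; [exact: cF|exact: continuous_normal_pdf].
    split.
    + by move=> x _; have [] := dh x.
    + by apply: cvg_at_right_filter; exact: cFp.
    + by apply: cvg_at_left_filter; exact: cFp.
  - by move=> x _; rewrite derive1E; have [] := dh x.
have h0 : \int[mu]_x h x = 0.
  have [D D0 hD] := cvg_pw_normal k.
  have c1 : \int[mu]_(x in `[- n.+1%:R, n.+1%:R]) h x @[n --> \oo] --> (0 : R).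
    apply/cvgr0Pnorm_le => e e0; near=> n.
    rewrite FTC; apply: (le_trans (ler_normB _ _)); rewrite !normrM.
    rewrite !(ger0_norm (normal_pdf_ge0 _ _ _)).
    apply: (@le_trans _ _ (2 * C * D / n.+2%:R)).
      have [h1 h2] := hD n.+1.
      have a1 : `|F n.+1%:R| * phi n.+1%:R <= C * (D / n.+2%:R).
        apply: (@le_trans _ _ (C * pw k n.+1%:R * phi n.+1%:R)).
          by rewrite ler_wpM2r ?normal_pdf_ge0.
        by rewrite -mulrA ler_wpM2l.
      have a2 : `|F (- n.+1%:R)| * phi (- n.+1%:R) <= C * (D / n.+2%:R).
        apply: (@le_trans _ _ (C * pw k (- n.+1%:R) * phi (- n.+1%:R))).
          by rewrite ler_wpM2r ?normal_pdf_ge0.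
        by rewrite -mulrA ler_wpM2l.
      by apply: (le_trans (lerD a1 a2)); rewrite -!mulrA mulr_natl mulr2n.
    rewrite ler_pdivrMr ?ltr0n// -ler_pdivrMl//.
    have : (e^-1 * (2 * C * D) <= n%:R) by near: n; exact: nbhs_infty_ger.
    by move=> /le_trans; apply; rewrite ler_nat ltnW.
  have c2 := cvg_Rintegral_itvT Ih.
  have c3 : \int[mu]_(x in `[- n.+1%:R, n.+1%:R]) h x @[n --> \oo] --> \int[mu]_x h x.
    by rewrite (cvg_shiftS (fun n => \int[mu]_(x in `[- n%:R, n%:R]) h x)).
  exact: cvg_unique c3 c1.
rewrite (Ex_normal IF) (Ex_normal If).
move: h0; rewrite /h RintegralB//; [|exact: intg_normalP|]; last first.
  by have := integrableZl measurableT (s ^- 2) (intg_normalP IF).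
rewrite RintegralZl//; last exact: intg_normalP.
move=> /eqP; rewrite subr_eq0 => /eqP ->.
by rewrite mulrA mulfV// mul1r.
Unshelve. all: by end_near. Qed.

End Normal.

(** * The characteristic function of a normal law *)

Section CharacteristicFunction.
Context {R : realType}.

Lemma gaussian_ode (a : R) (y : R -> R) :
  (forall t : R, is_derive t 1 y (- (a * t) * y t)) ->
  forall t, y t = y 0 * expR (- (a * t ^+ 2 / 2)).
Proof.
move=> dy t.
pose z t := y t * expR (a * t ^+ 2 / 2).
have dz (x : R) : is_derive x 1 z 0.
  have de : is_derive x 1 (fun t : R => expR (a * t ^+ 2 / 2)) (a * x * expR (a * x ^+ 2 / 2)).
    apply: is_derive_eq.
    by rewrite /GRing.scale/=; field.
  have := is_deriveM (dy x) de.
  move=> /is_derive_eq; apply; rewrite /GRing.scale/=; ring.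
have := is_derive_0_is_cst t 0 dz.
rewrite /z expr0n /= mulr0 mul0r expR0 mulr1 => <-.
by rewrite -mulrA -expRD subrr expR0 mulr1.
Qed.

Lemma measurable_cos : measurable_fun setT (@cos R).
Proof. by apply: continuous_measurable_fun; exact: continuous_cos. Qed.

Lemma measurable_sin : measurable_fun setT (@sin R).
Proof. by apply: continuous_measurable_fun; exact: continuous_sin. Qed.

Variable s : R.
Hypothesis s0 : s != 0.
Local Notation N := (gaussian s).

Let derive_under (u : R -> R -> R) (v : R -> R -> R) (t : R) :
  (forall t, measurable_fun setT (u t)) ->
  (forall t x, `|u t x| <= 1) -> (forall t x, `|v t x| <= `|x|) ->
  (forall t x : R, is_derive t 1 (u ^~ x) (v t x)) ->
  is_derive t 1 (fun t => Ex N (u t)) (Ex N (v t)).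
Proof.
move=> mu bu bv dv.
have Iu x : N.-integrable setT (EFin \o u x).
  exact: (@intg_bounded _ _ _ N _ _ (mu x) (bu x)).
have dvE x y : derive1 (fun x => u x y) x = v x y.
  by rewrite derive1E; have [] := dv x y.
have IG : N.-integrable setT (EFin \o (fun x : R => `|x|)).
  apply: (@intg_le _ _ _ N _ _ _ _ (intg_pw s0 1)); first exact: normr_measurable.
  move=> x; rewrite normr_id /pw expr1 ler_norml; apply/andP; split; nra.
have tI : `]t - 1, t + 1[%classic t.
  by rewrite /= in_itv/= ltrBlDr ltrDl ltr01.
have D1 := @derivable_under_integral R _ _ N u setT measurableT t (t - 1) (t + 1) tI
  (fun x _ => Iu x) (fun x y _ _ => (dv x y).(ex_derive)) (fun x => `|x|)
  (fun y => normr_ge0 y) IG.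
have D2 := @differentiation_under_integral R _ _ N u setT measurableT t (t - 1) (t + 1) tI
  (fun x _ => Iu x) (fun x y _ _ => (dv x y).(ex_derive)) (fun x => `|x|)
  (fun y => normr_ge0 y) IG.
have hb x y : `](t - 1), (t + 1)[%classic x -> setT y -> `|partial1of2 u x y| <= `|y|.
  by move=> _ _; rewrite /partial1of2 dvE.
apply: DeriveDef; first exact: (D1 hb).
by rewrite -derive1E (D2 hb)//; apply: eq_Rintegral => x _; rewrite /partial1of2 dvE.
Qed.

(** Stated for bounded [h] with [h'' = - h], so that cosine and sine are treated together.
    Differentiation under the integral followed by integration by parts shows that
    [y t = Ex N (fun x => h (t * x))] solves [y' = - s ^+ 2 * t * y]. *)
Lemma normal_trig (h dh : R -> R) (t : R) :
  (forall x : R, is_derive x 1 h (dh x)) -> (forall x : R, is_derive x 1 dh (- h x)) ->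
  (forall x, `|h x| <= 1) -> (forall x, `|dh x| <= 1) ->
  Ex N (fun x => h (t * x)) = h 0 * expR (- (s ^+ 2 * t ^+ 2 / 2)).
Proof.
move=> hd hdd h1 dh1; have ch := is_derive_continuous hd.
have dmul (a x : R) : is_derive x 1 ( *%R a) a.
  by apply: is_derive_eq; rewrite /GRing.scale/= mulr1.
have scaled (f df : R -> R) (a x : R) : (forall x : R, is_derive x 1 f (df x)) ->
    is_derive x 1 (fun x => f (a * x)) (a * df (a * x)).
  by move=> df'; rewrite mulrC; exact: is_derive1_comp (df' _) (dmul a x).
have cht (a : R) : continuous (fun x : R => h (a * x)).
  by move=> x; apply: continuous_comp; [exact: mulrl_continuous|exact: ch].
have mht (a : R) : measurable_fun setT (fun x : R => h (a * x)) by exact: continuous_measurable_fun.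
pose y t := Ex N (fun x => h (t * x)).
have dy (u : R) : is_derive u 1 y (- (s ^+ 2 * u) * y u).
  have -> : - (s ^+ 2 * u) * y u = Ex N (fun x => x * dh (u * x)).
    have [] := @normal_ibp _ _ s0 (fun x => dh (u * x)) (fun x => u * - h (u * x)) (1 + `|u|) 0.
    - by move=> x; exact: scaled.
    - by move=> x; apply: cvgM; [exact: cvg_cst|apply: cvgN; exact: cht].
    - by move=> x; rewrite /pw expr0 mulr1 (le_trans (dh1 _))// lerDl.
    - by move=> x; rewrite /pw expr0 mulr1 normrM normrN (@le_trans _ _ `|u|) ?ler_piMr ?lerDr.
    move=> _ _ ->; under [X in _ = _ * X]eq_Ex do rewrite mulrN -mulNr.
    by rewrite ExZ; [rewrite /y; ring|exact: (@intg_bounded _ _ _ N _ 1 (mht u) (fun x => h1 _))].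
  apply: (@derive_under (fun t x => h (t * x)) (fun t x => x * dh (t * x))) => //.
  - by move=> x z; rewrite normrM ler_piMr.
  - move=> x z; rewrite (mulrC x) [X in is_derive _ _ X _](_ : _ = fun t => h (z * t)); first exact: scaled.
    by apply/funext => t'; rewrite mulrC.
rewrite -/(y t) (gaussian_ode dy t); congr (_ * _).
by rewrite /y; under eq_Ex do rewrite mul0r; rewrite Ex_cst.
Qed.

Lemma normal_cos t : Ex N (fun x => cos (t * x)) = expR (- (s ^+ 2 * t ^+ 2 / 2)).
Proof.
rewrite (normal_trig t (h := cos) (dh := fun x => - sin x)) ?cos0 ?mul1r// => x; last 2 first.
- exact: cos_max.
- by rewrite normrN; exact: sin_max.
Qed.

Lemma normal_sin t : Ex N (fun x => sin (t * x)) = 0.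
Proof.
rewrite (normal_trig t (h := sin) (dh := cos)) ?sin0 ?mul0r//; [exact: sin_max|exact: cos_max].
Qed.

End CharacteristicFunction.

(** * Exchange of expectations for bounded functions *)

Section Fubini.
Context d d' (T : measurableType d) (S : measurableType d') (R : realType).
Variables (P : probability T R) (Q : probability S R).

Lemma intg_prod_bounded (f : T * S -> R) (c : R) : measurable_fun setT f ->
  (forall z, `|f z| <= c) -> (P \x Q)%E.-integrable setT (EFin \o f).
Proof.
move=> mf fc; apply: measurable_bounded_integrable => //.
  rewrite -setXTT [ltLHS]product_measure1E//.
  by rewrite [X in (X * _)%E](@probability_setT _ _ _ P) mul1e [ltLHS](@probability_setT _ _ _ Q) ltry.
by exists c; split; [exact: num_real|move=> x cx y _; exact: le_trans (fc _) (ltW cx)].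
Qed.

Variable f : T * S -> R.
Hypothesis If : (P \x Q)%E.-integrable setT (EFin \o f).

Lemma Ex_prod1 : (forall x, intg Q (fun y => f (x, y))) ->
  intg P (fun x => Ex Q (fun y => f (x, y))) /\
  (\int[(P \x Q)%E]_z f z)%R = Ex P (fun x => Ex Q (fun y => f (x, y))).
Proof.
move=> If1.
have e : (fun x => (Ex Q (fun y => f (x, y)))%:E) =
    fun x => (\int[Q]_y (f (x, y))%:E)%E.
  by apply/funext => x; rewrite Ex_fin.
split; first by rewrite /intg [X in integrable _ _ X]e; exact: integrable_fubini_F If.
by rewrite /Ex /Rintegral -integral12_prod_meas1//= -e.
Qed.

Lemma Ex_prod2 : (forall y, intg P (fun x => f (x, y))) ->
  (\int[(P \x Q)%E]_z f z)%R = Ex Q (fun y => Ex P (fun x => f (x, y))).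
Proof.
move=> If1.
have e : (fun y => (Ex P (fun x => f (x, y)))%:E) =
    fun y => (\int[P]_x (f (x, y))%:E)%E.
  by apply/funext => x; rewrite Ex_fin.
by rewrite /Ex /Rintegral -integral21_prod_meas1//= -e.
Qed.

End Fubini.

Lemma Ex_fubini_bounded d d' (T : measurableType d) (S : measurableType d')
  (R : realType) (P : probability T R) (Q : probability S R)
  (f : T * S -> R) (c : R) : measurable_fun setT f -> (forall z, `|f z| <= c) ->
  Ex P (fun x => Ex Q (fun y => f (x, y))) =
  Ex Q (fun y => Ex P (fun x => f (x, y))).
Proof.
move=> mf fc.
have If := intg_prod_bounded P Q mf fc.
have [_ <-] := Ex_prod1 If (fun x => intg_bounded Q
  (measurableT_comp mf (pair1_measurable x)) (fun y => fc (x, y))).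
exact: Ex_prod2 If (fun y => intg_bounded P
  (measurableT_comp mf (pair2_measurable y)) (fun x => fc (x, y))).
Qed.

Lemma measurable_Ex2 d d' (T : measurableType d) (S : measurableType d')
  (R : realType) (P : probability T R) (Q : probability S R)
  (f : T * S -> R) (c : R) : measurable_fun setT f -> (forall z, `|f z| <= c) ->
  measurable_fun setT (fun x => Ex Q (fun y => f (x, y))).
Proof.
move=> mf fc.
have If := intg_prod_bounded P Q mf fc.
apply: (intg_meas (P := P)).
by have [] := Ex_prod1 If (fun x => intg_bounded Q
  (measurableT_comp mf (pair1_measurable x)) (fun y => fc (x, y))).
Qed.

(** * Independence of orthonormal Gaussian variables *)

Section SmoothedInterval.
Context {R : realType}.
Implicit Types (x a b e : R).

(** By symmetry of the kernel this is the indicator of []a, b]] convolved with a centered Gaussian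
    density of deviation [e]. *)
Definition smooth_itv e a b x : R := fine (normal_prob x e `]a, b]).

Lemma smooth_itvE e a b x : (normal_prob x e `]a, b]) = (smooth_itv e a b x)%:E.
Proof. by rewrite /smooth_itv fineK// fin_num_measure. Qed.

Lemma smooth_itv_ge0 e a b x : 0 <= smooth_itv e a b x.
Proof. exact: fine_ge0. Qed.

Lemma smooth_itv_le1 e a b x : smooth_itv e a b x <= 1.
Proof. by rewrite -lee_fin -smooth_itvE probability_le1. Qed.

(** At distance at least [d] from the mean, the density of deviation [e] is at most
    [2 * expR (- (d ^+ 2 / e ^+ 2 / 4))] times that of deviation [2 * e], whose mass is at most 1;
    the factor 2 is the ratio of the peaks. The exponential is then weakened to a rational function,
    whose limit is elementary. *)
Lemma normal_prob_far e d x (A : set R) : 0 < e -> 0 < d -> measurable A ->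
  (forall y, A y -> d <= `|y - x|) ->
  (normal_prob x e A <= (2 / (1 + d ^+ 2 / e ^+ 2 / 4))%:E)%E.
Proof.
move=> e0 d0 mA Ad.
have e1 : e != 0 by rewrite gt_eqF.
have e2 : 2 * e != 0 by rewrite mulf_neq0.
pose K := 2 * expR (- (d ^+ 2 / e ^+ 2 / 4)).
have pk : normal_peak e = 2 * normal_peak (2 * e).
  rewrite /normal_peak.
  have -> : (2 * e) ^+ 2 * pi *+ 2 = 2 ^+ 2 * (e ^+ 2 * pi *+ 2) by ring.
  rewrite sqrtrM ?sqr_ge0// sqrtr_sqr ger0_norm// invfM mulrA divff// mul1r//.
have lepdf y : A y -> normal_pdf x e y <= K * normal_pdf x (2 * e) y.
  move=> /Ad dy; rewrite !normal_pdfE// /normal_fun pk /K.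
  rewrite -!mulrA ler_wpM2l// [leRHS]mulrCA ler_wpM2l ?normal_peak_ge0//.
  rewrite -expRD ler_expR.
  have : d ^+ 2 <= (y - x) ^+ 2.
    by rewrite -(real_normK (num_real (y - x))) lerXn2r ?nnegrE// ltW.
  rewrite -subr_ge0 => h; rewrite -subr_ge0.
  rewrite (_ : _ - _ = ((y - x) ^+ 2 - d ^+ 2) / e ^+ 2 / 4 + (y - x) ^+ 2 / e ^+ 2 / 8).
    by rewrite addr_ge0// !divr_ge0// sqr_ge0.
  by field.
apply: (@le_trans _ _ K%:E); last first.
  rewrite lee_fin /K ler_wpM2l// expRN lef_pV2 ?posrE ?expR_gt0//.
    exact: expR_ge1Dx.
  by rewrite ltr_pwDl// !divr_ge0// sqr_ge0.
rewrite /normal_prob.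
apply: (@le_trans _ _ (\int[lebesgue_measure]_(y in A) (K%:E * (normal_pdf x (2 * e) y)%:E))%E).
  apply: ge0_le_integral => //.
  - by move=> y _; rewrite lee_fin normal_pdf_ge0.
  - by apply/measurable_EFinP/measurable_funTS; exact: measurable_normal_pdf.
  - apply/measurable_funTS/measurable_EFinP/measurable_funM => //.
    exact: measurable_normal_pdf.
rewrite ge0_integralZl//.
- rewrite -[leRHS]mule1 lee_wpmul2l ?lee_fin//.
    by rewrite /K mulr_ge0// expR_ge0.
  exact: (@probability_le1 _ _ _ (normal_prob x (2 * e))).
- by apply/measurable_EFinP/measurable_funTS; exact: measurable_normal_pdf.
- by move=> y _; rewrite lee_fin normal_pdf_ge0.
- by rewrite lee_fin /K mulr_ge0// expR_ge0.
Qed.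

Let cvg_far d : 0 < d ->
  2 / (1 + d ^+ 2 / (n.+1%:R^-1) ^+ 2 / 4) @[n --> \oo] --> (0 : R).
Proof.
move=> d0; apply/cvgr0Pnorm_le => r r0; near=> n.
have d2 : 0 < d ^+ 2 by rewrite exprn_gt0.
have h : 0 <= d ^+ 2 / (n.+1%:R^-1) ^+ 2 / 4 :> R by rewrite !divr_ge0// sqr_ge0.
rewrite ger0_norm; last by rewrite divr_ge0// addr_ge0.
rewrite ler_pdivrMr; last by rewrite ltr_pwDl.
rewrite -ler_pdivrMl// exprVn invrK.
have n1 : 8 / (r * d ^+ 2) <= n%:R by near: n; exact: nbhs_infty_ger.
have n2 : n%:R <= n.+1%:R ^+ 2 :> R.
  rewrite -natrX ler_nat (leq_trans (leqnSn n))// expnS leq_pmulr//.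
have h3 : 8 / (r * d ^+ 2) <= n.+1%:R ^+ 2 := le_trans n1 n2.
have : r^-1 * 2 <= d ^+ 2 * n.+1%:R ^+ 2 / 4.
  rewrite ler_pdivlMr// -ler_pdivrMl//; apply: le_trans h3.
  by rewrite le_eqVlt; apply/orP; left; apply/eqP; field; rewrite !gt_eqF.
by move/le_trans; apply; rewrite lerDr.
Unshelve. all: by end_near. Qed.

(** When [a < b] the limit at an endpoint would be one half. The endpoints are harmless afterwards
    because a Gaussian law has no atom. *)
Lemma cvg_smooth_itv a b x : x != a -> x != b ->
  smooth_itv (n.+1%:R^-1) a b x @[n --> \oo] --> (\1_`]a, b] x : R).
Proof.
move=> xa xb.
have pos n : 0 < n.+1%:R^-1 :> R by rewrite invr_gt0.
pose d := Num.min `|x - a| `|x - b|.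
have d0 : 0 < d by rewrite lt_min !normr_gt0 !subr_eq0 xa xb.
have da : d <= `|x - a| by rewrite ge_min lexx.
have db : d <= `|x - b| by rewrite ge_min lexx orbT.
have [xab|xab] := boolP (x \in `]a, b]).
- rewrite indicE mem_set//=.
  apply/cvgrPdist_le => /= r r0.
  have := cvg_far d0 => /cvgrPdist_le/(_ _ r0); apply: filterS => n.
  rewrite sub0r normrN => h.
  rewrite ger0_norm ?subr_ge0 ?smooth_itv_le1//.
  apply: le_trans h; apply: le_trans (ler_norm _).
  rewrite -lee_fin EFinB -smooth_itvE.
  rewrite -(@probability_setC _ _ _ (normal_prob x n.+1%:R^-1))//.
  apply: normal_prob_far => //; first exact: measurableC.
  move: xab; rewrite in_itv/= => /andP[ax xb'] y /= /negP.
  rewrite in_itv/= negb_and -leNgt -ltNge ler_normr => /orP[ya|yb]; apply/orP.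
    by right; apply: (le_trans da); rewrite gtr0_norm ?subr_gt0//; lra.
  by left; apply: (le_trans db); rewrite ler0_norm ?subr_le0//; lra.
- rewrite indicE memNset//; last by move=> /=; exact/negP.
  apply/cvgrPdist_le => /= r r0.
  have := cvg_far d0 => /cvgrPdist_le/(_ _ r0); apply: filterS => n.
  rewrite sub0r normrN => h; rewrite sub0r normrN ger0_norm ?smooth_itv_ge0//.
  apply: le_trans h; apply: le_trans (ler_norm _).
  rewrite -lee_fin -smooth_itvE.
  apply: normal_prob_far => // y /=; rewrite in_itv/= => /andP[ay yb].
  move: xab; rewrite in_itv/= negb_and -leNgt -ltNge ler_normr => /orP[xa'|bx]; apply/orP.
    by left; apply: (le_trans da); rewrite ler0_norm ?subr_le0//; lra.
  by right; apply: (le_trans db); rewrite gtr0_norm ?subr_gt0//; lra.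
Qed.

End SmoothedInterval.

(** * Recovering a weighted law from its Fourier transform *)

Section FourierUniqueness.
Context {R : realType}.
Local Notation gam1 := (gaussian (1 : R)).

Definition bump (e y x : R) := expR (- (((x - y) / e) ^+ 2 / 2)).

(* Fourier inversion for a Gaussian kernel, in real form. *)
Lemma bump_mixture (e y x : R) :
  bump e y x = Ex gam1 (fun t => cos ((x - y) / e * t)).
Proof. by rewrite normal_cos// expr1n mul1r. Qed.

Lemma measurable_bump2 e : measurable_fun [set: R * R] (fun z => bump e z.2 z.1).
Proof.
apply: measurableT_comp => //; apply: measurableT_comp => //.
apply: measurable_funM => //; apply: measurable_funX; apply: measurable_funM => //.
exact: measurable_funB.
Qed.

Lemma bump_bound e y x : `|bump e y x| <= 1.
Proof.
by rewrite ger0_norm ?expR_ge0// -expR0 ler_expR oppr_le0 divr_ge0// sqr_ge0.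
Qed.

(** The average over the interval is taken under the uniform law so that the exchange lemma for two
    probabilities applies. *)
Lemma smooth_itv_bump e a b (ab : a < b) x : 0 < e ->
  smooth_itv e a b x =
  (b - a) * normal_peak e * Ex (uniform_prob ab) (fun y => bump e y x).
Proof.
move=> e0; rewrite /smooth_itv /normal_prob.
rewrite integral_itv_obnd_cbnd; last first.
  by apply/measurable_EFinP/measurable_funTS; exact: measurable_normal_pdf.
have mb : measurable_fun setT (fun y => bump e y x).
  exact: (measurableT_comp (measurable_bump2 e) (pair1_measurable x)).
rewrite /Ex /Rintegral integral_uniform; last 2 first.
- by apply/measurable_EFinP; exact: mb.
- by move=> y; rewrite lee_fin expR_ge0.
have -> : (\int[lebesgue_measure]_(y in `[a, b]) (normal_pdf x e y)%:E =
    (normal_peak e)%:E * \int[lebesgue_measure]_(y in `[a, b]) (bump e y x)%:E)%E.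
  rewrite -ge0_integralZl//.
  - apply: eq_integral => y _; rewrite normal_pdfE ?gt_eqF// -EFinM; congr (_ * expR _)%:E.
    by rewrite -mulr_natr; field; rewrite gt_eqF.
  - by apply/measurable_EFinP; apply: measurable_funTS; exact: mb.
  - by move=> y _; rewrite lee_fin expR_ge0.
  - by rewrite lee_fin normal_peak_ge0.
have : (\int[lebesgue_measure]_(y in `[a, b]) (bump e y x)%:E)%E \is a fin_num.
  rewrite ge0_fin_numE; last by apply: integral_ge0 => y _; rewrite lee_fin expR_ge0.
  apply: (@le_lt_trans _ _ (\int[lebesgue_measure]_(y in `[a, b]) cst 1 y)%E).
    apply: ge0_le_integral => //.
    + by move=> y _; rewrite lee_fin expR_ge0.
    + by apply/measurable_EFinP; apply: measurable_funTS; exact: mb.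
    + by move=> y _; rewrite lee_fin (le_trans (ler_norm _))// bump_bound.
  by rewrite integral_cst//= lebesgue_measure_itv/= lte_fin ab mul1e ltry.
move=> /fineK <-; rewrite -!EFinM /=.
by rewrite mulrAC mulrA mulfV ?mul1r 1?mulrC// subr_eq0 gt_eqF.
Qed.

Section Weighted.
Context d (T : measurableType d) (P : probability T R).
Variables (G M : T -> R) (m c : R).
Hypotheses (mG : measurable_fun setT G) (mM : measurable_fun setT M).
Hypothesis Mc : forall w, `|M w| <= c.
Hypothesis hcos : forall t, Ex P (fun w => M w * cos (t * G w)) = m * expR (- (t ^+ 2 / 2)).
Hypothesis hsin : forall t, Ex P (fun w => M w * sin (t * G w)) = 0.

Definition bump_const (e y : R) := Ex gam1 (fun t =>
  expR (- ((e^-1 * t) ^+ 2 / 2)) * cos (y / e * t)).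

(** The hypotheses say that the image under [G] of the measure with density [M] has the Fourier
    transform of [m] times the standard Gaussian law. A Gaussian kernel is a mixture of cosines, so
    its integral depends on [M] only through [m]. *)
Lemma Ex_bump e y :
  Ex P (fun w => M w * bump e y (G w)) = m * bump_const e y.
Proof.
pose F (z : T * R) := M z.1 * cos ((G z.1 - y) / e * z.2).
have mF : measurable_fun setT F.
  apply: measurable_funM; first exact: measurableT_comp.
  apply: measurableT_comp; first exact: measurable_cos.
  apply: measurable_funM => //; apply: measurable_funM => //.
  by apply: measurable_funB => //; exact: measurableT_comp.
have Fc z : `|F z| <= c.
  by rewrite /F normrM -[c]mulr1 ler_pM// cos_max.
have := Ex_fubini_bounded P gam1 mF Fc; rewrite /F/=.
have -> : (fun x => Ex gam1 (fun t => M x * cos ((G x - y) / e * t))) =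
    fun w => M w * bump e y (G w).
  apply/funext => w; rewrite bump_mixture ExZ//.
  apply: (@intg_bounded _ _ _ gam1 _ 1); last by move=> t; exact: cos_max.
  by apply: measurableT_comp; [exact: measurable_cos|exact: measurable_funM].
move=> ->; rewrite /bump_const -ExZ; last first.
  apply: (@intg_boundedM _ _ _ gam1 _ _ 1) => [|t||t]; last exact: cos_max.
  - apply: measurableT_comp => //; apply: measurableT_comp => //.
    by apply: measurable_funM => //; apply: measurable_funX; exact: measurable_funM.
  - by rewrite ger0_norm ?expR_ge0// -expR0 ler_expR oppr_le0 divr_ge0// sqr_ge0.
  - by apply: measurableT_comp; [exact: measurable_cos|exact: measurable_funM].
apply: eq_Ex => t.
have e1 w : M w * cos ((G w - y) / e * t) =
    cos (y / e * t) * (M w * cos ((e^-1 * t) * G w)) +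
    sin (y / e * t) * (M w * sin ((e^-1 * t) * G w)).
  have -> : (G w - y) / e * t = (e^-1 * t) * G w - y / e * t by ring.
  by rewrite cosB; ring.
have I (f : R -> R) x : measurable_fun setT f -> (forall y, `|f y| <= 1) ->
    intg P (fun w => M w * f (x * G w)).
  move=> mf f1; apply: (intg_boundedM P mM Mc) => //.
  by apply: measurableT_comp => //; exact: measurable_funM.
have Ic x := I cos x (@measurable_cos R) (@cos_max R).
have Is x := I sin x (@measurable_sin R) (@sin_max R).
by rewrite (eq_Ex _ e1) ExD ?ExZ ?hcos ?hsin//; [ring|exact: intgZ|exact: intgZ].
Qed.

Lemma Ex_smooth_itv e a b (ab : a < b) : 0 < e ->
  measurable_fun setT (fun w => smooth_itv e a b (G w)) /\
  Ex P (fun w => M w * smooth_itv e a b (G w)) =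
  m * ((b - a) * normal_peak e * Ex (uniform_prob ab) (bump_const e)).
Proof.
move=> e0.
pose F (z : T * R) := M z.1 * bump e z.2 (G z.1).
pose B (z : T * R) := bump e z.2 (G z.1).
have mB : measurable_fun setT B.
  have := measurableT_comp (measurable_bump2 e) (measurable_fun_pair
    (measurableT_comp mG measurable_fst) (measurable_snd : measurable_fun setT (@snd T R))).
  by [].
have mF : measurable_fun setT F by apply: measurable_funM => //; exact: measurableT_comp.
have Bc z : `|B z| <= 1 by exact: bump_bound.
have Fc z : `|F z| <= c.
  by rewrite /F normrM -[c]mulr1 ler_pM// bump_bound.
have h := Ex_fubini_bounded P (uniform_prob ab) mF Fc.
have mEB := measurable_Ex2 P (uniform_prob ab) mB Bc.
split.
  under [X in measurable_fun _ X]eq_fun do rewrite (smooth_itv_bump ab)//.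
  exact: measurable_funM.
have Iy w : intg (uniform_prob ab) (fun y => bump e y (G w)).
  apply: (@intg_bounded _ _ _ (uniform_prob ab) _ 1); last by move=> y; exact: bump_bound.
  exact: (measurableT_comp mB (pair1_measurable w)).
have IE : intg P (fun w => M w * Ex (uniform_prob ab) (fun y => bump e y (G w))).
  apply: (@intg_bounded _ _ _ P _ c); first exact: measurable_funM.
  move=> w; rewrite normrM -[c]mulr1 ler_pM//.
  apply: (@Ex_bounded _ _ _ (uniform_prob ab)); last by move=> y; exact: bump_bound.
  exact: (intg_meas (Iy w)).
have -> : (fun w => M w * smooth_itv e a b (G w)) = fun w =>
    (b - a) * normal_peak e * (M w * Ex (uniform_prob ab) (fun y => bump e y (G w))).
  by apply/funext => w; rewrite (smooth_itv_bump ab)// mulrCA.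
rewrite ExZ//.
have e1 : (fun w => M w * Ex (uniform_prob ab) (fun y => bump e y (G w))) =
    fun w => Ex (uniform_prob ab) (fun y => F (w, y)).
  by apply/funext => w; rewrite /F/= ExZ.
rewrite e1 h mulrCA; congr (_ * _).
under eq_Ex do rewrite /F/= Ex_bump.
(* Integrability of [bump_const e] is read off from [m * bump_const e], which requires dividing by
   [m]. *)
have [m0|m0] := eqVneq m 0.
  by rewrite m0 mul0r; under eq_Ex do rewrite mul0r; rewrite Ex_cst.
rewrite ExZ//.
have -> : bump_const e = fun y => m^-1 * Ex P (fun w => F (w, y)).
  by apply/funext => y; rewrite /F/= Ex_bump mulKf.
apply: intgZ; apply: (@intg_bounded _ _ _ (uniform_prob ab) _ c).
  have mF' : measurable_fun setT (fun z : R * T => F (z.2, z.1)).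
    exact: (measurableT_comp mF (measurable_fun_pair measurable_snd measurable_fst)).
  exact: (measurable_Ex2 (uniform_prob ab) P mF' (fun z => Fc _)).
move=> y; apply: (@Ex_bounded _ _ _ P); last by move=> w; exact: Fc.
exact: (measurableT_comp mF (pair2_measurable y)).
Qed.

Hypothesis lawG : forall A, measurable A -> P (G @^-1` A) = gam1 A.

Lemma lawG_point a : P (G @^-1` [set a]) = 0%E.
Proof. by rewrite lawG// /gaussian/= /normal_prob integral_set1. Qed.

Lemma cvg_Ex_smooth_itv a b (ab : a < b) :
  Ex P (fun w => M w * smooth_itv n.+1%:R^-1 a b (G w)) @[n --> \oo] -->
  Ex P (fun w => M w * \1_`]a, b] (G w)).
Proof.
have pos n : 0 < n.+1%:R^-1 :> R by rewrite invr_gt0.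
have mE A : measurable A -> measurable (G @^-1` A).
  by move=> mA; rewrite -[X in measurable X]setTI; exact: mG.
apply: (@Ex_cvg_bounded _ _ _ P _ _ c).
- by move=> n; apply: measurable_funM => //; have [] := Ex_smooth_itv ab (pos n).
- by apply: measurable_funM => //; apply: measurableT_comp.
- move=> n w; rewrite normrM -[c]mulr1 ler_pM//.
  by rewrite ger0_norm ?smooth_itv_ge0// smooth_itv_le1.
exists (G @^-1` [set a] `|` G @^-1` [set b]); split.
- by apply: measurableU; apply: mE.
- by apply: null_set_setU; [exact: mE|exact: mE|exact: lawG_point|exact: lawG_point].
- move=> w /=; apply: contra_notP => /not_orP[Ga Gb].
  by apply: cvgM; [exact: cvg_cst|apply: cvg_smooth_itv; exact/eqP].
Qed.

End Weighted.
End FourierUniqueness.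

Section WeightedLaw.
Context {R : realType}.
Local Notation gam1 := (gaussian (1 : R)).

Lemma indic_abs (U : Type) (A : set U) x : `|\1_A x : R| <= 1.
Proof. by rewrite indicE ger0_norm ?lern1 ?leq_b1. Qed.

Section Indic.
Context d (T : measurableType d) (P : probability T R).
Variables (G M : T -> R) (c : R).
Hypotheses (mG : measurable_fun setT G) (mM : measurable_fun setT M).
Hypothesis Mc : forall w, `|M w| <= c.

Lemma intg_weighted_indic A : measurable A -> intg P (fun w => M w * \1_A (G w)).
Proof.
move=> mA; apply: (@intg_bounded _ _ _ P _ c) => [|w].
  by apply: measurable_funM => //; apply: measurableT_comp.
by rewrite normrM -[c]mulr1 ler_pM// indic_abs.
Qed.

Lemma weighted_indicC A : measurable A ->
  Ex P (fun w => M w * \1_(~` A) (G w)) = Ex P M - Ex P (fun w => M w * \1_A (G w)).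
Proof.
move=> mA; rewrite -ExB//; last 2 first.
- exact: intg_bounded mM Mc.
- exact: intg_weighted_indic.
apply: eq_Ex => w; rewrite !indicE in_setC.
by case: (_ \in _); rewrite ?mulr1 ?mulr0 ?subrr ?subr0.
Qed.

Lemma weighted_indicU (F : (set R)^nat) : (forall n, measurable (F n)) ->
  trivIset setT F ->
  \sum_(k < n) Ex P (fun w => M w * \1_(F k) (G w)) @[n --> \oo] -->
  Ex P (fun w => M w * \1_(\bigcup_k F k) (G w)).
Proof.
move=> mF tF.
have mU : measurable (\bigcup_k F k) by exact: bigcup_measurable.
have IU := intg_weighted_indic mU.
have IF n : intg P (fun w => \sum_(k < n) M w * \1_(F k) (G w)).
  by apply: intg_sum => k; exact: intg_weighted_indic.
have sumE n w : \sum_(k < n) M w * \1_(F k) (G w) =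
    M w * \1_(\big[setU/set0]_(k < n) F k) (G w).
  rewrite -mulr_sumr; congr (_ * _).
  elim: n => [|n ih]; first by rewrite !big_ord0 indic0.
  rewrite !big_ord_recr /= ih !indicE in_setU; have [Fn|Fn] := boolP (G w \in F n).
    have -> : (G w \in \big[setU/set0]_(k < n) F k) = false.
      apply/negP; rewrite -bigcup_mkord !inE => -[k /= kn Fk].
      move: Fn; rewrite inE => Fn.
      have := tF k n I I (ex_intro _ (G w) (conj Fk Fn)) => kn'.
      by rewrite kn' ltnn in kn.
    by rewrite add0r.
  by rewrite orbF addr0.
rewrite (_ : (fun n => _) = fun n => Ex P (fun w => \sum_(k < n) M w * \1_(F k) (G w))); last first.
  by apply/funext => n; rewrite Ex_sum// => k; exact: intg_weighted_indic.
apply: (@Ex_cvg_bounded _ _ _ P _ _ c) => [n| |n w|].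
- exact: intg_meas (IF n).
- exact: intg_meas IU.
- by rewrite sumE normrM -[c]mulr1 ler_pM// indic_abs.
apply: aeW => w; under eq_fun do rewrite sumE.
apply: cvgM; first exact: cvg_cst.
have [[k _ Fk]|nF] := pselect ((\bigcup_k F k) (G w)).
  rewrite [X in _ --> X]indicE mem_set; last by exists k.
  apply: cvg_near_cst; near=> n.
  rewrite indicE mem_set// -bigcup_mkord; exists k => //=.
  by near: n; exact: nbhs_infty_gt.
rewrite [X in _ --> X]indicE memNset//.
apply: cvg_near_cst; near=> n.
by rewrite indicE memNset// -bigcup_mkord => -[k _ Fk]; apply: nF; exists k.
Unshelve. all: by end_near. Qed.

End Indic.

Variables (m c : R).
Context d (T : measurableType d) (P : probability T R).
Variables (G M : T -> R).
Hypotheses (mG : measurable_fun setT G) (mM : measurable_fun setT M).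
Hypothesis Mc : forall w, `|M w| <= c.
Hypothesis hcos : forall t, Ex P (fun w => M w * cos (t * G w)) = m * expR (- (t ^+ 2 / 2)).
Hypothesis hsin : forall t, Ex P (fun w => M w * sin (t * G w)) = 0.
Hypothesis lawG : forall A, measurable A -> P (G @^-1` A) = gam1 A.

(** Sets satisfying the identity form a Dynkin class, so half-open intervals suffice. There both
    sides are limits of smoothed expectations; the right-hand one comes from running the same
    argument on [gam1] with weight 1, so that the constants built from [bump_const] match without
    being evaluated. *)
Lemma Ex_weighted_indic A : measurable A ->
  Ex P (fun w => M w * \1_A (G w)) = m * fine (gam1 A).
Proof.
have one1 : forall x : R, `|1 : R| <= 1 by move=> _; rewrite normr1.
have m1 : measurable_fun setT (fun _ : R => 1 : R) by exact: measurable_cst.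
have mid : measurable_fun setT (id : R -> R) by exact: measurable_id.
suff h : measurable `<=` [set A : set R | measurable A /\
    Ex P (fun w => M w * \1_A (G w)) = m * Ex gam1 (fun x => 1 * \1_A x)].
  move=> mA; have [_ ->] := h _ mA; congr (_ * _).
  under eq_Ex do rewrite mul1r.
  by rewrite /Ex /Rintegral integral_indic// setIT.
have EM : Ex P M = m.
  have := hcos 0; under eq_Ex do rewrite mul0r cos0 mulr1.
  by rewrite expr0n mul0r oppr0 expR0 mulr1.
move=> {}A mA; have : <<s @ocitv R >> A by exact: mA.
rewrite -(@setI_closed_g_dynkin_g_sigma_algebra _ (@ocitv R) (@ocitvI R)).
move: A {mA}; apply: smallest_sub.
  split.
  - split; first exact: measurableT.
    under eq_Ex do rewrite indicT mulr1.
    by under [X in _ = _ * X]eq_Ex do rewrite indicT mulr1; rewrite Ex_cst mulr1.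
  - move=> A [mA eA]; split; first exact: measurableC.
    rewrite (weighted_indicC P mG mM Mc mA) eA EM.
    rewrite (@weighted_indicC _ _ gam1 id (fun=> 1) 1 mid m1 one1 _ mA) Ex_cst.
    by rewrite mulrBr mulr1.
  - move=> F tF hF; have mF n : measurable (F n) by have [] := hF n.
    split; first exact: bigcup_measurable.
    have c1 := weighted_indicU (P := P) mG mM Mc mF tF.
    have c2 := @weighted_indicU _ _ gam1 id (fun=> 1) 1 mid m1 one1 F mF tF.
    have c3 := cvgMl_tmp (a := m) c2.
    have e : (fun n => \sum_(k < n) Ex P (fun w => M w * \1_(F k) (G w))) =
        (fun n => m * \sum_(k < n) Ex gam1 (fun w => 1 * \1_(F k) w)).
      apply/funext => n; rewrite mulr_sumr; apply: eq_bigr => k _.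
      by have [_ ->] := hF k.
    by rewrite e in c1; exact: cvg_unique c1 (c3 _).
move=> _ /ocitvP[->|[[a b]/= ab ->]].
  split; first exact: measurable0.
  under eq_Ex do rewrite indic0 mulr0.
  by under [X in _ = _ * X]eq_Ex do rewrite indic0 mulr0; rewrite !Ex_cst mulr0.
split; first exact: measurable_itv.
have c1 := cvg_Ex_smooth_itv mG mM Mc hcos hsin lawG ab.
have g1 t : Ex gam1 (fun w => 1 * cos (t * w)) = 1 * expR (- (t ^+ 2 / 2)).
  by under eq_Ex do rewrite mul1r; rewrite normal_cos// expr1n mul1r mul1r.
have g2 t : Ex gam1 (fun w => 1 * sin (t * w)) = 0.
  by under eq_Ex do rewrite mul1r; rewrite normal_sin.
have lg (A : set R) : measurable A -> gam1 (id @^-1` A) = gam1 A by [].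
have c2 := @cvg_Ex_smooth_itv _ _ _ gam1 id (fun=> 1) 1 1 mid m1 one1 g1 g2 lg a b ab.
have pos n : 0 < n.+1%:R^-1 :> R by rewrite invr_gt0.
have e : (fun n => Ex P (fun w => M w * smooth_itv n.+1%:R^-1 a b (G w))) =
    (fun n => m * Ex gam1 (fun w => 1 * smooth_itv n.+1%:R^-1 a b w)).
  apply/funext => n.
  rewrite (Ex_smooth_itv mG mM Mc hcos hsin ab (pos n)).2.
  by rewrite (@Ex_smooth_itv _ _ _ gam1 id (fun=> 1) 1 1 mid m1 one1 g1 g2 _ _ _ ab (pos n)).2 mul1r.
have c3 := cvgMl_tmp (a := m) c2; rewrite e in c1; exact: cvg_unique c1 (c3 _).
Qed.

End WeightedLaw.

(** The joint law is prescribed by the real and imaginary parts of the standard Gaussian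
    characteristic function; independence is derived from it below. *)
Record gaussian_family (R : realType) d (T : measurableType d)
    (P : probability T R) (n : nat) (g : 'I_n -> T -> R) : Prop := {
  gf_meas : forall i, measurable_fun setT (g i);
  gf_law : forall i (A : set R), measurable A -> P (g i @^-1` A) = gaussian 1 A;
  gf_cos : forall t : 'I_n -> R, Ex P (fun w => cos (\sum_i t i * g i w)) =
    expR (- ((\sum_i t i ^+ 2) / 2));
  gf_sin : forall t : 'I_n -> R, Ex P (fun w => sin (\sum_i t i * g i w)) = 0 }.

Definition upd (R : Type) n (i : 'I_n) (x : R) (v : 'I_n -> R) : 'I_n -> R :=
  fun j => if j == i then x else v j.

(** * Joint law of a Gaussian family and replacement of one coordinate *)

Section Independence.
Context {R : realType} d (T : measurableType d) (P : probability T R).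
Variables (n : nat) (g : 'I_n -> T -> R).
Hypothesis gf : gaussian_family P g.
Local Notation gam1 := (gaussian (1 : R)).

Let mg i : measurable_fun setT (g i). Proof. exact: (gf_meas gf). Qed.

Let msum (t : 'I_n -> R) : measurable_fun setT (fun w => \sum_i t i * g i w).
Proof. by apply: measurable_sum => i; apply: measurable_funM => //; exact: mg. Qed.

Let ind (A : 'I_n -> set R) (s : seq 'I_n) w : R := \prod_(j <- s) \1_(A j) (g j w).

Let mind A s : (forall j, measurable (A j)) -> measurable_fun setT (ind A s).
Proof. by move=> mA; apply: measurable_prod => j _; apply: measurableT_comp. Qed.

Let ind1 A s w : `|ind A s w| <= 1.
Proof.
rewrite /ind; elim: s => [|j s ih]; first by rewrite big_nil normr1.
by rewrite big_cons normrM mulr_ile1 ?indic_abs//.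
Qed.

Let sum_upd (t : 'I_n -> R) i c w : t i = 0 ->
  \sum_j upd i c t j * g j w = \sum_j t j * g j w + c * g i w.
Proof.
move=> ti; rewrite (bigD1 i)//= [in RHS](bigD1 i)//= ti mul0r add0r /upd eqxx addrC.
by congr (_ + _); apply: eq_bigr => j /negbTE ->.
Qed.

Let sqr_upd (t : 'I_n -> R) i c : t i = 0 ->
  \sum_j upd i c t j ^+ 2 = \sum_j t j ^+ 2 + c ^+ 2.
Proof.
move=> ti; rewrite (bigD1 i)//= [in RHS](bigD1 i)//= ti expr0n add0r /upd eqxx addrC.
by congr (_ + _); apply: eq_bigr => j /negbTE ->.
Qed.

(** Indicators replace trigonometric factors one coordinate at a time. The induction hypothesis at
    [upd i c t], for all [c], is split into its even and odd parts in [c] by the addition formulas;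
    this is the Fourier transform in [g i] of the measure weighted by the factors already present,
    and [Ex_weighted_indic] converts it into an indicator. Cosine and sine are proved jointly
    because the addition formulas mix them. *)
Lemma Ex_indic_trig (A : 'I_n -> set R) (s : seq 'I_n) :
  (forall j, measurable (A j)) -> uniq s ->
  forall t : 'I_n -> R, (forall j, j \in s -> t j = 0) ->
  Ex P (fun w => ind A s w * cos (\sum_i t i * g i w)) =
    (\prod_(j <- s) fine (gam1 (A j))) * expR (- ((\sum_i t i ^+ 2) / 2)) /\
  Ex P (fun w => ind A s w * sin (\sum_i t i * g i w)) = 0.
Proof.
move=> mA; elim: s => [_ t _|i s ih /=/andP[si us] t ts].
  rewrite big_nil mul1r -(gf_cos gf); split; last rewrite -[RHS](gf_sin gf t).
    by apply: eq_Ex => w; rewrite /ind big_nil mul1r.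
  by apply: eq_Ex => w; rewrite /ind big_nil mul1r.
have ti : t i = 0 by apply: ts; rewrite mem_head.
have IH c := ih us (upd i c t).
have ts' c j : j \in s -> upd i c t j = 0.
  move=> js; rewrite /upd; case: eqP => [ji|_]; first by rewrite -ji js in si.
  by apply: ts; rewrite inE js orbT.
have Ib (f : R -> R) c : measurable_fun setT f -> (forall x, `|f x| <= 1) ->
    intg P (fun w => ind A s w * f (\sum_j t j * g j w + c * g i w)).
  move=> mf f1; apply: (@intg_bounded _ _ _ P _ 1) => [|w].
    apply: measurable_funM; first exact: mind.
    apply: measurableT_comp => //; apply: measurable_funD; first exact: msum.
    exact: measurable_funM.
  by rewrite normrM -[1]mulr1 ler_pM.
have mC : measurable_fun setT (@cos R) by exact: measurable_cos.
have mS : measurable_fun setT (@sin R) by exact: measurable_sin.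
set pr := \prod_(j <- s) _ in IH.
pose C c w := ind A s w * cos (\sum_j t j * g j w + c * g i w).
pose S c w := ind A s w * sin (\sum_j t j * g j w + c * g i w).
have IC c : intg P (C c) by exact: Ib mC (@cos_max R).
have IS c : intg P (S c) by exact: Ib mS (@sin_max R).
set e := expR (- ((\sum_i t i ^+ 2) / 2)).
have hc c : Ex P (C c) =
    pr * e * expR (- (c ^+ 2 / 2)).
  have [h _] := IH c (ts' c).
  under eq_Ex do rewrite ?/C ?/S -sum_upd//.
  by rewrite h sqr_upd// -mulrA -expRD; congr (_ * expR _); ring.
have hs c : Ex P (S c) = 0.
  have [_ h] := IH c (ts' c).
  by rewrite -h /S; under eq_Ex do rewrite ?/C ?/S -sum_upd//.
have mM (f : R -> R) : measurable_fun setT f ->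
    measurable_fun setT (fun w => ind A s w * f (\sum_j t j * g j w)).
  move=> mf; apply: measurable_funM; first exact: mind.
  exact: measurableT_comp.
have M1 (f : R -> R) : (forall x, `|f x| <= 1) -> forall w,
    `|ind A s w * f (\sum_j t j * g j w)| <= 1.
  by move=> f1 w; rewrite normrM -[1]mulr1 ler_pM.
have lawi := gf_law gf i.
have lin (a b : R) (u v : T -> R) : intg P u -> intg P v ->
    Ex P (fun w => a * u w + b * v w) = a * Ex P u + b * Ex P v.
  by move=> Iu Iv; rewrite ExD ?ExZ//; exact: intgZ.
have consE (f : R -> R) : Ex P (fun w => ind A (i :: s) w * f (\sum_j t j * g j w)) =
    Ex P (fun w => (ind A s w * f (\sum_j t j * g j w)) * \1_(A i) (g i w)).
  apply: eq_Ex => w; rewrite /ind big_cons; ring.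
split.
  rewrite consE (@Ex_weighted_indic R (pr * e) 1 _ _ P (g i)
    (fun w => ind A s w * cos (\sum_j t j * g j w)))//.
  - by rewrite big_cons /pr; ring.
  - exact: mM.
  - exact/M1/cos_max.
  - move=> c; transitivity (Ex P (fun w => 2^-1 * C c w + 2^-1 * C (- c) w)).
      by apply: eq_Ex => w; rewrite /C (mulNr c) cosD cosB; field.
    by rewrite (lin _ _ _ _ (IC _) (IC _)) !hc sqrrN; field.
  - move=> c; transitivity (Ex P (fun w => 2^-1 * S c w + - 2^-1 * S (- c) w)).
      by apply: eq_Ex => w; rewrite /S (mulNr c) sinD sinB; field.
    by rewrite (lin _ _ _ _ (IS _) (IS _)) !hs; ring.
rewrite consE (@Ex_weighted_indic R 0 1 _ _ P (g i)
    (fun w => ind A s w * sin (\sum_j t j * g j w)))//.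
- by rewrite mul0r.
- exact: mM.
- exact/M1/sin_max.
- move=> c; transitivity (Ex P (fun w => 2^-1 * S c w + 2^-1 * S (- c) w)).
    by apply: eq_Ex => w; rewrite /S (mulNr c) sinD sinB; field.
  by rewrite (lin _ _ _ _ (IS _) (IS _)) !hs; ring.
- move=> c; transitivity (Ex P (fun w => 2^-1 * C (- c) w + - 2^-1 * C c w)).
    by apply: eq_Ex => w; rewrite /C (mulNr c) !cosD cosN sinN; field.
  by rewrite (lin _ _ _ _ (IC _) (IC _)) !hc sqrrN; ring.
Qed.

Lemma gaussian_rectangle (A : 'I_n -> set R) : (forall j, measurable (A j)) ->
  P [set w | forall j, A j (g j w)] = (\prod_j fine (gam1 (A j)))%:E.
Proof.
move=> mA.
have [h _] := @Ex_indic_trig A (index_enum 'I_n) mA (index_enum_uniq _) (fun=> 0) (fun _ _ => erefl).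
have mB : measurable [set w | forall j, A j (g j w)].
  rewrite (_ : [set w | _] = \bigcap_(j in setT) (g j @^-1` A j)).
    apply: fin_bigcap_measurable => // j _.
    by rewrite -[X in measurable X]setTI; exact: mg.
  by apply/seteqP; split=> w /= h' j; [move=> _; exact: h'|exact: h'].
rewrite -[LHS]fineK ?fin_num_measure//; congr EFin.
have -> : fine (P [set w | forall j, A j (g j w)]) =
    Ex P (\1_[set w | forall j, A j (g j w)] : T -> R).
  by rewrite /Ex /Rintegral integral_indic// setIT.
have e0 : expR (- ((\sum_(i < n) 0 ^+ 2) / 2)) = 1 :> R.
  by rewrite big1 ?mul0r ?oppr0 ?expR0// => i _; rewrite expr0n.
rewrite e0 mulr1 in h; rewrite -h; apply: eq_Ex => w.
rewrite big1 ?cos0 ?mulr1; last by move=> i _; rewrite mul0r.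
rewrite /ind; have [Bw|nBw] := pselect (forall j, A j (g j w)).
  rewrite indicE mem_set// big1// => j _; by rewrite indicE mem_set.
rewrite indicE memNset//.
have [j nA] : exists j, ~ A j (g j w) by exact/existsNP.
rewrite (bigD1 j)//= indicE memNset//.
by rewrite mul0r.
Qed.

(* Independence of [g i] from the other variables is expressed by the equality of
   the laws of [gtuple] and of [rtuple i], in which the i-th coordinate is replaced
   by a standard Gaussian variable living on a second factor. *)
Definition gtuple w : n.-tuple R := [tuple g i w | i < n].

Definition rtuple i (z : T * measurableTypeR R) : n.-tuple R := [tuple upd i z.2 (g^~ z.1) j | j < n].

Lemma measurable_gtuple : measurable_fun setT gtuple.
Proof.
apply/measurable_fun_tnthP => i; rewrite (_ : _ \o _ = g i)//.
by apply/funext => w /=; rewrite tnth_mktuple.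
Qed.

Lemma measurable_rtuple i : measurable_fun setT (rtuple i).
Proof.
apply/measurable_fun_tnthP => j.
rewrite (_ : _ \o _ = fun z => upd i z.2 (g^~ z.1) j); last first.
  by apply/funext => w /=; rewrite tnth_mktuple.
rewrite /upd; case: eqP => _; first exact: measurable_snd.
exact: (measurableT_comp (mg j) measurable_fst).
Qed.

Let rect := [set B : set (n.-tuple R) | exists2 A : 'I_n -> set R,
  (forall j, measurable (A j)) & B = [set v | forall j, A j (tnth v j)]].

Lemma rect_generates : measurable = <<s rect >>.
Proof.
apply/seteqP; split=> B.
  apply: smallest_sub; first exact: smallest_sigma_algebra.
  move=> B1; rewrite -bigcup_seq => -[i _ [A mA <-]].
  apply: sub_sigma_algebra; exists (fun j => if j == i then A else setT).
    by move=> j; case: eqP.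
  apply/seteqP; split=> v /=; first by move=> [_ Av] j; case: eqP => [->|].
  by move=> /(_ i); rewrite eqxx.
apply: smallest_sub; first exact: sigma_algebra_measurable.
move=> _ [A mA ->].
rewrite (_ : [set v | _] = \bigcap_(j in setT) ((@tnth n R ^~ j) @^-1` A j)).
  apply: fin_bigcap_measurable => // j _.
  by rewrite -[X in measurable X]setTI; exact: measurable_tnth.
by apply/seteqP; split=> v /= h' j; [move=> _; exact: h'|exact: h'].
Qed.

Lemma rect_setI : setI_closed rect.
Proof.
move=> _ _ [A mA ->] [B mB ->]; exists (fun j => A j `&` B j).
  by move=> j; exact: measurableI.
by apply/seteqP; split=> v /=; [move=> [h1 h2] j|move=> h; split=> j; have [] := h j].
Qed.

Let pushforward_measure d1 d2 (T1 : measurableType d1) (T2 : measurableType d2)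
    (m : {measure set T1 -> \bar R}) (f : T1 -> T2) (mf : measurable_fun setT f) :=
  measure_function_pushforward__canonical__measure_function_Measure m mf.

(** Rectangles generate the sigma-algebra and are stable under intersection. On a rectangle, [A']
    drops the constraint on [g i], and the second factor restores the mass of [A i]. *)
Lemma replace_coordinate i (B : set (n.-tuple R)) : measurable B ->
  P (gtuple @^-1` B) = (P \x gam1)%E (rtuple i @^-1` B).
Proof.
have preT (A : 'I_n -> set R) : gtuple @^-1` [set v | forall j, A j (tnth v j)] =
    [set w | forall j, A j (g j w)].
  by apply/seteqP; split=> w /= h j; have := h j; rewrite tnth_mktuple.
apply: (@measure_unique _ _ _ rect (fun=> setT) rect_generates rect_setI _ _
   (pushforward_measure P measurable_gtuple)
   (pushforward_measure (P \x gam1)%E (measurable_rtuple i))).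
- by move=> _; exists (fun=> setT) => //; apply/seteqP.
- by apply/seteqP; split=> // v _; exists 0%N.
- move=> _ [A mA ->] /=.
  rewrite /pushforward preT gaussian_rectangle//.
  pose A' (j : 'I_n) := if j == i then setT else A j.
  have mA' j : measurable (A' j) by rewrite /A'; case: eqP.
  have -> : rtuple i @^-1` [set v | forall j, A j (tnth v j)] =
      [set w | forall j, A' j (g j w)] `*` A i.
    apply/seteqP; split=> -[w x] /=.
      move=> h; split=> [j|]; last by have := h i; rewrite tnth_mktuple /upd eqxx.
      have := h j; rewrite tnth_mktuple /upd /A'; by case: eqP.
    move=> [h1 h2] j; rewrite tnth_mktuple /upd; have := h1 j.
    by rewrite /A'; case: eqP => [->|].
  have mr : measurable [set w | forall j, A' j (g j w)].
    rewrite -preT -[X in measurable X]setTI; apply: measurable_gtuple => //.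
    by rewrite rect_generates; apply: sub_sigma_algebra; exists A'.
  rewrite [RHS](product_measure1E P gam1 mr (mA i)).
  rewrite [X in (X * _)%E](gaussian_rectangle mA') -[X in (_ * X)%E](fineK (fin_num_measure gam1 _ (mA i))) -EFinM.
  congr EFin; rewrite (bigD1 i)//= [in RHS](bigD1 i)//= mulrC; congr (_ * _).
  rewrite {1}/A' eqxx [X in _ = X * _](_ : _ = 1) ?mul1r; last first.
    by have -> : gaussian (1 : R) setT = 1%E by exact: probability_setT.
  by apply: eq_bigr => j /negbTE ji; rewrite /A' ji.
- by move=> _; rewrite /= /pushforward preimage_setT (@probability_setT _ _ _ P) ltry.
Qed.

Lemma Ex_replace i (F : ('I_n -> R) -> R) :
  measurable_fun setT (fun v : n.-tuple R => F (tnth v)) ->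
  intg P (fun w => F (g^~ w)) ->
  (P \x gam1)%E.-integrable setT (fun z => (F (upd i z.2 (g^~ z.1)))%:E) /\
  Ex P (fun w => F (g^~ w)) = \int[(P \x gam1)%E]_z F (upd i z.2 (g^~ z.1)).
Proof.
move=> mF IF.
pose F' := EFin \o (fun v : n.-tuple R => F (tnth v)).
have mF' : measurable_fun setT F' by exact/measurable_EFinP.
have E1 : F' \o gtuple = fun w => (F (g^~ w))%:E.
  apply/funext => w; rewrite /F'/=; congr (F _)%:E.
  by apply/funext => j; rewrite tnth_mktuple.
have E2 : F' \o rtuple i = fun z => (F (upd i z.2 (g^~ z.1)))%:E.
  apply/funext => w; rewrite /F'/=; congr (F _)%:E.
  by apply/funext => j; rewrite tnth_mktuple.
pose X : {RV P >-> n.-tuple R} := HB.pack gtuple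
  (@isMeasurableFun.Build _ _ _ _ gtuple measurable_gtuple).
have IX : intg (distribution P X) (fun v => F (tnth v)).
  apply: (integrable_pushforward measurable_gtuple mF' _ measurableT).
  by rewrite E1 preimage_setT.
have [I2 e2] := @intg_transfer _ _ _ (P \x gam1)%E _ _ (distribution P X) _ _
  (measurable_rtuple i) (fun B mB => esym (replace_coordinate i mB)) IX.
have [_ e1] := @intg_transfer _ _ _ P _ _ (distribution P X) _ _
  measurable_gtuple (fun _ _ => erefl) IX.
split; first by rewrite -E2.
by rewrite /Ex /Rintegral -E1 -E2; exact: etrans e1 (esym e2).
Qed.

End Independence.

(** * Functions of polynomial growth in several variables *)

Section Tame.
Context {R : realType} (n : nat).
Implicit Types (F : ('I_n -> R) -> R) (dF : 'I_n -> ('I_n -> R) -> R).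

Definition weight (v : 'I_n -> R) := 1 + \sum_j v j ^+ 2.

Lemma weight_ge1 v : 1 <= weight v.
Proof. by rewrite lerDl sumr_ge0// => j _; exact: sqr_ge0. Qed.

Lemma weight_ge0 v : 0 <= weight v.
Proof. exact: le_trans (weight_ge1 v). Qed.

Lemma weight_upd i x v : weight (upd i x v) <= weight v * pw 1 x.
Proof.
rewrite /weight /pw expr1 (bigD1 i)//= /upd eqxx [in leRHS](bigD1 i)//=.
rewrite (eq_bigr (fun j => v j ^+ 2)); last by move=> j /negbTE ->.
have : 0 <= \sum_(j < n | j != i) v j ^+ 2 by rewrite sumr_ge0// => j _; exact: sqr_ge0.
move: (\sum_(j < n | j != i) v j ^+ 2) => S S0.
have := sqr_ge0 (v i); have := sqr_ge0 x; move: (x ^+ 2) (v i ^+ 2) => a b a0 b0.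
nra.
Qed.

(** Polynomials are evaluated on functions ['I_n -> R], while measurability is read on tuples;
    [tnth] connects the two. *)
Record poly_growth F : Prop := {
  pg_meas : measurable_fun setT (fun v : n.-tuple R => F (tnth v));
  pg_bound : exists C k, forall v, `|F v| <= C * weight v ^+ k }.

Lemma pg_boundP F : poly_growth F ->
  exists C k, 0 <= C /\ forall k', (k <= k')%N -> forall v, `|F v| <= C * weight v ^+ k'.
Proof.
move=> [_ [C [k h]]]; have C0 : 0 <= C.
  have := le_trans (normr_ge0 _) (h (fun=> 0)).
  by rewrite pmulr_lge0// exprn_gt0// (lt_le_trans _ (weight_ge1 _)).
exists C, k; split=> // k' kk v; apply: (le_trans (h v)).
by rewrite ler_wpM2l// ler_weXn2l// weight_ge1.
Qed.

Lemma pgD F G : poly_growth F -> poly_growth G -> poly_growth (fun v => F v + G v).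
Proof.
move=> pF pG; split; first exact: measurable_funD (pg_meas pF) (pg_meas pG).
have [C [k [C0 hF]]] := pg_boundP pF; have [D [l [D0 hG]]] := pg_boundP pG.
exists (C + D), (maxn k l) => v; apply: (le_trans (ler_normD _ _)).
by rewrite mulrDl lerD// ?hF ?hG// ?leq_maxl// leq_maxr.
Qed.

Lemma pgN F : poly_growth F -> poly_growth (fun v => - F v).
Proof.
move=> [mF [C [k hF]]]; split; first exact: measurableT_comp.
by exists C, k => v; rewrite normrN.
Qed.

Lemma pgM F G : poly_growth F -> poly_growth G -> poly_growth (fun v => F v * G v).
Proof.
move=> pF pG; split; first exact: measurable_funM (pg_meas pF) (pg_meas pG).
have [C [k [C0 hF]]] := pg_boundP pF; have [D [l [D0 hG]]] := pg_boundP pG.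
exists (C * D), (k + l)%N => v.
by rewrite normrM exprD mulrACA ler_pM// ?hF// hG.
Qed.

Lemma pg_bounded F K : measurable_fun setT (fun v : n.-tuple R => F (tnth v)) ->
  (forall v, `|F v| <= K) -> poly_growth F.
Proof. by move=> mF bF; split => //; exists K, 0 => v; rewrite expr0 mulr1. Qed.

Lemma pg_cst c : poly_growth (fun=> c).
Proof. by apply: (@pg_bounded _ `|c|) => //; exact: measurable_cst. Qed.

Lemma pg_coord i : poly_growth (fun v => v i).
Proof.
split; first exact: measurable_tnth.
exists 1, 1%N => v; rewrite mul1r expr1 /weight (bigD1 i)//= addrA.
apply: (@le_trans _ _ (1 + v i ^+ 2)); last first.
  by rewrite lerDl sumr_ge0// => j _; exact: sqr_ge0.
rewrite ler_norml; apply/andP; split; nra.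
Qed.

(** What [normal_ibp] requires in each coordinate separately. The class contains the polynomials and
    is stable under sums, products and composition with bounded C^1 functions, so it contains the
    test functions of Stein's method. *)
Record tame F dF : Prop := {
  tame_pg : poly_growth F;
  tame_dpg : forall i, poly_growth (dF i);
  tame_derive : forall i (v : 'I_n -> R) (x : R),
    is_derive x 1 (fun x : R => F (upd i x v)) (dF i (upd i x v));
  tame_cont : forall i (v : 'I_n -> R), continuous (fun x : R => dF i (upd i x v)) }.

Lemma tame_continuous F dF i (v : 'I_n -> R) : tame F dF -> continuous (fun x : R => F (upd i x v)).
Proof. by move=> tF; exact: is_derive_continuous (tame_derive tF i v). Qed.

Lemma tame_cst c : tame (fun=> c) (fun _ _ => 0).
Proof.
split=> [|i|i v x|i v x]; [exact: pg_cst|exact: pg_cst| |exact: cvg_cst].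
exact: is_derive_cst.
Qed.

Lemma tame_coord i : tame (fun v => v i) (fun j _ => (j == i)%:R).
Proof.
split=> [|j|j v x|j v x]; [exact: pg_coord|exact: pg_cst| |exact: cvg_cst].
rewrite /upd eq_sym; case: eqP => _; [exact: is_derive_id|exact: is_derive_cst].
Qed.

Lemma tameD F dF G dG : tame F dF -> tame G dG ->
  tame (fun v => F v + G v) (fun i v => dF i v + dG i v).
Proof.
move=> tF tG; split=> [|i|i v x|i v x].
- by apply: pgD; [exact: tame_pg tF|exact: tame_pg tG].
- by apply: pgD; [exact: tame_dpg tF i|exact: tame_dpg tG i].
- by have := is_deriveD (tame_derive tF i v x) (tame_derive tG i v x).
- by apply: cvgD; [exact: tame_cont tF i v x|exact: tame_cont tG i v x].
Qed.

Lemma tameM F dF G dG : tame F dF -> tame G dG ->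
  tame (fun v => F v * G v) (fun i v => F v * dG i v + G v * dF i v).
Proof.
move=> tF tG; split=> [|i|i v x|i v x].
- by apply: pgM; [exact: tame_pg tF|exact: tame_pg tG].
- apply: pgD; apply: pgM;
    [exact: tame_pg tF|exact: tame_dpg tG i|exact: tame_pg tG|exact: tame_dpg tF i].
- by have := is_deriveM (tame_derive tF i v x) (tame_derive tG i v x).
- apply: cvgD; apply: cvgM.
  + exact: tame_continuous tF x.
  + exact: tame_cont tG i v x.
  + exact: tame_continuous tG x.
  + exact: tame_cont tF i v x.
Qed.

Lemma eq_tame F dF G dG : (forall v, F v = G v) -> (forall i v, dF i v = dG i v) ->
  tame F dF -> tame G dG.
Proof.
move=> FG dFG; have -> : F = G by exact/funext.
suff -> : dF = dG by [].
by apply/funext => i; exact/funext.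
Qed.

Lemma tame_comp F dF (psi dpsi : R -> R) (K : R) : tame F dF ->
  (forall x : R, is_derive x 1 psi (dpsi x)) -> continuous dpsi ->
  (forall x, `|psi x| <= K) -> (forall x, `|dpsi x| <= K) ->
  tame (fun v => psi (F v)) (fun i v => dpsi (F v) * dF i v).
Proof.
move=> tF dp cp bp bdp.
have bounded (h : R -> R) : continuous h -> (forall x, `|h x| <= K) -> poly_growth (fun v => h (F v)).
  move=> ch hK; apply: (@pg_bounded _ K) => //.
  apply: (@measurableT_comp _ _ _ _ _ _ h); last exact: pg_meas (tame_pg tF).
  exact: continuous_measurable_fun.
have cpsi := is_derive_continuous dp.
split=> [|i|i v x|i v x].
- exact: bounded.
- by apply: pgM; [exact: bounded|exact: (tame_dpg tF i)].
- exact: (@is_derive1_comp _ psi (fun x => F (upd i x v)) x _ _ (dp _) (tame_derive tF i v x)).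
- apply: (@cvgM _ _ _ _ (fun x => dpsi (F (upd i x v))) (fun x => dF i (upd i x v))); last exact: (tame_cont tF).
  apply: continuous_comp; [exact: tame_continuous tF x|exact: cp].
Qed.

Lemma tame_meval (a : mpoly n R) :
  tame (fun v => meval v a) (fun i v => meval v (mderiv i a)).
Proof.
pose Q (a : mpoly n R) := tame (fun v => meval v a) (fun i v => meval v (mderiv i a)).
have Q1 (c : R) : Q (c *: 1).
  apply: (eq_tame _ _ (tame_cst c)) => [v|i v]; first by rewrite mevalZ meval1 mulr1.
  by rewrite mderiv_cst meval0.
have QM b b' : Q b -> Q b' -> Q (b * b').
  move=> qb qb'; apply: (eq_tame _ _ (tameM qb qb')) => [v|i v].
    by rewrite mevalM.
  by rewrite mderivM mevalD !mevalM addrC mulrC.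
have QX i : Q (mvar R i).
  apply: (eq_tame _ _ (tame_coord i)) => [v|j v]; first by rewrite /mvar mevalXU.
  by rewrite mderiv_mvar rmorph_nat.
have QD b b' : Q b -> Q b' -> Q (b + b').
  move=> qb qb'; apply: (eq_tame _ _ (tameD qb qb')) => [v|i v].
    by rewrite mevalD.
  by rewrite mderivD mevalD.
have Qm m : Q (mpolyX R m).
  rewrite mpolyXE_id; elim/big_rec: _ => [|i b _ qb]; first by rewrite -[1]scale1r.
  apply: (QM) (qb); elim: (m i) => [|k ih]; first by rewrite expr0 -[1]scale1r.
  by rewrite exprS; exact: (QM _ _ (QX i) ih).
rewrite -/(Q a); elim/mpolyind: a => [|c m b _ _ qb].
  by rewrite -(scale0r 1).
by apply: QD => //; rewrite -[mpolyX _ _]mul1r scalerAl; exact: QM.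
Qed.

End Tame.

(** * Integration by parts for a Gaussian family *)

Section IntegrationByParts.
Context {R : realType} d (T : measurableType d) (P : probability T R).
Variables (n : nat) (g : 'I_n -> T -> R).
Hypothesis gf : gaussian_family P g.
Local Notation gam1 := (gaussian (1 : R)).

Let intg_pow1D (u v : T -> R) :
  measurable_fun setT u -> measurable_fun setT v ->
  (forall w, 0 <= u w) -> (forall w, 0 <= v w) ->
  (forall k, intg P (fun w => u w ^+ k)) -> (forall k, intg P (fun w => v w ^+ k)) ->
  forall k, intg P (fun w => (u w + v w) ^+ k).
Proof.
move=> mu mv u0 v0 Iu Iv k.
apply: (@intg_le _ _ _ P _ (fun w => 2 ^+ k * (u w ^+ k + v w ^+ k))).
- by apply: measurable_funX; exact: measurable_funD.
- move=> w; rewrite ger0_norm ?exprn_ge0 ?addr_ge0//.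
  wlog uv : u v mu mv u0 v0 Iu Iv / u w <= v w.
    by move=> h; case: (leP (u w) (v w)) => [|/ltW] vu; [exact: h|rewrite addrC (addrC (u w ^+ k)); exact: h].
  apply: (@le_trans _ _ ((2 * v w) ^+ k)).
    by rewrite lerXn2r ?nnegrE ?addr_ge0 ?mulr_ge0// mulr_natl mulr2n lerD2r.
  by rewrite exprMn ler_wpM2l ?exprn_ge0// lerDr exprn_ge0.
- by apply: intgZ; exact: intgD.
Qed.

Lemma intg_weight k : intg P (fun w => weight (g^~ w) ^+ k).
Proof.
have mg := gf_meas gf.
have h (r : seq 'I_n) : measurable_fun setT (fun w => \sum_(j <- r) g j w ^+ 2) /\
    forall k, intg P (fun w => (\sum_(j <- r) g j w ^+ 2) ^+ k).
  elim: r => [|j r [m1 ih]].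
    split; first by under eq_fun do rewrite big_nil; exact: measurable_cst.
    by move=> l; under [X in intg _ X]eq_fun do rewrite big_nil; exact: intg_cst.
  split.
    under eq_fun do rewrite big_cons; apply: measurable_funD => //.
    exact: measurable_funX.
  move=> l; under [X in intg _ X]eq_fun do rewrite big_cons.
  apply: intg_pow1D => //.
  - exact: measurable_funX.
  - by move=> w; exact: sqr_ge0.
  - by move=> w; rewrite sumr_ge0// => i _; exact: sqr_ge0.
  - move=> {}l; have [] // := @intg_transfer R _ _ P _ _ gam1 (g j) (fun x => (x ^+ 2) ^+ l) (gf_meas gf j) (gf_law gf j) _.
    apply: (@intg_le _ _ _ gam1 _ (pw l)); last exact: intg_pw.
      by apply: measurable_funX; exact: measurable_funX.
    move=> x; have x0 := sqr_ge0 x.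
    rewrite ger0_norm; last exact: exprn_ge0.
    by rewrite lerXn2r ?nnegrE// ?addr_ge0// lerDr.
have [m1 h1] := h (index_enum 'I_n).
apply: intg_pow1D => //.
- by move=> w; rewrite sumr_ge0// => i _; exact: sqr_ge0.
- by move=> l; exact: intg_cst.
Qed.

Lemma measurable_pg F : poly_growth F -> measurable_fun setT (fun w => F (g^~ w)).
Proof.
move=> pF; have := measurableT_comp (pg_meas pF) (measurable_gtuple gf).
congr (measurable_fun _ _); apply/funext => w /=; congr F.
by apply/funext => j; rewrite tnth_mktuple.
Qed.

Lemma intg_pg F : poly_growth F -> intg P (fun w => F (g^~ w)).
Proof.
move=> pF; have [C [k h]] := pg_bound pF.
apply: (@intg_le _ _ _ P _ (fun w => C * weight (g^~ w) ^+ k)).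
- exact: measurable_pg.
- by move=> w; exact: h.
- by apply: intgZ; exact: intg_weight.
Qed.

(** Replace [g i] by a coordinate on a second factor, then apply the one-dimensional formula in that
    coordinate with the others frozen. *)
Lemma gaussian_ibp F dF i : tame F dF ->
  Ex P (fun w => g i w * F (g^~ w)) = Ex P (fun w => dF i (g^~ w)).
Proof.
move=> tF.
have pF := tame_pg tF; have pdF := tame_dpg tF i.
have pxF : poly_growth (fun v => v i * F v) by apply: pgM => //; exact: pg_coord.
have [I1 e1] := Ex_replace gf i (pg_meas pxF) (intg_pg pxF).
have [I2 e2] := Ex_replace gf i (pg_meas pdF) (intg_pg pdF).
have IBP w : [/\ intg gam1 (fun x => x * F (upd i x (g^~ w))),
    intg gam1 (fun x => dF i (upd i x (g^~ w))) &
    Ex gam1 (fun x => x * F (upd i x (g^~ w))) =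
    Ex gam1 (fun x => dF i (upd i x (g^~ w)))].
  have [C [k [C0 hF]]] := pg_boundP pF; have [D [l [D0 hdF]]] := pg_boundP pdF.
  pose m := maxn k l; pose v := g^~ w.
  have wm x : weight (upd i x v) ^+ m <= weight v ^+ m * pw m x.
    rewrite /pw -exprMn lerXn2r ?nnegrE ?weight_ge0 ?mulr_ge0 ?weight_ge0 ?addr_ge0 ?sqr_ge0//.
    by have := weight_upd i x v; rewrite /pw expr1.
  have [] := @normal_ibp _ _ (oner_neq0 R) (fun x => F (upd i x v))
    (fun x => dF i (upd i x v)) ((C + D) * weight v ^+ m) m.
  - exact: tame_derive tF i v.
  - exact: tame_cont tF i v.
  - move=> x; apply: (le_trans (hF m (leq_maxl _ _) _)).
    by rewrite -mulrA ler_pM ?exprn_ge0 ?weight_ge0 ?lerDl.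
  - move=> x; apply: (le_trans (hdF m (leq_maxr _ _) _)).
    by rewrite -mulrA ler_pM ?exprn_ge0 ?weight_ge0 ?lerDr.
  by move=> h1 h2; rewrite expr1n mul1r => h3; split.
rewrite e1 e2.
have [|_ ->] := Ex_prod1 I1.
  move=> w; rewrite /=; under [X in intg _ X]eq_fun do rewrite {1}/upd eqxx.
  by have [] := IBP w.
have [|_ ->] := Ex_prod1 I2; first by move=> w; have [] := IBP w.
apply: eq_Ex => w /=; under eq_Ex do rewrite {1}/upd eqxx.
by have [] := IBP w.
Qed.

Lemma gaussian_expectation_meval :
  gaussian_expectation (fun a : mpoly n R => Ex P (fun w => meval (g^~ w) a)).
Proof.
have Ia (a : mpoly n R) : intg P (fun w => meval (g^~ w) a).
  exact: (intg_pg (tame_pg (tame_meval a))).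
split=> [c a b||a|i a].
- rewrite -ExZ// -ExD//; last exact: intgZ.
  by apply: eq_Ex => w; rewrite mevalD mevalZ.
- by under eq_Ex do rewrite meval1; rewrite Ex_cst.
- by apply: Ex_ge0 => w; rewrite rmorphXn sqr_ge0.
- rewrite -(gaussian_ibp i (tame_meval a)); apply: eq_Ex => w.
  by rewrite mevalM /mvar mevalXU.
Qed.

End IntegrationByParts.

(** * Stein's method *)

Section TestFunctions.
Context {R : realType}.
Implicit Types (b db : R -> R) (K : R).

(** A single constant bounds the function and its derivative; it is then also a Lipschitz constant,
    and products are controlled by powers of it. *)
Record c1bound K b db : Prop := {
  c1_derive : forall x : R, is_derive x 1 b (db x);
  c1_cont : continuous db;
  c1_bnd : forall x, `|b x| <= K;
  c1_dbnd : forall x, `|db x| <= K }.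

Definition c1b b := exists K db, c1bound K b db.

Lemma c1bound_ge0 K b db : c1bound K b db -> 0 <= K.
Proof. by move=> h; exact: le_trans (normr_ge0 _) (c1_bnd h 0). Qed.

Lemma c1bound_continuous K b db : c1bound K b db -> continuous b.
Proof. by move=> h; exact: is_derive_continuous (c1_derive h). Qed.

Lemma c1b_continuous b : c1b b -> continuous b.
Proof. by move=> [K [db h]]; exact: c1bound_continuous h. Qed.

Lemma c1b_measurable b : c1b b -> measurable_fun setT b.
Proof. by move=> /c1b_continuous; exact: continuous_measurable_fun. Qed.

Lemma c1b_bounded b : c1b b -> exists K, forall x, `|b x| <= K.
Proof. by move=> [K [db h]]; exists K; exact: c1_bnd h. Qed.

Lemma c1boundW K K' b db : K <= K' -> c1bound K b db -> c1bound K' b db.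
Proof.
move=> KK h; split; [exact: c1_derive h|exact: c1_cont h| |] => x.
  exact: le_trans (c1_bnd h x) KK.
exact: le_trans (c1_dbnd h x) KK.
Qed.

Lemma c1bound_lipschitz K b db : c1bound K b db ->
  forall x y, `|b x - b y| <= K * `|x - y|.
Proof.
move=> h x y; wlog xy : x y / y <= x.
  move=> H; have [yx|/ltW xy] := leP y x; first exact: H.
  by rewrite distrC [in leRHS]distrC; exact: H.
move: xy; rewrite le_eqVlt => /predU1P[->|yx]; first by rewrite !subrr normr0 mulr0.
have [|c _ ->] := @MVT _ b db y x yx (fun z _ => c1_derive h z).
  exact: continuous_subspaceT (c1bound_continuous h).
by rewrite normrM ler_wpM2r// (c1_dbnd h).
Qed.

Lemma c1b_cst c : c1b (fun=> c).
Proof.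
exists `|c|, (fun=> 0); split=> // [x|x|x]; last by rewrite normr0.
  exact: is_derive_cst.
exact: cvg_cst.
Qed.

Lemma c1bD b b' : c1b b -> c1b b' -> c1b (fun x => b x + b' x).
Proof.
move=> [K [db h]] [K' [db' h']]; exists (K + K'), (fun x => db x + db' x).
split=> [x|x|x|x].
- by have := is_deriveD (c1_derive h x) (c1_derive h' x).
- by apply: cvgD; [exact: c1_cont h x|exact: c1_cont h' x].
- by apply: (le_trans (ler_normD _ _)); rewrite lerD// ?(c1_bnd h) ?(c1_bnd h').
- by apply: (le_trans (ler_normD _ _)); rewrite lerD// ?(c1_dbnd h) ?(c1_dbnd h').
Qed.

Lemma c1bM b b' : c1b b -> c1b b' -> c1b (fun x => b x * b' x).
Proof.
move=> [K [db h]] [K' [db' h']].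
have K0 := c1bound_ge0 h; have K0' := c1bound_ge0 h'.
exists (2 * (K * K')), (fun x => b x * db' x + b' x * db x).
split=> [x|x|x|x].
- by have := is_deriveM (c1_derive h x) (c1_derive h' x).
- apply: cvgD; apply: cvgM.
  + exact: c1bound_continuous h x.
  + exact: c1_cont h' x.
  + exact: c1bound_continuous h' x.
  + exact: c1_cont h x.
- rewrite normrM mulr_natl mulr2n ler_wpDl ?mulr_ge0//.
  by rewrite ler_pM// ?(c1_bnd h) ?(c1_bnd h').
- apply: (le_trans (ler_normD _ _)); rewrite !normrM mulr_natl mulr2n lerD//.
    by rewrite ler_pM// ?(c1_bnd h) ?(c1_dbnd h').
  by rewrite mulrC ler_pM// ?(c1_dbnd h) ?(c1_bnd h').
Qed.

Lemma c1bZ c b : c1b b -> c1b (fun x => c * b x).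
Proof. by move=> h; apply: c1bM => //; exact: c1b_cst. Qed.

Lemma c1bB b b' : c1b b -> c1b b' -> c1b (fun x => b x - b' x).
Proof.
move=> h h'; under eq_fun do rewrite -mulN1r.
by apply: c1bD => //; exact: c1bZ.
Qed.

Lemma c1b_affine b (l t : R) : c1b b -> c1b (fun x => b (l * x + t)).
Proof.
move=> [K [db h]]; have K0 := c1bound_ge0 h.
exists (K * (1 + `|l|)), (fun x => db (l * x + t) * l).
have daff (x : R) : is_derive x 1 (fun x => l * x + t) l.
  by apply: is_derive_eq; rewrite /GRing.scale/=; ring.
split=> [x|x|x|x].
- exact: (@is_derive1_comp _ b (fun x => l * x + t) x _ _ (c1_derive h _) (daff x)).
- apply: cvgM; last exact: cvg_cst.
  apply: (@continuous_comp _ _ _ (fun x => l * x + t) db); last exact: c1_cont h _.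
  exact: is_derive_continuous daff x.
- by apply: (le_trans (c1_bnd h _)); rewrite ler_peMr// lerDl.
- by rewrite normrM ler_pM// ?(c1_dbnd h)// lerDr.
Qed.

Lemma continuous_compact_bounded (f : R -> R) (M : R) : continuous f ->
  (forall x, M < `|x| -> f x = 0) -> exists2 K, 0 <= K & forall x, `|f x| <= K.
Proof.
move=> cf f0; have [M0|M0] := ltP M 0.
  by exists 0 => // x; rewrite f0 ?normr0// (lt_le_trans M0).
have MM : - M <= M by rewrite ge0_cp.
have cn : {within `[- M, M], continuous (fun x => `|f x|)}.
  apply: continuous_subspaceT => x; apply: continuous_comp; first exact: cf.
  exact: norm_continuous.
have [c _ hc] := EVT_max MM cn.
exists `|f c| => // x; have [xM|xM] := ltP M `|x|; first by rewrite f0 ?normr0.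
by apply: hc; rewrite in_itv/= -ler_norml.
Qed.

Lemma c1b_compact b db (M : R) : (forall x : R, is_derive x 1 b (db x)) ->
  continuous db -> (forall x, M < `|x| -> b x = 0) ->
  (forall x, M < `|x| -> db x = 0) -> exists K, c1bound K b db.
Proof.
move=> dbx cdb b0 db0.
have cb := is_derive_continuous dbx.
have [K K0 hK] := continuous_compact_bounded cb b0.
have [L L0 hL] := continuous_compact_bounded cdb db0.
exists (K + L); split=> // x; first by rewrite (le_trans (hK x))// lerDl.
by rewrite (le_trans (hL x))// lerDr.
Qed.

(** This reduces differentiability of [ramp2], including at its kink, to an inequality checked by
    cases on signs. *)
Lemma is_derive_quadratic (f : R -> R) (x l K : R) :
  (forall y, `|f y - f x - l * (y - x)| <= K * (y - x) ^+ 2) ->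
  is_derive x 1 f l.
Proof.
move=> h; have K0 : 0 <= K.
  by have := le_trans (normr_ge0 _) (h (x + 1)); rewrite addrAC subrr add0r expr1n mulr1.
have c : h0^-1 *: ((f \o shift x) (h0 *: (1 : R)) - f x) @[h0 --> 0^'] --> l.
  apply/cvgrPdist_le => /= e e0.
  have eK : 0 < e / (K + 1) by rewrite divr_gt0// ltr_wpDl.
  near=> t.
  have t0 : t != 0 by near: t; exact: nbhs_dnbhs_neq.
  have tn : 0 < `|t| by rewrite normr_gt0.
  rewrite /GRing.scale/= mulr1 -(ler_pM2l tn) -normrM mulrBr.
  rewrite mulVKf//.
  have := h (t + x); rewrite addrK => ht.
  rewrite distrC (mulrC t); apply: (le_trans ht).
  rewrite -(real_normK (num_real t)) expr2 mulrCA ler_wpM2l//.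
  have : `|t| <= e / (K + 1) by near: t; exact: dnbhs0_le.
  rewrite ler_pdivlMr ?ltr_wpDl// => te; apply: le_trans te.
  by rewrite mulrDr mulr1 mulrC lerDl.
apply: DeriveDef; first by apply/cvg_ex; exists l.
exact/cvg_lim/c.
Unshelve. all: by end_near. Qed.

Let ramp2 (c x : R) : R := Num.max 0 (x - c) ^+ 2.

Let is_derive_ramp2 (c x : R) : is_derive x 1 (ramp2 c) (2 * Num.max 0 (x - c)).
Proof.
apply: (@is_derive_quadratic _ _ _ 1) => y; rewrite /ramp2.
have -> : y - x = (y - c) - (x - c) by ring.
move: (x - c) (y - c) => u v; rewrite mul1r ler_norml; apply/andP.
have uu := sqr_ge0 u; have vv := sqr_ge0 v; have uv := sqr_ge0 (v - u).
case: (leP 0 u) => hu; case: (leP 0 v) => hv.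
- by split; lra.
- have h : u * v <= 0 by rewrite mulr_ge0_le0// ltW.
  by split; rewrite expr0n /=; lra.
- have h : u * v <= 0 by rewrite mulr_le0_ge0// ltW.
  by split; rewrite expr0n /=; lra.
- by split; rewrite expr0n /=; lra.
Qed.

Let continuous_ramp (c : R) : continuous (fun x : R => Num.max 0 (x - c)).
Proof.
under eq_fun do rewrite maxr_absE.
move=> x; apply: cvgM; last exact: cvg_cst.
have cs : (y - c @[y --> x]) --> x - c by apply: cvgB; [exact: cvg_id|exact: cvg_cst].
apply: cvgD; first by apply: cvgD => //; exact: cvg_cst.
by apply: cvg_norm; apply: cvgB => //; exact: cvg_cst.
Qed.

(* A quadratic B-spline primitive: a C^1 step from 0 to 1 over [0, 1]. *)
Definition sstep (x : R) : R := 2 * (ramp2 0 x - 2 * ramp2 2^-1 x + ramp2 1 x).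

Let dsstep (x : R) : R :=
  4 * (Num.max 0 (x - 0) - 2 * Num.max 0 (x - 2^-1) + Num.max 0 (x - 1)).

Let is_derive_sstep (z : R) : is_derive z 1 sstep (dsstep z).
Proof.
have h := is_deriveZ 2 (is_deriveD (is_deriveB (is_derive_ramp2 0 z)
  (is_deriveZ 2 (is_derive_ramp2 2^-1 z))) (is_derive_ramp2 1 z)).
apply: is_derive_eq h _; rewrite /GRing.scale/= /dsstep; ring.
Qed.

Lemma sstep_le0 x : x <= 0 -> sstep x = 0.
Proof.
move=> x0; rewrite /sstep /ramp2 !max_l ?subr_le0 ?expr0n; first by rewrite /= mulr0 subrr addr0 mulr0.
all: by rewrite ?(le_trans x0).
Qed.

Lemma sstep_ge1 x : 1 <= x -> sstep x = 1.
Proof.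
move=> x1; rewrite /sstep /ramp2.
have h : 2^-1 <= 1 :> R by rewrite invf_le1// ler1n.
rewrite !max_r ?subr_ge0//; [by field|exact: le_trans x1|exact: le_trans x1].
Qed.

Lemma sstep_range x : 0 <= sstep x <= 1.
Proof.
rewrite /sstep /ramp2 subr0; apply/andP.
case: (leP 0 x) => h0; case: (leP 0 (x - 2^-1)) => h1; case: (leP 0 (x - 1)) => h2; split; nra.
Qed.

Lemma sstep_nd x y : x <= y -> sstep x <= sstep y.
Proof.
move=> xy; have d0 (z : R) : 0 <= dsstep z.
  rewrite /dsstep subr0.
  by case: (leP 0 z) => h0; case: (leP 0 (z - 2^-1)) => h1; case: (leP 0 (z - 1)) => h2; lra.
move: xy; rewrite le_eqVlt => /predU1P[->//|xy].
have [|c _ e] := @MVT _ sstep dsstep x y xy (fun z _ => is_derive_sstep z).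
  by apply: continuous_subspaceT; exact: is_derive_continuous is_derive_sstep.
by rewrite -subr_ge0 e mulr_ge0// subr_ge0 ltW.
Qed.

Lemma c1b_sstep : c1b sstep.
Proof.
exists 2, dsstep; split=> //.
- move=> x; apply: cvgM; first exact: cvg_cst.
  apply: cvgD; last exact: continuous_ramp.
  apply: cvgB; first exact: continuous_ramp.
  by apply: cvgM; [exact: cvg_cst|exact: continuous_ramp].
- move=> x; have /andP[h0 h1] := sstep_range x.
  by rewrite ger0_norm// (le_trans h1)// ler1n.
- move=> x; rewrite /dsstep subr0 ler_norml; apply/andP.
  by case: (leP 0 x) => h0; case: (leP 0 (x - 2^-1)) => h1; case: (leP 0 (x - 1)) => h2; split; lra.
Qed.

Lemma c1b_family (I : finType) (b : I -> R -> R) : (forall j, c1b (b j)) ->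
  exists K (db : I -> R -> R), forall j, c1bound K (b j) (db j).
Proof.
move=> h.
have ex j : exists x : R * (R -> R), c1bound x.1 (b j) x.2.
  by have [K [db hb]] := h j; exists (K, db).
have [Kj hK] := choice ex.
exists (\sum_j (Kj j).1), (fun j => (Kj j).2) => j.
apply: c1boundW (hK j); rewrite (bigD1 j)//= lerDl sumr_ge0// => i _.
exact: c1bound_ge0 (hK i).
Qed.

Lemma measurable_prod_test d (T : measurableType d) (I : eqType) (r : seq I) (b : I -> R -> R)
    (X : I -> T -> R) :
  (forall i, c1b (b i)) -> (forall i, measurable_fun setT (X i)) ->
  measurable_fun setT (fun w => \prod_(i <- r) b i (X i w)).
Proof.
move=> hb mX; apply: measurable_prod => i _.
exact: (measurableT_comp (c1b_measurable (hb i)) (mX i)).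
Qed.

Lemma prod_test_abs (I : Type) (b db : I -> R -> R) K : (forall i, c1bound K (b i) (db i)) ->
  forall (r : seq I) (v : I -> R), `|\prod_(i <- r) b i (v i)| <= K ^+ size r.
Proof.
move=> hb r v; elim: r => [|j s ih]; first by rewrite big_nil normr1.
by rewrite big_cons normrM exprS ler_pM// (c1_bnd (hb j)).
Qed.

Lemma intg_prod_test d (T : measurableType d) (P : probability T R) (I : finType)
    (b : I -> R -> R) (X : I -> T -> R) :
  (forall i, c1b (b i)) -> (forall i, measurable_fun setT (X i)) ->
  intg P (fun w => \prod_i b i (X i w)).
Proof.
move=> cb mX; have [K [db hb]] := c1b_family cb.
apply: (@intg_bounded _ _ _ P _ (K ^+ size (index_enum I))) => [|w].
  exact: measurable_prod_test.
exact: prod_test_abs hb _ _.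
Qed.

(** For large [m] it rises over [[- m, 1 - m]] and falls over [[m, m + 1]]; the lemmas on its values
    use the symmetric thresholds [m - 1] and [m + 1]. *)
Definition cutoff (m : R) (x : R) := sstep (x + m) - sstep (x - m).

Lemma c1b_cutoff m : c1b (cutoff m).
Proof.
apply: c1bB.
  by have := c1b_affine 1 m c1b_sstep; under eq_fun do rewrite mul1r.
by have := c1b_affine 1 (- m) c1b_sstep; under eq_fun do rewrite mul1r.
Qed.

Lemma cutoff_range m x : 0 <= m -> 0 <= cutoff m x <= 1.
Proof.
move=> m0; rewrite /cutoff subr_ge0 sstep_nd/=; last by rewrite lerD2l ge0_cp.
have /andP[_ h1] := sstep_range (x + m); have /andP[h0 _] := sstep_range (x - m).
by rewrite lerBlDr (le_trans h1)// lerDl.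
Qed.

Lemma cutoff_abs m x : 0 <= m -> `|cutoff m x| <= 1.
Proof. by move=> /(cutoff_range x)/andP[h0 h1]; rewrite ger0_norm. Qed.

Lemma measurable_cutoff d (T : measurableType d) (U : T -> R) m :
  measurable_fun setT U -> measurable_fun setT (fun w => cutoff m (U w)).
Proof. by apply: measurableT_comp; exact: c1b_measurable (c1b_cutoff m). Qed.

Lemma intg_cutoff d (T : measurableType d) (P : probability T R) (U : T -> R) m :
  measurable_fun setT U -> 0 <= m -> intg P (fun w => cutoff m (U w)).
Proof.
move=> mU m0; apply: (@intg_bounded _ _ _ P _ 1); first exact: measurable_cutoff.
by move=> w; exact: cutoff_abs.
Qed.

Lemma prod_cutoff_range (I : finType) m (v : I -> R) : 0 <= m ->
  0 <= \prod_i cutoff m (v i) <= 1.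
Proof.
move=> m0; elim/big_rec: _ => [|i y _ /andP[y0 y1]]; first by rewrite ler01 lexx.
have /andP[h0 h1] := cutoff_range (v i) m0.
by rewrite mulr_ge0//= mulr_ile1.
Qed.

Lemma cutoff_eq1 m x : `|x| <= m - 1 -> cutoff m x = 1.
Proof.
rewrite ler_norml => /andP[h1 h2]; rewrite /cutoff sstep_ge1; last by lra.
by rewrite sstep_le0 ?subr0//; lra.
Qed.

Lemma cutoff_eq0 m x : 0 <= m -> m + 1 <= `|x| -> cutoff m x = 0.
Proof.
move=> m0; rewrite ler_normr => /orP[h|h]; rewrite /cutoff.
  by rewrite !sstep_ge1 ?subrr//; lra.
by rewrite !sstep_le0 ?subrr//; lra.
Qed.

End TestFunctions.

(** * Stein's equation *)

Section SteinEquation.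
Context {R : realType}.
Variable s : R.
Hypothesis s0 : s != 0.
Local Notation mu := (@lebesgue_measure R).
Local Notation phi := (normal_pdf 0 s).

(* Since [a] has mean zero, the usual solution of Stein's equation is
   compactly supported, hence bounded together with its derivative. *)
Lemma stein_solution (a : R -> R) (M : R) : 0 < M -> continuous a ->
  (forall x, M < `|x| -> a x = 0) -> Ex (gaussian s) a = 0 ->
  exists K u du, c1bound K u du /\ forall x, a x = s ^+ 2 * du x - x * u x.
Proof.
move=> M0 ca a0 Ea.
have s2 : s ^+ 2 != 0 by rewrite expf_neq0.
pose f x := a x * phi x.
have cf : continuous f.
  by move=> x; apply: cvgM; [exact: ca|exact: continuous_normal_pdf].
have f0 x : M < `|x| -> f x = 0 by move=> /a0; rewrite /f => ->; rewrite mul0r.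
have Ia : intg (gaussian s) a.
  have [K _ hK] := continuous_compact_bounded ca a0.
  by apply: (@intg_bounded _ _ _ (gaussian s) _ K) => //; exact: continuous_measurable_fun.
have If : mu.-integrable setT (EFin \o f) by exact: intg_normalP.
have IfS (D : set R) : measurable D -> mu.-integrable D (EFin \o f).
  by move=> mD; apply: integrableS If.
(* The lower end lies strictly to the left of the support, so that the fundamental theorem applies
   at every [x >= - M], the edge included. *)
pose I x := \int[mu]_(t in `[- M - 1, x]) f t.
have I_lt x : x <= - M -> I x = 0.
  move=> xM; rewrite /I.
  have -> : \int[mu]_(t in `[- M - 1, x]) f t = \int[mu]_(t in `[- M - 1, x[) f t.
    by rewrite Rintegral_itv_bndo_bndc//; exact: IfS.
  rewrite (@eq_Rintegral _ _ _ mu _ (fun=> 0)).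
    by rewrite /Rintegral integral0.
  move=> t; rewrite inE/= in_itv/= => /andP[_ tx]; apply: f0.
  have tM : t < - M by rewrite (lt_le_trans tx).
  rewrite ltr0_norm; last by rewrite (lt_trans tM)// oppr_lt0.
  by rewrite ltrNr.
have I_gt x : M <= x -> I x = 0.
  move=> Mx; have : \int[mu]_t f t = 0 by rewrite -Ex_normal.
  rewrite /I => <-; rewrite [RHS](_ : _ = \int[mu]_(t in setT) f t)//.
  rewrite Rintegral_mkcond; apply: eq_Rintegral => t _.
  rewrite patchE; case: ifPn => // /negP nt; apply/esym.
  have [tM|tM] := ltP M `|t|; first exact: f0.
  have : t = M.
    apply/eqP; apply/negPn/negP => tn; apply: nt.
    rewrite inE/= in_itv/=; move: tM; rewrite ler_norml => /andP[h1 h2].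
    rewrite (le_trans _ Mx)// andbT (le_trans _ h1)// lerBlDr lerDl//.
  move=> tE; exfalso; apply: nt; rewrite inE/= in_itv/= tE Mx andbT.
  by rewrite lerBlDr; move: M0; lra.
have dI (x : R) : is_derive x 1 I (f x).
  have [xM|xM] := ltP x (- M).
    have nI : \forall y \near x, I y = 0.
      by near=> y; apply: I_lt; apply/ltW; near: y; exact: lt_nbhsl.
    have -> : f x = 0.
      apply: f0; rewrite ltr0_norm; first by rewrite ltrNr.
      by rewrite (lt_trans xM)// oppr_lt0.
    apply: DeriveDef.
      apply: (@near_eq_derivable _ _ _ (cst 0) I x 1); last exact: derivable_cst.
      by near do apply/esym.
    rewrite (@near_eq_derive _ _ _ I (cst 0) x 1) ?derive_cst//.
  have Mx : - M - 1 < x by rewrite (lt_le_trans _ xM)// gtrBl.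
  have [] := @continuous_FTC1_closed R f (- M - 1) x (x + 1) _ _ Mx (cf x).
  - by rewrite ltrDl.
  - exact: IfS.
  move=> h1 h2; apply: DeriveDef; first exact: h1.
  by rewrite -derive1E.
(* This is [1 / (s ^+ 2 * phi)] written out, so [I * w] is the classical solution. *)
pose w (x : R) := expR (x ^+ 2 / (2 * s ^+ 2)) / (s ^+ 2 * normal_peak s).
have p0 : normal_peak s != 0 by rewrite gt_eqF// normal_peak_gt0.
have wphi x : phi x * w x = (s ^+ 2)^-1.
  rewrite normal_pdfE// /normal_fun subr0 /w.
  have -> : - x ^+ 2 / (s ^+ 2 *+ 2) = - (x ^+ 2 / (2 * s ^+ 2)).
    by rewrite mulNr; congr (- (_ / _)); rewrite mulr_natl.
  rewrite expRN; have : expR (x ^+ 2 / (2 * s ^+ 2)) != 0 by rewrite gt_eqF// expR_gt0.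
  move: (expR _) p0 => e p0 e0; field; first by rewrite e0 p0 s0.
have dw (x : R) : is_derive x 1 w (x / s ^+ 2 * w x).
  apply: is_derive_eq; rewrite /GRing.scale/= /w.
  by field; rewrite p0 s0.
pose u x := I x * w x.
pose du x := (a x + x * u x) / s ^+ 2.
have dudx (x : R) : is_derive x 1 u (du x).
  have := is_deriveM (dI x) (dw x).
  move=> /is_derive_eq; apply; rewrite /GRing.scale/= /du /u /f.
  have -> : w x * (a x * phi x) = a x / s ^+ 2 by rewrite -(wphi x); ring.
  by field.
have cu := is_derive_continuous dudx.
have u0 x : M < `|x| -> u x = 0.
  rewrite ltr_normr /u => /orP[h|h]; first by rewrite I_gt ?mul0r// ltW.
  by rewrite I_lt ?mul0r// lerNr ltW.
have cdu : continuous du.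
  move=> x; apply: cvgM; last exact: cvg_cst.
  apply: cvgD; first exact: ca.
  by apply: cvgM; [exact: cvg_id|exact: cu].
have du0 x : M < `|x| -> du x = 0.
  by move=> Mx; rewrite /du a0// u0// mulr0 addr0 mul0r.
have [K hK] := c1b_compact dudx cdu u0 du0.
exists K, u, du; split=> // x.
by rewrite /du mulrC divfK// addrK.
Unshelve. all: by end_near. Qed.

End SteinEquation.

(** * Stein's bound for polynomials in a Gaussian family *)

Section SteinBound.
Context {R : realType} d (T : measurableType d) (P : probability T R).
Variables (n : nat) (g : 'I_n -> T -> R).
Hypothesis gf : gaussian_family P g.
Local Notation ev a w := (meval (g^~ w) a).

Lemma pg_sum I (r : seq I) (F : I -> ('I_n -> R) -> R) :
  (forall i, poly_growth (F i)) -> poly_growth (fun v => \sum_(i <- r) F i v).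
Proof.
move=> pF; elim: r => [|i r ih].
  by under eq_fun do rewrite big_nil; exact: pg_cst.
by under eq_fun do rewrite big_cons; exact: pgD.
Qed.

Lemma pg_meval (a : mpoly n R) : poly_growth (fun v => meval v a).
Proof. exact: tame_pg (tame_meval a). Qed.

Lemma meval_gam v (a b : mpoly n R) :
  meval v (gam a b) = \sum_i meval v (mderiv i a) * meval v (mderiv i b).
Proof. by rewrite /gam raddf_sum; apply: eq_bigr => i _; rewrite /= mevalM. Qed.

Ltac poly_growth := by repeat first
  [exact: pg_meval | exact: pg_cst | exact: pg_coord | apply: pgD | apply: pgM | apply: pgN
  | apply: pg_sum => ? | done].

(** The counterpart of [gexp_gam_eigen] for test functions that are not polynomials: the eigenvector
    equation rewrites [p * X] as [- ou X], and integration by parts is applied in each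
    coordinate. *)
Lemma stein_ibp p (X : mpoly n R) F dF : ou X = - (p%:R *: X) -> tame F dF ->
  p%:R * Ex P (fun w => ev X w * F (g^~ w)) =
  Ex P (fun w => \sum_i ev (mderiv i X) w * dF i (g^~ w)).
Proof.
move=> eX tF; have pF := tame_pg tF.
have pXF : poly_growth (fun v => meval v X * F v) by poly_growth.
rewrite -ExZ; last exact: intg_pg gf _ pXF.
have e w : p%:R * (ev X w * F (g^~ w)) = \sum_i (g i w * (ev (mderiv i X) w * F (g^~ w)) -
    ev (mderiv i (mderiv i X)) w * F (g^~ w)).
  have -> : p%:R * (ev X w * F (g^~ w)) = - (ev (ou X) w) * F (g^~ w).
    by rewrite eX mevalN mevalZ opprK mulrA.
  have -> : ev (ou X) w = \sum_i (ev (mderiv i (mderiv i X)) w - g i w * ev (mderiv i X) w).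
    rewrite /ou raddf_sum; apply: eq_bigr => i _ /=.
    by rewrite mevalB mevalM /mvar mevalXU.
  by rewrite -sumrN mulr_suml; apply: eq_bigr => i _; ring.
rewrite (eq_Ex _ e).
have pg1 i : poly_growth (fun v => v i * (meval v (mderiv i X) * F v)).
  by poly_growth.
have pg2 i : poly_growth (fun v => meval v (mderiv i (mderiv i X)) * F v) by poly_growth.
have pg3 i : poly_growth (fun v => meval v (mderiv i X) * dF i v).
  by have pdF := tame_dpg tF; poly_growth.
have I1 i := intg_pg gf (pg1 i).
have I2 i := intg_pg gf (pg2 i).
have I3 i := intg_pg gf (pg3 i).
rewrite (@Ex_sum _ _ _ P _ _ (fun i w => g i w * (ev (mderiv i X) w * F (g^~ w)) -
    ev (mderiv i (mderiv i X)) w * F (g^~ w))); last by move=> i; exact: intgB.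
rewrite (@Ex_sum _ _ _ P _ _ (fun i w => ev (mderiv i X) w * dF i (g^~ w)))//.
apply: eq_bigr => i _; rewrite ExB//.
have := gaussian_ibp gf i (tameM (tame_meval (mderiv i X)) tF) => ->.
rewrite -ExB//; last by apply: intgD => //; under [X in intg _ X]eq_fun do rewrite mulrC; exact: I2.
by apply: eq_Ex => w; ring.
Qed.

Variables (D : nat) (Y : 'I_D -> mpoly n R) (b db : 'I_D -> R -> R) (K : R).
Hypothesis hb : forall j, c1bound K (b j) (db j).

Lemma pg_c1_derive (X : mpoly n R) K0 u du : c1bound K0 u du ->
  poly_growth (fun v => du (meval v X)).
Proof.
move=> hu; apply: (@pg_bounded _ _ _ K0); last by move=> v; exact: (c1_dbnd hu).
apply: (@measurableT_comp _ _ _ _ _ _ du); last exact: pg_meas (pg_meval X).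
by apply: continuous_measurable_fun; exact: (c1_cont hu).
Qed.

(** The chain rule with coefficients bounded uniformly in [n] and in the polynomials [Y j]. Each new
    factor contributes the two terms of Leibniz's rule, whence [2 * K]. *)
Lemma prod_test (s : seq 'I_D) : exists c : 'I_D -> ('I_n -> R) -> R,
  [/\ forall j, poly_growth (c j),
      forall j v, `|c j v| <= (2 * K) ^+ size s &
      tame (fun v => \prod_(j <- s) b j (meval v (Y j)))
           (fun i v => \sum_j c j v * meval v (mderiv i (Y j)))].
Proof.
elim: s => [|j0 s [c [pc cK tc]]].
  exists (fun _ _ => 0); split=> [j|j v|]; [exact: pg_cst|by rewrite normr0 expr0|].
  apply: (eq_tame _ _ (tame_cst n 1)) => [v|i v]; first by rewrite big_nil.
  by rewrite big1// => j _; rewrite mul0r.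
have K0 := c1bound_ge0 (hb j0).
pose B v := \prod_(j <- s) b j (meval v (Y j)).
have tY := tame_comp (tame_meval (Y j0)) (c1_derive (hb j0)) (c1_cont (hb j0))
  (c1_bnd (hb j0)) (c1_dbnd (hb j0)).
have tYB := tameM tY tc.
exists (fun j v => b j0 (meval v (Y j0)) * c j v +
  (j == j0)%:R * (B v * db j0 (meval v (Y j0)))); split.
- move=> j /=; have pY := tame_pg tY; have pB : poly_growth B := tame_pg tc.
  by have pdb := pg_c1_derive (Y j0) (hb j0); poly_growth.
- move=> j v; apply: (le_trans (ler_normD _ _)).
  rewrite normrM exprS.
  have -> : 2 * K * (2 * K) ^+ size s = K * (2 * K) ^+ size s + K * (2 * K) ^+ size s by ring.
  rewrite lerD//; first by rewrite ler_pM// (c1_bnd (hb j0)).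
  have le : `|B v * db j0 (meval v (Y j0))| <= K * (2 * K) ^+ size s.
    rewrite normrM mulrC ler_pM// ?(c1_dbnd (hb j0))//.
    apply: (le_trans (prod_test_abs hb s (fun j => meval v (Y j)))).
    by rewrite lerXn2r ?nnegrE ?mulr_ge0// ler_peMl// ler1n.
  case: eqP => _; first by rewrite mul1r.
  by rewrite mul0r normr0 mulr_ge0// exprn_ge0// mulr_ge0.
apply: (eq_tame _ _ tYB) => [v|i v]; first by rewrite big_cons.
rewrite mulr_sumr (bigD1 j0)//= [in RHS](bigD1 j0)//= eqxx mul1r.
rewrite [X in _ = _ + X](eq_bigr (fun j => b j0 (meval v (Y j0)) * (c j v * meval v (mderiv i (Y j))))).
  by rewrite -/(B v); ring.
by move=> j /negbTE ->; rewrite mul0r addr0 mulrA.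
Qed.

(** Integration by parts with [u (X) * B] trades [X] for [gam X X / p] against [u' (X) * B], plus
    terms in [gam X (Y j) / p]. What is left is the deviation of [gam X X / p] from [s2] and the
    mixed terms, with a constant independent of [n] and of the polynomials. *)
Lemma stein_bound p (X : mpoly n R) (s2 Ku : R) (u du : R -> R) :
  (0 < p)%N -> ou X = - (p%:R *: X) -> c1bound Ku u du ->
  `|Ex P (fun w => (s2 * du (ev X w) - ev X w * u (ev X w)) *
      \prod_j b j (ev (Y j) w))| <=
  Ku * (K ^+ D + (2 * K) ^+ D) *
    (Ex P (fun w => `|s2 - ev (gam X X) w / p%:R|) +
     \sum_j Ex P (fun w => `|ev (gam X (Y j)) w|)).
Proof.
move=> p0 eX hu.
have [c [pc cK tc]] := prod_test (index_enum 'I_D).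
have sz : size (index_enum 'I_D) = D by rewrite -sum1_size big_const_ord iter_addn mul1n addn0.
rewrite sz in cK.
pose B v := \prod_j b j (meval v (Y j)).
have BK v : `|B v| <= K ^+ D.
  by have := prod_test_abs hb (index_enum 'I_D) (fun j => meval v (Y j)); rewrite sz.
have tu := tame_comp (tame_meval X) (c1_derive hu) (c1_cont hu) (c1_bnd hu) (c1_dbnd hu).
have tF := tameM tu tc.
have pgdu := pg_c1_derive X hu.
have pgB : poly_growth B by exact: (tame_pg tc).
have pgu : poly_growth (fun v => u (meval v X)) by exact: (tame_pg tu).
have pn : (p%:R : R) != 0 by rewrite pnatr_eq0 -lt0n.
have p1 : 1 <= p%:R :> R by rewrite ler1n.
have Ku0 := c1bound_ge0 hu.
have := stein_ibp eX tF; rewrite -/(B _) => ibp.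
pose H v := du (meval v X) * B v * (s2 - meval v (gam X X) / p%:R) -
  p%:R^-1 * (u (meval v X) * \sum_j c j v * meval v (gam X (Y j))).
have pgE1 : poly_growth (fun v => s2 - meval v (gam X X) / p%:R) by poly_growth.
have pgH : poly_growth H by poly_growth.
have EH : Ex P (fun w => (s2 * du (ev X w) - ev X w * u (ev X w)) * B (g^~ w)) =
    Ex P (fun w => H (g^~ w)).
  have pa : poly_growth (fun v => s2 * (du (meval v X) * B v)) by poly_growth.
  have pb : poly_growth (fun v => meval v X * (u (meval v X) * B v)) by poly_growth.
  have pc' : poly_growth (fun v => s2 * (du (meval v X) * B v) - H v) by poly_growth.
  have -> : Ex P (fun w => (s2 * du (ev X w) - ev X w * u (ev X w)) * B (g^~ w)) =
     Ex P (fun w => s2 * (du (ev X w) * B (g^~ w)) - ev X w * (u (ev X w) * B (g^~ w))).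
    by apply: eq_Ex => w; ring.
  rewrite ExB; [|exact: intg_pg gf _ pa|exact: intg_pg gf _ pb].
  have eb : Ex P (fun w => ev X w * (u (ev X w) * B (g^~ w))) =
      Ex P (fun w => s2 * (du (ev X w) * B (g^~ w)) - H (g^~ w)).
    apply: (mulfI pn); rewrite ibp -ExZ; last exact: intg_pg gf _ pc'.
    apply: eq_Ex => w; rewrite /H !meval_gam.
    have -> : \sum_i ev (mderiv i X) w * (u (ev X w) * (\sum_j c j (g^~ w) * ev (mderiv i (Y j)) w) +
        B (g^~ w) * (du (ev X w) * ev (mderiv i X) w)) =
      u (ev X w) * (\sum_j c j (g^~ w) * ev (gam X (Y j)) w) +
        B (g^~ w) * du (ev X w) * (\sum_i ev (mderiv i X) w * ev (mderiv i X) w).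
      rewrite mulr_sumr [X in _ = _ + X]mulr_sumr.
      under [X in _ = X + _]eq_bigr do rewrite meval_gam mulrA mulr_sumr.
      rewrite exchange_big/= -big_split/=; apply: eq_bigr => i _.
      rewrite mulrDr; congr (_ + _); last by ring.
      rewrite mulrA mulr_sumr; apply: eq_bigr => j _; ring.
    by field.
  rewrite eb -ExB; [|exact: intg_pg gf _ pa|exact: intg_pg gf _ pc'].
  by apply: eq_Ex => w; rewrite opprB addrC subrK.
rewrite -/(B _) EH.
have mH := measurable_pg gf pgH.
have In : intg P (fun w => `|s2 - ev (gam X X) w / p%:R|).
  by apply: intg_norm; exact: intg_pg gf _ pgE1.
have Ij j : intg P (fun w => `|ev (gam X (Y j)) w|).
  by apply: intg_norm; exact: intg_pg gf _ (pg_meval _).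
have Is : intg P (fun w => \sum_j `|ev (gam X (Y j)) w|) by exact: intg_sum.
rewrite -Ex_sum// -ExD// -ExZ; last exact: intgD.
apply: Ex_norm_le => //; last by apply: intgZ; exact: intgD.
move=> w; rewrite /H; apply: (le_trans (ler_normB _ _)).
have KD0 : 0 <= K ^+ D := le_trans (normr_ge0 _) (BK (g^~ w)).
have KD2 : 0 <= (2 * K) ^+ D by rewrite exprMn mulr_ge0// exprn_ge0.
rewrite [leRHS]mulrDr lerD//.
  rewrite !normrM ler_wpM2r// ler_pM//; first exact: (c1_dbnd hu).
  by apply: (le_trans (BK _)); rewrite lerDl.
rewrite !normrM normfV normr_nat.
apply: (@le_trans _ _ (1 * (Ku * ((2 * K) ^+ D * \sum_j `|ev (gam X (Y j)) w|)))).
  rewrite ler_pM ?mulr_ge0 ?invr_ge0 ?invf_le1 ?ltr0n// ler_pM//; first exact: (c1_bnd hu).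
  apply: (le_trans (ler_norm_sum _ _ _)); rewrite mulr_sumr; apply: ler_sum => j _.
  by rewrite normrM ler_wpM2r.
rewrite mul1r mulrA ler_wpM2r ?sumr_ge0// ler_wpM2l// lerDr//.
Qed.

End SteinBound.

(** * Normal moments, truncation and convergence of moments *)

Section Moments.
Context {R : realType}.

Lemma c1bound_derive_eq0 K (b db : R -> R) M x : c1bound K b db ->
  (forall x, M < `|x| -> b x = 0) -> M < `|x| -> db x = 0.
Proof.
move=> h b0 Mx.
have [_ <-] := c1_derive h x.
rewrite (@near_eq_derive _ _ _ b (cst 0) x 1) ?derive_cst//.
have : \forall y \near x, M < `|y|.
  by have h1 := @norm_continuous R R x; exact: cvgr_gt h1 _ Mx.
by apply: filterS => y; exact: b0.
Qed.

Lemma c1b_mulX (b : R -> R) M : c1b b -> (forall x, M < `|x| -> b x = 0) ->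
  c1b (fun x => x * b x).
Proof.
move=> [K [db h]] b0.
have db0 x := @c1bound_derive_eq0 K b db M x h b0.
have [|||x Mx|K' hK'] := @c1b_compact R (fun x => x * b x) (fun x => x * db x + b x) M.
- move=> x; have := is_deriveM (is_derive_id x 1) (c1_derive h x).
  by move=> /is_derive_eq; apply; rewrite /GRing.scale/= mulr1.
- move=> x; apply: cvgD; last exact: c1bound_continuous h x.
  by apply: cvgM; [exact: cvg_id|exact: c1_cont h x].
- by move=> x Mx; rewrite b0// mulr0.
- by rewrite db0// b0// mulr0 addr0.
by exists K', (fun x => x * db x + b x).
Qed.

Lemma c1b_pow_cutoff k (m : R) : 0 <= m -> c1b (fun x => x ^+ k * cutoff m x).
Proof.
move=> m0; have c0 j x : m + 1 < `|x| -> x ^+ j * cutoff m x = 0.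
  by move=> h; rewrite cutoff_eq0 ?mulr0// ltW.
elim: k => [|k ih].
  by under eq_fun do rewrite expr0 mul1r; exact: c1b_cutoff.
under eq_fun do rewrite exprS -mulrA.
exact: (@c1b_mulX _ (m + 1) ih (c0 k)).
Qed.

Variable s : R.
Hypothesis s0 : s != 0.
Local Notation N := (gaussian s).

Lemma normX_le_pw (x : R) k : `|x ^+ k| <= pw k x.
Proof.
rewrite normrX /pw lerXn2r ?nnegrE ?addr_ge0 ?sqr_ge0//.
rewrite ler_norml; apply/andP; split; nra.
Qed.

Lemma intg_normal_pow k : intg N (fun x => x ^+ k).
Proof.
apply: (@intg_le _ _ _ N _ (pw k)); last exact: intg_pw.
  exact: measurable_funX.
by move=> x; exact: normX_le_pw.
Qed.

Lemma normal_moment k : Ex N (fun x => x ^+ k.+2) = s ^+ 2 * (k.+1%:R * Ex N (fun x => x ^+ k)).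
Proof.
have dF (x : R) : is_derive x 1 (fun x => x ^+ k.+1) (k.+1%:R * x ^+ k).
  apply: DeriveDef; first exact: exprn_derivable.
  by rewrite exp_derive /GRing.scale/= mulr1.
have cf : continuous (fun x : R => k.+1%:R * x ^+ k).
  by move=> x; apply: cvgM; [exact: cvg_cst|exact: exprn_continuous].
have bF (x : R) : `|x ^+ k.+1| <= k.+1%:R * pw k.+1 x.
  by apply: (le_trans (normX_le_pw x k.+1)); rewrite ler_peMl ?pw_ge0// ler1n.
have bf (x : R) : `|k.+1%:R * x ^+ k| <= k.+1%:R * pw k.+1 x.
  rewrite normrM normr_nat ler_wpM2l//; apply: (le_trans (normX_le_pw x k)).
  by rewrite /pw ler_weXn2l// lerDl sqr_ge0.
have [_ _ e] := normal_ibp s0 dF cf bF bf.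
rewrite -ExZ; last exact: intg_normal_pow.
by rewrite -e; apply: eq_Ex => x; rewrite exprS.
Qed.

Lemma normal_moment2 : Ex N (fun x => x ^+ 2) = s ^+ 2.
Proof.
by rewrite normal_moment mul1r; under eq_Ex do rewrite expr0; rewrite Ex_cst mulr1.
Qed.

Lemma normal_moment4 : Ex N (fun x => x ^+ 4) = 3 * s ^+ 4.
Proof. by rewrite normal_moment normal_moment2; ring. Qed.

Section TailEstimates.
Context d (T : measurableType d) (P : probability T R).
Variables (U : T -> R).
Hypothesis mU : measurable_fun setT U.

Let mcut m : measurable_fun setT (fun w => cutoff m (U w)).
Proof. exact: measurable_cutoff. Qed.

(** The truncation only acts where [|U| > m - 1], and there [|U| ^+ k] is at most
    [U ^+ (k + k) / (m - 1) ^+ k]. *)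
Lemma moment_cutoff (k : nat) (m : R) : 1 < m ->
  intg P (fun w => U w ^+ (k + k)) ->
  `|Ex P (fun w => U w ^+ k) - Ex P (fun w => U w ^+ k * cutoff m (U w))| <=
  Ex P (fun w => U w ^+ (k + k)) / (m - 1) ^+ k.
Proof.
move=> m1 IU; have m0 : 0 <= m by rewrite ltW// (lt_trans _ m1).
have d0 : 0 < m - 1 by rewrite subr_gt0.
have Ik : intg P (fun w => U w ^+ k).
  apply: (@intg_le _ _ _ P _ (fun w => 1 + U w ^+ (k + k))); first exact: measurable_funX.
    move=> w; rewrite exprD; move: (U w ^+ k) => z.
    rewrite ler_norml; apply/andP; split; nra.
  by apply: intgD => //; exact: intg_cst.
have Ic : intg P (fun w => U w ^+ k * cutoff m (U w)).
  apply: (intg_le _ _ (intg_norm Ik)).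
    by apply: measurable_funM => //; exact: measurable_funX.
  by move=> w; rewrite normrM ler_piMr// cutoff_abs.
rewrite -ExB// mulrC -ExZ//.
apply: Ex_norm_le.
- by apply: measurable_funB; [exact: measurable_funX|apply: measurable_funM => //; exact: measurable_funX].
- move=> w; have /andP[h0 h1] := cutoff_range (U w) m0.
  rewrite -[X in X - _]mulr1 -mulrBr normrM (@ger0_norm _ (1 - _)) ?subr_ge0//.
  have [Um|Um] := leP `|U w| (m - 1).
    have UU : 0 <= U w ^+ (k + k) by rewrite exprD -expr2 sqr_ge0.
    by rewrite cutoff_eq1// subrr mulr0 mulr_ge0// invr_ge0 exprn_ge0// ltW.
  rewrite ler_pdivlMl ?exprn_gt0// exprD.
  have -> : U w ^+ k * U w ^+ k = `|U w| ^+ k * `|U w| ^+ k.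
    by rewrite -normrX -[RHS]expr2 real_normK ?num_real// expr2.
  rewrite normrX; have Uk : 0 <= `|U w| ^+ k by rewrite exprn_ge0.
  have le1 : (m - 1) ^+ k <= `|U w| ^+ k by rewrite lerXn2r ?nnegrE ?(ltW d0)// ltW.
  have le2 : `|U w| ^+ k * (1 - cutoff m (U w)) <= `|U w| ^+ k by rewrite ler_piMr// gerBl.
  have m1k : 0 <= (m - 1) ^+ k by rewrite exprn_ge0// ltW.
  by apply: ler_pM; rewrite // mulr_ge0// subr_ge0.
- exact: intgZ.
Qed.

(** A converse of Chebyshev's inequality, of Paley-Zygmund type. By Cauchy-Schwarz and the bound on
    the fourth moment, a tail of mass [1 / (4 (C ^+ 2 + 1))] carries at most half of the second
    moment; the other half lives where [|U| <= m + 1]. *)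
Lemma tight_sqr_bound (C m : R) : 0 <= m ->
  intg P (fun w => U w ^+ 2) -> intg P (fun w => U w ^+ 4) ->
  Ex P (fun w => U w ^+ 4) <= C ^+ 2 * Ex P (fun w => U w ^+ 2) ^+ 2 ->
  1 - (4 * (C ^+ 2 + 1))^-1 <= Ex P (fun w => cutoff m (U w)) ->
  Ex P (fun w => U w ^+ 2) <= 2 * (m + 1) ^+ 2.
Proof.
move=> m0 I2 I4 hC ht.
set e := Ex P (fun w => U w ^+ 2) in hC *.
have e0 : 0 <= e by apply: Ex_ge0 => w; exact: sqr_ge0.
pose V w := 1 - cutoff m (U w).
have V01 w : 0 <= V w <= 1.
  by have /andP[h0 h1] := cutoff_range (U w) m0; rewrite /V subr_ge0 h1 gerBl.
have mV : measurable_fun setT V by exact: measurable_funB.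
have Ic := intg_cutoff P mU m0.
have IV2 : intg P (fun w => V w ^+ 2).
  apply: (@intg_bounded _ _ _ P _ 1); first exact: measurable_funX.
  by move=> w; have /andP[h0 h1] := V01 w; rewrite ger0_norm ?sqr_ge0// expr_le1.
have I22 : intg P (fun w => (U w ^+ 2) ^+ 2).
  by under [X in intg _ X]eq_fun do rewrite -exprM.
have IUV := intgM2 (measurable_funX 2 mU) mV I22 IV2.
have EV : Ex P (fun w => V w ^+ 2) <= (4 * (C ^+ 2 + 1))^-1.
  apply: (@le_trans _ _ (Ex P V)).
    apply: Ex_le => //; first exact/intgB/Ic/intg_cst.
    by move=> w; have /andP[h0 h1] := V01 w; rewrite expr2 ler_piMr.
  by rewrite /V ExB ?Ex_cst//; [lra|exact: intg_cst].
have CS := Ex_CS (measurable_funX 2 mU) mV I22 IV2.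
have half : Ex P (fun w => U w ^+ 2 * V w) <= e / 2.
  have x0 : 0 <= Ex P (fun w => U w ^+ 2 * V w).
    by apply: Ex_ge0 => w; have /andP[h0 h1] := V01 w; rewrite mulr_ge0// sqr_ge0.
  rewrite -(@ler_pXn2r _ 2)// ?nnegrE ?divr_ge0//.
  apply: (le_trans CS); under eq_Ex do rewrite -exprM.
  apply: (@le_trans _ _ ((C ^+ 2 * e ^+ 2) * (4 * (C ^+ 2 + 1))^-1)).
    by apply: ler_pM => //; apply: Ex_ge0 => w; rewrite ?sqr_ge0// (exprM _ 2 2) sqr_ge0.
  have C2 : 0 <= C ^+ 2 := sqr_ge0 C.
  rewrite ler_pdivrMr; last by rewrite mulr_gt0// ltr_wpDl.
  have e2 := sqr_ge0 e.
  have -> : (e / 2) ^+ 2 * (4 * (C ^+ 2 + 1)) = e ^+ 2 * (C ^+ 2 + 1) by field.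
  by rewrite mulrC ler_wpM2l// lerDl.
have small : Ex P (fun w => U w ^+ 2 - U w ^+ 2 * V w) <= (m + 1) ^+ 2.
  rewrite -[leRHS](Ex_cst P); apply: Ex_le; [exact: intgB|exact: intg_cst|] => w.
  have -> : U w ^+ 2 - U w ^+ 2 * V w = U w ^+ 2 * cutoff m (U w) by rewrite /V; ring.
  have /andP[h0 h1] := cutoff_range (U w) m0.
  have [Um|Um] := leP (m + 1) `|U w|; first by rewrite cutoff_eq0// mulr0 sqr_ge0.
  apply: (@le_trans _ _ (U w ^+ 2)); first by rewrite ler_piMr// sqr_ge0.
  by rewrite -(real_normK (num_real (U w))) lerXn2r ?nnegrE ?addr_ge0// ltW.
rewrite ExB// -/e in small; lra.
Qed.

End TailEstimates.

Lemma moment_cvg d (T : measurableType d) (P : probability T R) (U : nat -> T -> R)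
  (k : nat) (C : R) : (0 < k)%N ->
  (forall n, measurable_fun setT (U n)) ->
  (forall n, intg P (fun w => U n w ^+ (k + k))) ->
  (\forall n \near \oo, Ex P (fun w => U n w ^+ (k + k)) <= C) ->
  (forall b, c1b b -> Ex P (fun w => b (U n w)) @[n --> \oo] --> Ex N b) ->
  Ex P (fun w => U n w ^+ k) @[n --> \oo] --> Ex N (fun x => x ^+ k).
Proof.
move=> k0 mU IU hC hb.
apply/cvgrPdist_le => /= e e0.
pose C' := `|C| + Ex N (fun x => x ^+ (k + k)).
have C'0 : 0 <= C'.
  rewrite addr_ge0//; apply: Ex_ge0 => x; rewrite exprD -expr2 sqr_ge0 //.
(* Since [m - 1 >= 1] and [k > 0], [(m - 1) ^+ k] is at least [m - 1], and
   [e / 3 * (m - 1) = e / 3 + C']. As [C'] dominates the moments of the sequence and of the limit,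
   both truncation errors are at most [e / 3]. *)
pose m := 2 + 3 * C' / e.
have me0 : 0 <= 3 * C' / e by rewrite divr_ge0 ?mulr_ge0// ltW.
have m1 : 1 < m by rewrite /m; lra.
have m0 : 0 <= m by rewrite ltW// (lt_trans _ m1).
have d1 : 1 <= m - 1 by rewrite /m; lra.
have mk : C' / (m - 1) ^+ k <= e / 3.
  rewrite ler_pdivrMr ?exprn_gt0 ?(lt_le_trans _ d1)//.
  apply: (@le_trans _ _ (e / 3 * (m - 1))); last first.
    by rewrite ler_wpM2l ?divr_ge0 ?(ltW e0)// -[leLHS]expr1 ler_weXn2l.
  have -> : e / 3 * (m - 1) = e / 3 + C' by rewrite /m; field; rewrite gt_eqF.
  by rewrite lerDr divr_ge0// ltW.
have IN : intg N (fun x => x ^+ (k + k)) := intg_normal_pow _.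
have limE := @moment_cutoff _ _ N id (@measurable_id _ _ setT) k m m1 IN.
have mk0 : 0 < (m - 1) ^+ k by rewrite exprn_gt0// (lt_le_trans _ d1).
have le1 z : z <= C' -> z / (m - 1) ^+ k <= e / 3.
  by move=> h; apply: le_trans mk; rewrite ler_pM2r ?invr_gt0.
have := hb _ (c1b_pow_cutoff k m0) => /cvgrPdist_le /(_ (e / 3)).
rewrite divr_gt0// => /(_ isT) near1.
near=> n.
have c2 : Ex P (fun w => U n w ^+ (k + k)) <= C by near: n.
have h2 : `|Ex N (fun x => x ^+ k * cutoff m x) - Ex P (fun w => U n w ^+ k * cutoff m (U n w))| <= e / 3.
  by near: n.
have h3 := @moment_cutoff _ _ P (U n) (mU n) k m m1 (IU n).
have h3' := le_trans h3 (le1 _ _).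
have {}h3 : `|Ex P (fun w => U n w ^+ k) - Ex P (fun w => U n w ^+ k * cutoff m (U n w))| <= e / 3.
  apply: h3'; apply: (le_trans c2); rewrite /C' (le_trans (ler_norm _))// lerDl.
  by apply: Ex_ge0 => x; rewrite exprD -expr2 sqr_ge0.
have {}limE : `|Ex N (fun x => x ^+ k) - Ex N (fun x => x ^+ k * cutoff m x)| <= e / 3.
  by apply: (le_trans limE); apply: le1; rewrite /C' lerDr.
move: limE h2 h3; rewrite !ler_norml => /andP[a1 a2] /andP[b1 b2] /andP[d2 d3].
by apply/andP; split; lra.
Unshelve. all: by end_near. Qed.

End Moments.

Section VanishingSequences.
Context {R : realType}.

Lemma sqr_le_cvg0 (u v : nat -> R) (c : R) :
  (\forall n \near \oo, 0 <= u n) -> (\forall n \near \oo, u n ^+ 2 <= c * v n) ->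
  v n @[n --> \oo] --> 0 -> u n @[n --> \oo] --> 0.
Proof.
move=> u0 uv v0.
have h : c * v n @[n --> \oo] --> 0.
  by rewrite -[X in _ --> X](mulr0 c); apply: cvgM => //; exact: cvg_cst.
have hs : Num.sqrt (c * v n) @[n --> \oo] --> 0.
  by rewrite -[X in _ --> X]sqrtr0; exact: (continuous_cvg _ (@sqrt_continuous R 0) h).
apply: (@squeeze_cvgr _ _ _ _ (cst 0) (fun n => Num.sqrt (c * v n))) => //; last exact: cvg_cst.
near=> n; have a0 : 0 <= u n by near: n.
rewrite /= a0/= -(@ger0_norm _ (u n))// -sqrtr_sqr ler_wsqrtr//.
by near: n.
Unshelve. all: by end_near. Qed.

End VanishingSequences.

Lemma cvg_sum_seq (R : realType) I (r : seq I) (F : I -> nat -> R) (l : I -> R) :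
  (forall i, F i @ \oo --> l i) ->
  \sum_(i <- r) F i N @[N --> \oo] --> \sum_(i <- r) l i.
Proof.
move=> h; elim: r => [|i r ih].
  by rewrite big_nil; under eq_fun do rewrite big_nil; exact: cvg_cst.
rewrite big_cons (_ : (fun N => _) = (fun N => F i N + \sum_(j <- r) F j N)).
  by apply: cvgD => //; exact: h.
by apply/funext => N; rewrite big_cons.
Qed.

Section Tightness.
Context {R : realType}.

Lemma cutoff_cvg1 d (T : measurableType d) (P : probability T R) (U : T -> R) :
  measurable_fun setT U -> Ex P (fun w => cutoff k%:R (U w)) @[k --> \oo] --> (1 : R).
Proof.
move=> mU.
have mc k := measurable_cutoff (k%:R : R) mU.
have c1 k w : `|cutoff (k%:R : R) (U w)| <= 1 by exact: cutoff_abs.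
rewrite -[X in _ --> X](Ex_cst P (1 : R)).
apply: (@Ex_cvg_bounded _ _ _ P _ _ 1) => //; apply: aeW => w.
apply: cvg_near_cst; near=> k; apply: cutoff_eq1.
by rewrite lerBrDr; near: k; exact: nbhs_infty_ger.
Unshelve. all: by end_near. Qed.

Lemma tight_cutoff d (T : measurableType d) (P : probability T R) (U : T -> R) (eta : R) :
  measurable_fun setT U -> 0 < eta ->
  exists2 m : R, 0 <= m & forall m', m <= m' -> 1 - eta <= Ex P (fun w => cutoff m' (U w)).
Proof.
move=> mU e0; have /cvgrPdist_le/(_ _ e0)[k _ /(_ _ (leqnn k))] := cutoff_cvg1 P mU.
rewrite ler_norml => /andP[_ h].
exists k%:R => // m' km; have m0 : 0 <= m' by exact: le_trans km.
apply: (@le_trans _ _ (Ex P (fun w => cutoff k%:R (U w)))); first lra.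
apply: Ex_le; [exact: intg_cutoff|exact: intg_cutoff|] => w.
by rewrite /cutoff; apply: lerB; apply: sstep_nd; rewrite lerD2l ?lerN2.
Qed.

End Tightness.

(** * Asymptotic independence for sequences of polynomials *)

Section Chaos.
Context {R : realType} d (T : measurableType d) (P : probability T R).
Variables (n : nat -> nat) (g : forall N, 'I_(n N) -> T -> R).
Arguments g : clear implicits.
Hypothesis gf : forall N, gaussian_family P (g N).
Local Notation ev N a := (fun w => meval ((g N)^~ w) a).

(** Tightness tested on smooth cutoffs, so that it follows from convergence against bounded C^1
    functions. *)
Definition tight (U : nat -> T -> R) := forall eta : R, 0 < eta ->
  exists2 m : R, 0 <= m & \forall N \near \oo, 1 - eta <= Ex P (fun w => cutoff m (U N w)).

Lemma intg_meval N (a : mpoly (n N) R) : intg P (ev N a).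
Proof. exact: intg_pg (gf N) _ (pg_meval a). Qed.

Lemma measurable_meval N (a : mpoly (n N) R) : measurable_fun setT (ev N a).
Proof. exact: intg_meas (intg_meval a). Qed.

Lemma intg_mevalX N (a : mpoly (n N) R) k : intg P (fun w => ev N a w ^+ k).
Proof.
have := intg_meval (a ^+ k); congr (intg _ _).
by apply/funext => w; rewrite rmorphXn.
Qed.

Lemma Ex_mevalX N (a : mpoly (n N) R) k : Ex P (ev N (a ^+ k)) = Ex P (fun w => ev N a w ^+ k).
Proof. by apply: eq_Ex => w; rewrite rmorphXn. Qed.

(** The hypercontractive constants depend on the degree only, so the bounds are uniform although
    [n N] varies. The eighth moment, obtained by viewing the square as a polynomial of degree [2 m],
    serves to pass to the limit in the fourth. *)
Lemma chaos_tight m (a : forall N, mpoly (n N) R) : (forall N, pdeg m (a N)) ->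
  tight (fun N => ev N (a N)) ->
  exists2 C : R, 0 <= C & \forall N \near \oo,
    [/\ Ex P (fun w => ev N (a N) w ^+ 2) <= C, Ex P (fun w => ev N (a N) w ^+ 4) <= C &
        Ex P (fun w => ev N (a N) w ^+ 8) <= C].
Proof.
move=> pa ta.
pose C := hyper_const R m; pose C4 := hyper_const R (m + m).
have eta0 : 0 < (4 * (C ^+ 2 + 1))^-1.
  by rewrite invr_gt0 mulr_gt0// ltr_wpDl ?sqr_ge0.
have [M M0 hM] := ta _ eta0.
have h4 N : Ex P (fun w => ev N (a N) w ^+ 4) <= C ^+ 2 * Ex P (fun w => ev N (a N) w ^+ 2) ^+ 2.
  by have := hypercontractivity (gaussian_expectation_meval (gf N)) (pa N); rewrite !Ex_mevalX.
have h8 N : Ex P (fun w => ev N (a N) w ^+ 8) <= C4 ^+ 2 * Ex P (fun w => ev N (a N) w ^+ 4) ^+ 2.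
  have := hypercontractivity (gaussian_expectation_meval (gf N)) (pdegM (pa N) (pa N)).
  by rewrite -expr2 -!exprM !Ex_mevalX.
have p2 N : 0 <= Ex P (fun w => ev N (a N) w ^+ 2) by apply: Ex_ge0 => w; exact: sqr_ge0.
have p4 N : 0 <= Ex P (fun w => ev N (a N) w ^+ 4).
  by apply: Ex_ge0 => w; rewrite (exprM _ 2 2) sqr_ge0.
pose A2 := 2 * (M + 1) ^+ 2; pose A4 := C ^+ 2 * A2 ^+ 2; pose A8 := C4 ^+ 2 * A4 ^+ 2.
have A20 : 0 <= A2 by rewrite mulr_ge0// sqr_ge0.
have A40 : 0 <= A4 by rewrite mulr_ge0// sqr_ge0.
have A80 : 0 <= A8 by rewrite mulr_ge0// sqr_ge0.
exists (A2 + A4 + A8); first by rewrite !addr_ge0.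
near=> N.
have b2 : Ex P (fun w => ev N (a N) w ^+ 2) <= A2.
  apply: (tight_sqr_bound (measurable_meval (a N)) M0 (intg_mevalX _ _) (intg_mevalX _ _) (h4 N)).
  by near: N.
have b4 : Ex P (fun w => ev N (a N) w ^+ 4) <= A4.
  by apply: (le_trans (h4 N)); rewrite ler_wpM2l ?sqr_ge0// lerXn2r ?nnegrE.
have b8 : Ex P (fun w => ev N (a N) w ^+ 8) <= A8.
  by apply: (le_trans (h8 N)); rewrite ler_wpM2l ?sqr_ge0// lerXn2r ?nnegrE.
by split; lra.
Unshelve. all: by end_near. Qed.

Variables (sigma : R) (p D : nat) (q : 'I_D -> nat).
Variables (X : forall N, mpoly (n N) R) (Y : forall N, 'I_D -> mpoly (n N) R).
Hypotheses (s0 : sigma != 0) (p0 : (0 < p)%N) (hq : forall j, (q j < p)%N).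
Hypotheses (degX : forall N, pdeg p (X N)) (eigX : forall N, ou (X N) = - (p%:R *: X N)).
Hypotheses (degY : forall N j, pdeg (q j) (Y N j))
  (eigY : forall N j, ou (Y N j) = - ((q j)%:R *: Y N j)).
Hypothesis limX : forall b, c1b b ->
  Ex P (fun w => b (ev N (X N) w)) @[N --> \oo] --> Ex (gaussian sigma) b.
Hypothesis tightY : forall j, tight (fun N => ev N (Y N j)).

Let tightX : tight (fun N => ev N (X N)).
Proof.
move=> eta eta0; have e2 : 0 < eta / 2 by rewrite divr_gt0.
have [m m0 hm] := tight_cutoff (gaussian sigma) (@measurable_id _ _ setT) e2.
exists m => //; have /cvgrPdist_le/(_ _ e2) := limX (c1b_cutoff m).
have := hm m (lexx m) => h1.
apply: filterS => N; rewrite ler_norml => /andP[_ h2]; lra.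
Qed.

Let M2 N := Ex P (fun w => ev N (X N) w ^+ 2).
Let V N := Ex P (ev N ((gam (X N) (X N) - (p%:R * M2 N) *: 1) ^+ 2)).

Let V_ge0 N : 0 <= V N.
Proof. by rewrite /V Ex_mevalX; apply: Ex_ge0 => w; exact: sqr_ge0. Qed.

Let M2_cvg : M2 N @[N --> \oo] --> sigma ^+ 2.
Proof.
have [C C0 hC] := chaos_tight degX tightX.
rewrite -(normal_moment2 s0).
apply: (moment_cvg s0 (k := 2) (C := C)) => //.
- by move=> N; exact: measurable_meval.
- by move=> N; exact: intg_mevalX.
- by apply: filterS hC => N [].
Qed.

Let V_cvg : V N @[N --> \oo] --> 0.
Proof.
have [C C0 hC] := chaos_tight degX tightX.
have M4 : Ex P (fun w => ev N (X N) w ^+ 4) @[N --> \oo] --> 3 * sigma ^+ 4.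
  rewrite -(normal_moment4 s0).
  apply: (moment_cvg s0 (k := 4) (C := C)) => //.
  - by move=> N; exact: measurable_meval.
  - by move=> N; exact: intg_mevalX.
  - by apply: filterS hC => N [].
pose U N := p%:R ^+ 2 / 3 * (Ex P (fun w => ev N (X N) w ^+ 4) - 3 * M2 N ^+ 2).
have U0 : U N @[N --> \oo] --> 0.
  have -> : 0 = p%:R ^+ 2 / 3 * (3 * sigma ^+ 4 - 3 * (sigma ^+ 2) ^+ 2) by ring.
  apply: cvgM; first exact: cvg_cst.
  apply: cvgB => //; apply: cvgM; first exact: cvg_cst.
  by under eq_fun do rewrite expr2; rewrite expr2; exact: cvgM.
apply: (@squeeze_cvgr _ _ _ _ (cst 0) U) => //; last exact: cvg_cst.
near=> N; rewrite /= V_ge0/=.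
have := fourth_moment_gam (gaussian_expectation_meval (gf N)) (degX N) (eigX N).
by rewrite !(Ex_mevalX (X N)).
Unshelve. all: by end_near. Qed.

Let gamX_cvg : Ex P (fun w => `|sigma ^+ 2 - ev N (gam (X N) (X N)) w / p%:R|) @[N --> \oo] --> 0.
Proof.
have pn : (p%:R : R) != 0 by rewrite pnatr_eq0 -lt0n.
pose U N := Ex P (fun w => `|ev N (gam (X N) (X N) - (p%:R * M2 N) *: 1) w|).
have U0 : U N @[N --> \oo] --> 0.
  apply: (sqr_le_cvg0 (c := 1)) V_cvg.
    by apply: nearW => N; exact: Ex_ge0.
  apply: nearW => N; rewrite mul1r /V Ex_mevalX.
  have le := Ex_sqr_le (measurable_meval _) (intg_mevalX (gam (X N) (X N) - (p%:R * M2 N) *: 1) 2).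
  rewrite -[leRHS]sqr_sqrtr; last by apply: Ex_ge0 => w; exact: sqr_ge0.
  by rewrite lerXn2r ?nnegrE ?sqrtr_ge0// Ex_ge0.
apply: (@squeeze_cvgr _ _ _ _ (cst 0) (fun N => `|sigma ^+ 2 - M2 N| + U N / p%:R)); first last.
- have -> : 0 = `|sigma ^+ 2 - sigma ^+ 2| + 0 / p%:R :> R by rewrite subrr normr0 mul0r addr0.
  apply: cvgD; last by apply: cvgM => //; exact: cvg_cst.
  by apply: cvg_norm; apply: cvgB => //; exact: cvg_cst.
- exact: cvg_cst.
apply: nearW => N; rewrite /= Ex_ge0//=.
rewrite mulrC -ExZ; last exact/intg_norm/intg_meval.
rewrite -(Ex_cst P `|sigma ^+ 2 - M2 N|) -ExD; [|exact: intg_cst|exact/intgZ/intg_norm/intg_meval].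
have I1 : intg P (fun w => `|sigma ^+ 2 - ev N (gam (X N) (X N)) w / p%:R|).
  apply/intg_norm/intgB; first exact: intg_cst.
  by under [X in intg _ X]eq_fun do rewrite mulrC; exact/intgZ/intg_meval.
apply: Ex_le => //.
  by apply: intgD; [exact: intg_cst|exact/intgZ/intg_norm/intg_meval].
move=> w; rewrite mevalB mevalZ meval1 mulr1.
set z := meval _ _.
have -> : sigma ^+ 2 - z / p%:R = (sigma ^+ 2 - M2 N) - (p%:R^-1 * (z - p%:R * M2 N)) by field.
apply: (le_trans (ler_normB _ _)); rewrite normrM lerD2l.
by rewrite (@ger0_norm _ p%:R^-1)// invr_ge0.
Qed.

Let gamXY_cvg j : Ex P (fun w => `|ev N (gam (X N) (Y N j)) w|) @[N --> \oo] --> 0.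
Proof.
have [C C0 hC] := chaos_tight (fun N => degY N j) (tightY j).
have U0 : Ex P (fun w => ev N (gam (X N) (Y N j)) w ^+ 2) @[N --> \oo] --> 0.
  apply: (sqr_le_cvg0 (c := ((p + q j) * q j)%:R ^+ 2 * C)) V_cvg.
    by apply: nearW => N; apply: Ex_ge0 => w; exact: sqr_ge0.
  apply: filterS hC => N [_ h4 _].
  have := gam_lower_order (gaussian_expectation_meval (gf N)) (degX N) (eigX N) (hq j) (degY N j) (eigY N j).
  rewrite (Ex_mevalX (gam _ _)) (Ex_mevalX (X N)) (Ex_mevalX (Y N j)) => h.
  apply: (le_trans h); rewrite -/(V N) ler_wpM2r// ler_wpM2l// sqr_ge0.
apply: (sqr_le_cvg0 (c := 1)) U0.
  by apply: nearW => N; exact: Ex_ge0.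
apply: nearW => N; rewrite mul1r.
have le := Ex_sqr_le (measurable_meval _) (intg_mevalX (gam (X N) (Y N j)) 2).
rewrite -[leRHS]sqr_sqrtr; last by apply: Ex_ge0 => w; exact: sqr_ge0.
by rewrite lerXn2r ?nnegrE ?sqrtr_ge0// Ex_ge0.
Qed.

Variable b : 'I_D -> R -> R.
Hypothesis hb : forall j, c1b (b j).
Let B N w := \prod_j b j (ev N (Y N j) w).

Let stein_cvg (K : R) u du : c1bound K u du ->
  Ex P (fun w => (sigma ^+ 2 * du (ev N (X N) w) - ev N (X N) w * u (ev N (X N) w)) * B N w)
    @[N --> \oo] --> 0.
Proof.
move=> hu; have [L [db hL]] := c1b_family hb.
pose c := K * (L ^+ D + (2 * L) ^+ D).
apply/cvgr0Pnorm_le => e e0.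
pose U N := c * (Ex P (fun w => `|sigma ^+ 2 - ev N (gam (X N) (X N)) w / p%:R|) +
     \sum_j Ex P (fun w => `|ev N (gam (X N) (Y N j)) w|)).
have U0 : U N @[N --> \oo] --> 0.
  have -> : 0 = c * (0 + 0) :> R by rewrite addr0 mulr0.
  apply: cvgM; first exact: cvg_cst.
  apply: cvgD => //; rewrite [X in _ --> X](_ : 0 = \sum_(j < D) 0); last by rewrite big1.
  exact: cvg_sum_seq gamXY_cvg.
have /cvgr0Pnorm_le/(_ _ e0) := U0.
apply: filterS => N h.
apply: le_trans h; apply: le_trans (ler_norm _).
exact: (stein_bound (gf N) (Y N) hL (sigma ^+ 2) p0 (eigX N) hu).
Qed.

Let BL L db : (forall j, c1bound L (b j) (db j)) -> forall N w, `|B N w| <= L ^+ D.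
Proof.
move=> hL N w; have := prod_test_abs hL (index_enum 'I_D) (fun j => ev N (Y N j) w).
by rewrite -sum1_size big_const_ord iter_addn mul1n addn0.
Qed.

Let mB N : measurable_fun setT (B N).
Proof.
apply: measurable_prod_test => // j; exact: measurable_meval.
Qed.

(** Stein's equation is solved for compactly supported functions of mean zero, and subtracting the
    mean of [a] would destroy compact support. A multiple of a wide cutoff is subtracted instead;
    the resulting error is small because the cutoff is close to 1 under the law of [X] as well as
    under the Gaussian law. *)
Lemma asymptotic_independence (a : R -> R) (M : R) : 0 < M -> c1b a ->
  (forall x, M < `|x| -> a x = 0) ->
  Ex P (fun w => a (ev N (X N) w) * B N w) - Ex (gaussian sigma) a * Ex P (B N)
    @[N --> \oo] --> 0.
Proof.
move=> M0 ca a0; have [L [db hL]] := c1b_family hb.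
have hB := BL hL; set G := gaussian sigma.
have LD : 0 <= L ^+ D by apply: le_trans (hB 0 point).
have IB N : intg P (B N) := @intg_bounded _ _ _ P _ _ (mB N) (hB N).
have mc1 c : c1b c -> forall N, measurable_fun setT (fun w => c (ev N (X N) w)).
  by move=> cc N; exact: (measurableT_comp (c1b_measurable cc) (measurable_meval (X N))).
have IcB c : c1b c -> forall N, intg P (fun w => c (ev N (X N) w) * B N w).
  move=> cc N; have [K hK] := c1b_bounded cc.
  apply: (@intg_bounded _ _ _ P _ (K * L ^+ D)); first exact/measurable_funM/mB/mc1.
  by move=> w; rewrite normrM ler_pM.
have IcG c : c1b c -> intg G c.
  by move=> cc; have [K hK] := c1b_bounded cc; exact: (@intg_bounded _ _ _ G _ K (c1b_measurable cc)).
apply/cvgr0Pnorm_le => e e0.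
pose A := `|Ex G a|.
have A0 : 0 <= A by exact: normr_ge0.
(* The bound by one half keeps the mass [k] of the cutoff at least one half, so [|c| <= 2 * A]. The
   cutoff error is then at most [6 * eta * A * L ^+ D <= 3 / 8 * e], which together with the Stein
   term [e / 4] stays below [e]. *)
pose eta := Num.min 2^-1 (e / (16 * (A * L ^+ D + 1))).
have AL0 : 0 < 16 * (A * L ^+ D + 1) by rewrite mulr_gt0// ltr_wpDl// mulr_ge0.
have eta0 : 0 < eta by rewrite lt_min invr_gt0 ltr0n divr_gt0.
have eta1 : eta <= 2^-1 by rewrite ge_min lexx.
have eta2 : eta * (16 * (A * L ^+ D + 1)) <= e.
  by rewrite -ler_pdivlMr// ge_min lexx orbT.
have [m1 m10 hm1] := tight_cutoff G (@measurable_id _ _ setT) eta0.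
pose m := m1 + M.
have m0 : 0 <= m by rewrite addr_ge0// ltW.
have Ecut : 1 - eta <= Ex G (cutoff m) by apply: hm1; rewrite lerDl ltW.
have Ecut_le : Ex G (cutoff m) <= 1.
  rewrite -(Ex_cst G 1); apply: Ex_le; [exact: IcG (c1b_cutoff m)|exact: intg_cst|] => x.
  by have /andP[] := cutoff_range x m0.
set k := Ex G (cutoff m) in Ecut Ecut_le.
have k0 : 2^-1 <= k by lra.
have kp : 0 < k by lra.
pose c := Ex G a / k.
have c2 : `|c| <= 2 * A.
  have ki : k^-1 <= 2 by rewrite invf_ple ?posrE.
  have k1 : 0 <= k^-1 by rewrite invr_ge0 ltW.
  by rewrite /c normrM (ger0_norm k1) -/A; nra.
pose a1 x := a x - c * cutoff m x.
have ca1 : c1b a1 by apply: c1bB => //; exact/c1bZ/c1b_cutoff.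
have Ea1 : Ex G a1 = 0.
  rewrite /a1 ExB; [|exact: IcG|exact/intgZ/IcG/c1b_cutoff].
  rewrite ExZ; last exact/IcG/c1b_cutoff.
  by rewrite -/k /c -mulrA mulVf ?mulr1 ?subrr// gt_eqF.
have mp : 0 < m + 1 by rewrite ltr_wpDl.
have [|K [u [du [hu eu]]]] := @stein_solution R sigma s0 a1 (m + 1) mp (c1b_continuous ca1) _ Ea1.
  move=> x hx; rewrite /a1 a0 ?cutoff_eq0 ?mulr0 ?subr0//; first exact: ltW.
  by apply: le_lt_trans hx; rewrite /m; lra.
have lim1 := stein_cvg hu.
have e4 : 0 < e / 4 by rewrite divr_gt0.
have /cvgr0Pnorm_le/(_ _ e4) near1 := lim1.
have /cvgrPdist_le/(_ _ eta0) near2 := limX (c1b_cutoff m).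
apply: filterS2 near1 near2 => N h1 h2.
have eq1 : Ex P (fun w => a (ev N (X N) w) * B N w) - Ex G a * Ex P (B N) =
   Ex P (fun w => a1 (ev N (X N) w) * B N w) + c * Ex P (fun w => (cutoff m (ev N (X N) w) - k) * B N w).
  have I3 : intg P (fun w => (cutoff m (ev N (X N) w) - k) * B N w).
    by have := IcB _ (c1bB (c1b_cutoff m) (c1b_cst k)) N.
  rewrite -!ExZ// -ExB//; [|exact: IcB|exact: intgZ].
  rewrite -ExD//; [|exact: (IcB _ ca1)|exact: intgZ].
  apply: eq_Ex => w; rewrite /a1 /c; field; rewrite gt_eqF//.
have {}h1 : `|Ex P (fun w => a1 (ev N (X N) w) * B N w)| <= e / 4.
  apply: le_trans h1; rewrite le_eqVlt; apply/orP; left; apply/eqP; congr `|_|.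
  by apply: eq_Ex => w; rewrite eu.
(* The mass missed under the law of [X] is at most [2 * eta], one [eta] for the Gaussian tail and
   one for the convergence; replacing 1 by [k] costs the third. *)
have h3 : `|Ex P (fun w => (cutoff m (ev N (X N) w) - k) * B N w)| <= L ^+ D * (3 * eta).
  have Ic := intg_cutoff P (measurable_meval (X N)) m0.
  have I4 : intg P (fun w => (1 - cutoff m (ev N (X N) w)) + (1 - k)).
    by apply: intgD; [apply: intgB => //; exact: intg_cst|exact: intg_cst].
  apply: (@le_trans _ _ (Ex P (fun w => L ^+ D * ((1 - cutoff m (ev N (X N) w)) + (1 - k))))).
    apply: Ex_norm_le.
    - exact: intg_meas (IcB _ (c1bB (c1b_cutoff m) (c1b_cst k)) N).
    - move=> w; rewrite normrM mulrC ler_pM//.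
      have /andP[? ?] := cutoff_range (ev N (X N) w) m0.
      by rewrite ler_norml; apply/andP; split; lra.
    - exact: intgZ.
  rewrite ExZ// ler_wpM2l// ExD; [|by apply: intgB => //; exact: intg_cst|exact: intg_cst].
  rewrite ExB//; last exact: intg_cst.
  rewrite !Ex_cst; move: h2; rewrite ler_norml => /andP[h2 h2']; rewrite -/k in h2 h2'; lra.
rewrite eq1; apply: (le_trans (ler_normD _ _)); rewrite normrM.
have h4 : `|c| * `|Ex P (fun w => (cutoff m (ev N (X N) w) - k) * B N w)| <= 2 * A * (L ^+ D * (3 * eta)).
  by rewrite ler_pM.
have := mulr_ge0 A0 LD; move: h1 h4 eta2 eta0; rewrite -/A.
set u1 := `|_|; set u2 := _ * `|_|; set Z := L ^+ D; move=> h1 h4 eta2' eta0'.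
have e2 : 2 * A * (Z * (3 * eta)) = 6 * (eta * (A * Z)) by ring.
have e3 : eta * (16 * (A * Z + 1)) = 16 * (eta * (A * Z)) + 16 * eta by ring.
rewrite e2 in h4; rewrite e3 in eta2'.
by move=> AZ; have := mulr_ge0 (ltW eta0') AZ; lra.
Qed.

End Chaos.

(** * Almost sure identities and Gaussian moments *)

Section Transfer.
Context {R : realType}.

Lemma expectation_Ex d (T : measurableType d) (P : probability T R) (f : T -> R) :
  intg P f -> 'E_P[f]%E = (Ex P f)%:E.
Proof. by move=> If; rewrite Ex_fin// unlock. Qed.

Lemma intg_sqr_ae d (T : measurableType d) (P : probability T R) (f : T -> R) :
  measurable_fun setT f -> intg P (fun w => f w ^+ 2) -> Ex P (fun w => f w ^+ 2) = 0 ->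
  {ae P, forall w, f w = 0}.
Proof.
move=> mf If E0.
have m2 : measurable_fun setT (fun w => (f w ^+ 2)%:E).
  by apply/measurable_EFinP; exact: measurable_funX.
have [h _] := ae_eq_integral_abs P measurableT m2.
have : ae_eq P setT (fun w => (f w ^+ 2)%:E) (cst 0%E).
  apply: h; transitivity (Ex P (fun w => f w ^+ 2))%:E; last by rewrite E0.
  rewrite Ex_fin//.
  by apply: eq_integral => w _; rewrite gee0_abs// lee_fin sqr_ge0.
apply: filterS => w /(_ I)/= [] /eqP; rewrite sqrf_eq0 => /eqP -> //.
Qed.

Lemma ae_intg d (T : measurableType d) (P : probability T R) (f g : T -> R) :
  measurable_fun setT g -> {ae P, forall w, f w = g w} -> intg P f -> intg P g /\ Ex P g = Ex P f.
Proof.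
move=> mg fg If; have mf := intg_meas If.
have fg' : ae_eq P setT (EFin \o f) (EFin \o g).
  by apply: filterS fg => w /= ->.
have Ig : intg P g.
  apply/integrableP; split; first exact/measurable_EFinP.
  move/integrableP : If => [_]; rewrite (ae_eq_integral (fun x => `|(f x)%:E|%E) (fun x => `|(g x)%:E|%E))//.
  - by apply/measurable_EFinP; exact: measurableT_comp.
  - by apply/measurable_EFinP; exact: measurableT_comp.
  - by apply: filterS fg => w /= ->.
split=> //; rewrite /Ex /Rintegral; congr fine; apply/esym/ae_eq_integral => //; exact/measurable_EFinP.
Qed.

Lemma intg_expectation_le d (T : measurableType d) (P : probability T R) (f : T -> R) (e : R) :
  measurable_fun setT f -> (forall w, 0 <= f w) -> ('E_P[f] <= e%:E)%E ->
  intg P f /\ Ex P f <= e.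
Proof.
move=> mf f0; rewrite unlock => le.
have If : intg P f.
  apply/integrableP; split; first exact/measurable_EFinP.
  rewrite (eq_integral (fun w => (f w)%:E)); first by rewrite (le_lt_trans le)// ltry.
  by move=> w _; rewrite /= ger0_norm.
by split=> //; rewrite -lee_fin Ex_fin.
Qed.

End Transfer.

Section GaussianLaw.
Context {R : realType} d (T : measurableType d) (P : probability T R).

Lemma gaussianN (s : R) : gaussian (- s) = gaussian s :> (set _ -> \bar R).
Proof.
apply/funext => A; rewrite /gaussian /normal_prob/=; apply: eq_integral => x _.
by rewrite /normal_pdf oppr_eq0 /normal_peak /normal_fun sqrrN.
Qed.

Lemma centered_gaussian_moments (U : T -> R) (s : R) : measurable_fun setT U ->
  (forall A, measurable A -> P (U @^-1` A) = centered_gaussian_law s A) ->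
  [/\ intg P (fun w => U w ^+ 2), Ex P (fun w => U w ^+ 2) = s ^+ 2,
      Ex P (fun w => cos (U w)) = expR (- (s ^+ 2 / 2)) & Ex P (fun w => sin (U w)) = 0].
Proof.
move=> mU; rewrite /centered_gaussian_law; have [->|s0] := eqVneq s 0; move=> hU.
  have U0 : {ae P, forall w, U w = 0}.
    exists (U @^-1` [set~ 0]); split.
    - by rewrite -[X in measurable X]setTI; apply: mU => //; exact: measurableC.
    - rewrite hU; last exact: measurableC.
      by rewrite diracE memNset//= => /(_ erefl).
    - by move=> w /= h1 h2; exact: h1.
  have h (f : R -> R) : measurable_fun setT f -> intg P (fun w => f (U w)) /\ Ex P (fun w => f (U w)) = f 0.
    move=> mf; rewrite -(Ex_cst P (f 0)).
    apply: (ae_intg _ _ (intg_cst P (f 0))); first exact: measurableT_comp.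
    by apply: filterS U0 => w ->.
  have [|i1 e1] := h (fun x => x ^+ 2); first exact: measurable_funX.
  have [_ e2] := h cos (@measurable_cos R).
  have [_ e3] := h sin (@measurable_sin R).
  by split => //; rewrite ?e1 ?e2 ?e3 ?cos0 ?sin0// expr0n/= ?mul0r ?oppr0 ?expR0.
have hU' A : measurable A -> P (U @^-1` A) = gaussian s A by exact: hU.
have tr := @intg_transfer R _ _ P _ _ (gaussian s) U _ mU hU'.
have I2 := intg_normal_pow s0 2.
have Ic : intg (gaussian s) cos := @intg_bounded _ _ _ (gaussian s) _ 1 (@measurable_cos R) (@cos_max R).
have Is : intg (gaussian s) sin := @intg_bounded _ _ _ (gaussian s) _ 1 (@measurable_sin R) (@sin_max R).
have [i2 e2] := tr _ I2; have [_ ec] := tr _ Ic; have [_ es] := tr _ Is.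
split => //.
- by rewrite -[LHS]/(Ex P ((fun x => x ^+ 2) \o U)) e2 normal_moment2.
- rewrite -[LHS]/(Ex P (cos \o U)) ec.
  have := normal_cos s0 1; rewrite expr1n mulr1 => <-.
  by apply: eq_Ex => x; rewrite mul1r.
- rewrite -[LHS]/(Ex P (sin \o U)) es -[RHS](normal_sin s0 1).
  by apply: eq_Ex => x; rewrite mul1r.
Qed.

End GaussianLaw.

(** * Polynomial approximation of multiple integrals *)

Section Hermite.
Context {R : realType}.

Lemma hermite_deriv k : (hermite R k.+1)^`() = k.+1%:R *: hermite R k.
Proof.
have d1 : (1 : {poly R})^`() = 0 by rewrite -polyC1 derivC.
elim: k => [|k ih]; first by rewrite /= mulr1 d1 subr0 derivX scale1r.
rewrite -[hermite R k.+2]/('X * hermite R k.+1 - (hermite R k.+1)^`()).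
rewrite derivB derivM derivX mul1r ih derivZ -scalerAr -addrA -scalerBr.
by rewrite -[X in X + _]scale1r -scalerDl nat1r.
Qed.

(** The homogenized polynomial [r ^+ k * He_k (y / r)] obeys a three-term recursion in which [r]
    occurs only squared and no division remains. This makes it a polynomial in the coordinates and
    also accounts for the value at [r = 0]. *)
Lemma hermite_scaled (y r : R) (h : nat -> R) : (r = 0 -> y = 0) ->
  h 0%N = 1 -> h 1%N = y -> (forall k, h k.+2 = y * h k.+1 - k.+1%:R * (r ^+ 2 * h k)) ->
  forall k, r ^+ k * (hermite R k).[y / r] = h k.
Proof.
move=> ry h0 h1 hS.
suff H k : r ^+ k * (hermite R k).[y / r] = h k /\
           r ^+ k.+1 * (hermite R k.+1).[y / r] = h k.+1 by move=> k; have [] := H k.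
elim: k => [|k [ih1 ih2]].
  rewrite h0 h1 /= expr0 mul1r hornerC mulr1 derivC subr0 hornerX expr1; split=> //.
  by have [r0|r0] := eqVneq r 0; [rewrite r0 mul0r ry|rewrite mulrC mulfVK].
split=> //; rewrite -[hermite R k.+2]/('X * hermite R k.+1 - (hermite R k.+1)^`()).
rewrite hermite_deriv hornerD hornerN hornerM hornerX hornerZ hS -ih1 -ih2.
have [r0|r0] := eqVneq r 0; last by rewrite !exprS; field.
by rewrite r0 ry// !expr0n/= !mul0r !mulr0 subrr.
Qed.

Variables (n : nat) (c : 'I_n -> R).
Local Notation A := (mpoly n R).
Let l : A := \sum_i c i *: mvar R i.
Let s : R := \sum_i c i ^+ 2.

(** For [h = sum_i c_i e_i] with [e] orthonormal, this represents the k-th multiple integral of the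
    k-th tensor power of [h]: the homogenized Hermite recursion in the linear form [l], with [s] the
    squared norm of [h]. *)
Fixpoint hermite_mpoly (k : nat) : A :=
  match k with
  | 0 => 1
  | 1 => l
  | (k'.+1 as k1).+1 => l * hermite_mpoly k1 - (k1%:R * s) *: hermite_mpoly k'
  end.

Let hermite_mpolyS k :
  hermite_mpoly k.+2 = l * hermite_mpoly k.+1 - (k.+1%:R * s) *: hermite_mpoly k.
Proof. by []. Qed.

Lemma nat2_ind (Q : nat -> Prop) : Q 0 -> Q 1 -> (forall k, Q k -> Q k.+1 -> Q k.+2) ->
  forall k, Q k.
Proof.
move=> Q0 Q1 QS k; suff [] : Q k /\ Q k.+1 by [].
by elim: k => [|k [h1 h2]]; split=> //; exact: QS.
Qed.

Let pdeg_l : pdeg 1 l.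
Proof. by apply: pdeg_sum => i _; apply: pdegZ; have := pdeg_var i (pdeg_cst n 0 (1 : R)); rewrite scale1r mulr1. Qed.

Lemma pdeg_hermite k : pdeg k (hermite_mpoly k).
Proof.
elim/nat2_ind: k => [||k h0 h1]; [|exact: pdeg_l|].
  by have := pdeg_cst n 0 (1 : R); rewrite scale1r.
rewrite hermite_mpolyS; apply: pdegB; first exact: pdegM pdeg_l h1.
by apply: pdegZ; exact: pdegW h0 _ (ltnW (leqnSn _)).
Qed.

Let ou_l : ou l = - l.
Proof.
rewrite ou_sum -sumrN; apply: eq_bigr => i _.
by rewrite ouZ ou_mvar scalerN.
Qed.

Let gam_suml I (r : seq I) (F : I -> A) b : gam (\sum_(i <- r) F i) b = \sum_(i <- r) gam (F i) b.
Proof.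
rewrite /gam exchange_big/=; apply: eq_bigr => i _.
by rewrite raddf_sum mulr_suml.
Qed.

Let gam_scalel x (a b : A) : gam (x *: a) b = x *: gam a b.
Proof.
by rewrite /gam scaler_sumr; apply: eq_bigr => i _; rewrite linearZ/= scalerAl.
Qed.

Let gam_subl (a b e : A) : gam (a - b) e = gam a e - gam b e.
Proof.
by rewrite /gam -sumrB; apply: eq_bigr => i _; rewrite raddfB/= mulrBl.
Qed.

Let gam_ll : gam l l = s *: 1.
Proof.
rewrite /l gam_suml /s scaler_suml; apply: eq_bigr => i _.
rewrite gam_scalel gamC gam_suml (bigD1 i)//= big1 => [|j ji]; last first.
  by rewrite gam_scalel gam_mvar mderiv_mvar (negbTE ji) scaler0.
by rewrite addr0 gam_scalel gam_mvar mderiv_mvar eqxx scalerA -expr2.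
Qed.

Let gam_hermite k : gam (hermite_mpoly k.+1) l = (k.+1%:R * s) *: hermite_mpoly k.
Proof.
elim/nat2_ind: k => [||k h0 h1].
- by rewrite /= gam_ll mul1r.
- rewrite hermite_mpolyS gam_subl gamMl gam_scalel gam_ll/=.
  have -> : gam 1 l = 0 by rewrite -(scale1r 1) gam_cst.
  by rewrite scaler0 subr0 -scalerAr mulr1 -scalerDl mulr_natl mulr2n.
rewrite hermite_mpolyS gam_subl gamMl gam_scalel gam_ll h0 h1 (hermite_mpolyS k).
rewrite -(natr1 k.+2) -(natr1 k.+1) -!scalerAr mulr1 !scalerBr !scalerA.
have lin (x1 x2 y1 y2 : R) (a b : A) :
    x1 *: a + (x2 *: a - y1 *: b) - y2 *: b = (x1 + x2) *: a - (y1 + y2) *: b.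
  by rewrite !scalerDl opprD !addrA.
by rewrite lin; congr (_ *: _ - _ *: _); ring.
Qed.

(** By [ouM], [ou] of [l * hermite_mpoly k.+1] differs from the eigenvalue terms by twice [gam] of
    the factors. By [gam_hermite], which is the rule [He_k' = k He_(k-1)] with [gam l l = s], this
    is a multiple of [hermite_mpoly k], exactly what the recursion needs. *)
Lemma ou_hermite k : ou (hermite_mpoly k) = - (k%:R *: hermite_mpoly k).
Proof.
elim/nat2_ind: k => [||k h0 h1].
- by rewrite scale0r oppr0 /= -(scale1r 1) ou_cst.
- by rewrite /= ou_l scale1r.
have ouB (a b : A) : ou (a - b) = ou a - ou b by rewrite -scaleN1r ouD ouZ scaleN1r.
rewrite hermite_mpolyS ouB ouZ ouM h0 h1 ou_l gamC gam_hermite.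
have lin (x1 y1 y2 : R) (a b : A) :
    - (x1 *: a) - a + y1 *: b + y2 *: b = - ((x1 + 1) *: a - (y1 + y2) *: b).
  by rewrite !scalerDl scale1r !opprD !opprK !addrA.
rewrite !mulrN (mulrC _ l) -!scalerAr !scalerA scalerN opprK !scalerA lin scalerBr scalerA.
by rewrite -(natr1 k.+1) -(natr1 k); congr (- (_ - _ *: _)); ring.
Qed.

Lemma meval_hermite (v : 'I_n -> R) (r : R) k : r ^+ 2 = s ->
  meval v (hermite_mpoly k) = r ^+ k * (hermite R k).[(\sum_i c i * v i) / r].
Proof.
move=> rs; have el : meval v l = \sum_i c i * v i.
  by rewrite raddf_sum; apply: eq_bigr => i _; rewrite /= mevalZ /mvar mevalXU.
apply/esym; apply: hermite_scaled (fun k => meval v (hermite_mpoly k)) _ _ _ _ _.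
- move=> r0; rewrite big1// => i _.
  have s0 : s = 0 by rewrite -rs r0 expr0n.
  have /eqP := s0; rewrite psumr_eq0; last by move=> j _; exact: sqr_ge0.
  by move=> /allP/(_ i); rewrite mem_index_enum => /(_ isT)/=; rewrite sqrf_eq0 => /eqP ->; rewrite mul0r.
- by rewrite /= meval1.
- by rewrite /= el.
- by move=> {}k; rewrite hermite_mpolyS mevalB mevalM mevalZ el rs mulrA.
Qed.

End Hermite.

(** * Orthonormal families spanning finitely many vectors *)

Section GramSchmidt.
Context {R : realType} (H : completeNormedModType R) (dot : {dot H for idfun}).
Hypothesis dotn : forall h : H, `|h| ^+ 2 = dot h h.

Lemma dotC g h : dot g h = dot h g.
Proof. by have := hermC dot g h; rewrite /= expr0 mul1r. Qed.

Lemma dotDl (g h k : H) : dot (g + h) k = dot g k + dot h k.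
Proof. exact: linearDl. Qed.

Lemma dotZl a (g h : H) : dot (a *: g) h = a * dot g h.
Proof. by rewrite linearZl_LR. Qed.

Lemma dotNl (g h : H) : dot (- g) h = - dot g h.
Proof. by rewrite -scaleN1r dotZl mulN1r. Qed.

Lemma dot_suml I (r : seq I) (F : I -> H) h : dot (\sum_(i <- r) F i) h = \sum_(i <- r) dot (F i) h.
Proof.
elim: r => [|i r ih]; last by rewrite !big_cons dotDl ih.
by rewrite !big_nil -(scale0r 0) dotZl mul0r.
Qed.

Lemma gram_schmidt (hs : seq H) : exists m (e : 'I_m -> H), orthonormal_family dot e /\
  forall h, h \in hs -> h = \sum_i dot h (e i) *: e i.
Proof.
elim: hs => [|h hs [m [e [oe he]]]]; first by exists 0%N, (fun=> 0); split=> // -[].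
pose r := h - \sum_i dot h (e i) *: e i.
have re j : dot r (e j) = 0.
  rewrite dotDl dotNl dot_suml (bigD1 j)//= big1 => [|i ij].
    by rewrite addr0 dotZl oe eqxx mulr1 subrr.
  by rewrite dotZl oe (negbTE ij) mulr0.
have [r0|r0] := eqVneq r 0.
  exists m, e; split=> // k; rewrite in_cons => /orP[/eqP ->|]; last exact: he.
  by apply/eqP; rewrite -subr_eq0 -/r r0.
have nr : `|r| != 0 by rewrite normr_eq0.
pose f := `|r|^-1 *: r.
have ff : dot f f = 1.
  by rewrite dotZl dotC dotZl -dotn expr2 mulKf// mulVf.
have fe j : dot f (e j) = 0 by rewrite dotZl re mulr0.
pose e' (i : 'I_m.+1) := if unlift ord0 i is Some j then e j else f.
have e'0 : e' ord0 = f by rewrite /e' unlift_none.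
have e'S j : e' (lift ord0 j) = e j by rewrite /e' liftK.
have oe' : orthonormal_family dot e'.
  move=> i j; case: (unliftP ord0 i) => [i'|] ->; case: (unliftP ord0 j) => [j'|] ->.
  - by rewrite !e'S oe (inj_eq lift_inj).
  - by rewrite e'S e'0 dotC fe eq_sym (negbTE (neq_lift _ _)).
  - by rewrite e'S e'0 fe (negbTE (neq_lift _ _)).
  - by rewrite e'0 eqxx ff.
exists m.+1, e'; split=> // k kin; rewrite big_ord_recl e'0.
under eq_bigr do rewrite e'S.
move: kin; rewrite in_cons => /orP[/eqP ->|kin].
  have -> : dot h f = `|r|.
    have eh : h = r + \sum_i dot h (e i) *: e i by rewrite subrK.
    rewrite {1}eh dotDl dot_suml big1 => [|i _]; last by rewrite dotZl (dotC (e i)) fe mulr0.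
    by rewrite addr0 dotC dotZl -dotn expr2 mulKf.
  by rewrite scalerA mulfV// scale1r subrK.
have -> : dot k f = 0.
  by rewrite (he k kin) dot_suml big1 => // i _; rewrite dotZl (dotC (e i)) fe mulr0.
by rewrite scale0r add0r; exact: he.
Qed.

End GramSchmidt.

(** * The isonormal process on an orthonormal family *)

Section Isonormal.
Context {R : realType} (H : completeNormedModType R) (dot : {dot H for idfun}).
Hypothesis dotn : forall h : H, `|h| ^+ 2 = dot h h.
Context dT (T : measurableType dT) (P : probability T R).
Variable W : H -> {RV P >-> R}.
Hypothesis hW : isonormal dot W.

Let mW h : measurable_fun setT (W h). Proof. exact: measurable_funPT. Qed.

Let W2 h : intg P (fun w => W h w ^+ 2).
Proof.
have [_ /(_ h h) cov] := hW.
have m2 : measurable_fun setT (fun w => W h w ^+ 2) by exact: measurable_funX.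
have le : ('E_P[fun w => (W h w ^+ 2)%R] <= (dot h h)%:E)%E by rewrite -cov.
by have [] := intg_expectation_le m2 (fun w => sqr_ge0 _) le.
Qed.

Let WW g h : intg P (fun w => W g w * W h w). Proof. exact: intgM2. Qed.

Let cov g h : Ex P (fun w => W g w * W h w) = dot g h.
Proof.
have [_ /(_ g h)] := hW.
by rewrite expectation_Ex// => -[].
Qed.

Let mcomb (c : seq (R * H)) : measurable_fun setT (fun w => \sum_(a <- c) a.1 * W a.2 w).
Proof. by apply: measurable_sum => a; apply: measurable_funM. Qed.

Let comb_sqr (c : seq (R * H)) : intg P (fun w => (\sum_(a <- c) a.1 * W a.2 w) ^+ 2) /\
  Ex P (fun w => (\sum_(a <- c) a.1 * W a.2 w) ^+ 2) =
  dot (\sum_(a <- c) a.1 *: a.2) (\sum_(a <- c) a.1 *: a.2).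
Proof.
have e w : (\sum_(a <- c) a.1 * W a.2 w) ^+ 2 =
    \sum_(a <- c) \sum_(b <- c) a.1 * b.1 * (W a.2 w * W b.2 w).
  rewrite expr2 mulr_suml; apply: eq_bigr => a _.
  by rewrite mulr_sumr; apply: eq_bigr => b _; ring.
have I1 (a b : R * H) : intg P (fun w => a.1 * b.1 * (W a.2 w * W b.2 w)) by exact: intgZ.
have I2 (a : R * H) : intg P (fun w => \sum_(b <- c) a.1 * b.1 * (W a.2 w * W b.2 w)).
  exact: (intg_sum c (I1 a)).
split; first by under [X in intg _ X]eq_fun do rewrite e; exact: (intg_sum c I2).
rewrite (eq_Ex _ e) (@Ex_sum _ _ _ P _ c _ I2) dot_suml; apply: eq_bigr => a _.
rewrite (@Ex_sum _ _ _ P _ c _ (I1 a)) dotZl dotC dot_suml mulr_sumr; apply: eq_bigr => b _.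
by rewrite ExZ// cov dotZl dotC mulrA.
Qed.

Section Orthonormal.
Variables (m : nat) (e : 'I_m -> H).
Hypothesis oe : orthonormal_family dot e.

(** Isonormality only asserts that some standard deviation exists; computing the second moment from
    the law and from the covariance identifies its square. *)
Let comb_law (c : seq (R * H)) : exists2 s : R,
  s ^+ 2 = dot (\sum_(a <- c) a.1 *: a.2) (\sum_(a <- c) a.1 *: a.2) &
  forall A, measurable A ->
     P ((fun w => \sum_(a <- c) a.1 * W a.2 w) @^-1` A) = centered_gaussian_law s A.
Proof.
have [/(_ c)[s hs] _] := hW; exists s => //.
by have [_ <- _ _] := centered_gaussian_moments (mcomb c) hs; have [_ ->] := comb_sqr c.
Qed.

Let norm_comb (t : 'I_m -> R) :
  dot (\sum_i t i *: e i) (\sum_i t i *: e i) = \sum_i t i ^+ 2.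
Proof.
rewrite dot_suml; apply: eq_bigr => i _.
rewrite dotZl dotC dot_suml (bigD1 i)//= big1 => [|j ji].
  by rewrite addr0 dotZl oe eqxx mulr1 -expr2.
by rewrite dotZl oe (negbTE ji) mulr0.
Qed.

Lemma isonormal_gaussian_family : gaussian_family P (fun i => (W (e i) : T -> R)).
Proof.
have tr (t : 'I_m -> R) := comb_law [seq (t i, e i) | i <- index_enum 'I_m].
have ew (t : 'I_m -> R) : (fun w => \sum_(a <- [seq (t i, e i) | i <- index_enum 'I_m]) a.1 * W a.2 w)
    = (fun w => \sum_i t i * W (e i) w) by apply/funext => w; rewrite big_map.
have mt t : measurable_fun setT (fun w => \sum_i t i * W (e i) w) by rewrite -ew.
split=> [i|i A mA|t|t]; first exact: mW.
- have [s] := comb_law [:: (1, e i)].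
  rewrite big_seq1 scale1r oe eqxx => s1 /(_ A mA).
  have -> : (fun w => \sum_(a <- [:: (1, e i)]) a.1 * W a.2 w) = W (e i).
    by apply/funext => w; rewrite big_seq1 mul1r.
  (* The sign of [s] stays undetermined, and [gaussianN] makes it immaterial. *)
  move=> ->; have /eqP := s1; rewrite -[X in _ == X](expr1n _ 2) eqf_sqr /centered_gaussian_law.
  by case/orP => /eqP ->; rewrite ?oppr_eq0 oner_eq0// -gaussianN.
- have [s] := tr t; rewrite ew big_map norm_comb => <- hs.
  by have [_ _ ->] := centered_gaussian_moments (mt t) hs.
- have [s] := tr t; rewrite ew big_map norm_comb => _ hs.
  by have [_ _ _ ->] := centered_gaussian_moments (mt t) hs.
Qed.

(** Almost sure linearity of [W] comes from the covariance: the difference of the two sides has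
    second moment zero. *)
Let W_ae h : h = \sum_i dot h (e i) *: e i ->
  {ae P, forall w, W h w = \sum_i dot h (e i) * W (e i) w}.
Proof.
move=> eh; pose c := (1, h) :: [seq (- dot h (e i), e i) | i <- index_enum 'I_m].
have [I2 E2] := comb_sqr c.
have ec w : \sum_(a <- c) a.1 * W a.2 w = W h w - \sum_i dot h (e i) * W (e i) w.
  by rewrite big_cons big_map/= mul1r -sumrN; congr (_ + _); apply: eq_bigr => i _; rewrite mulNr.
have s0 : \sum_(a <- c) a.1 *: a.2 = 0.
  rewrite big_cons big_map/= scale1r {1}eh -big_split/= big1// => i _.
  by rewrite scaleNr subrr.
have := intg_sqr_ae (mcomb c) I2; rewrite E2 s0 -(scale0r 0) dotZl mul0r => /(_ erefl).
by apply: filterS => w; rewrite ec => /eqP; rewrite subr_eq0 => /eqP.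
Qed.

Lemma integral_pow_tensor_ae k (c : seq (R * H)) :
  (forall a, a \in c -> a.2 = \sum_i dot a.2 (e i) *: e i) ->
  {ae P, forall w, \sum_(a <- c) a.1 * integral_pow_tensor W k a.2 w =
    meval (fun i => W (e i) w) (\sum_(a <- c) a.1 *: hermite_mpoly (fun i => dot a.2 (e i)) k)}.
Proof.
elim: c => [_|a c ih hc].
  by apply: aeW => w; rewrite !big_nil meval0.
have h1 := W_ae (hc a (mem_head _ _)).
have h2 : forall b, b \in c -> b.2 = \sum_i dot b.2 (e i) *: e i.
  by move=> b bc; apply: hc; rewrite in_cons bc orbT.
apply: filterS2 h1 (ih h2) => w e1 e2.
rewrite !big_cons mevalD e2 mevalZ; congr (_ * _ + _).
rewrite (@meval_hermite _ _ _ _ `|a.2|); first by rewrite /integral_pow_tensor e1.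
by rewrite dotn {1 2}(hc a (mem_head _ _)) norm_comb.
Qed.

End Orthonormal.

End Isonormal.

(** * Square-mean approximation by polynomials *)

Section Approximation.
Context {R : realType} (H : completeNormedModType R) (dot : {dot H for idfun}).
Hypothesis dotn : forall h : H, `|h| ^+ 2 = dot h h.
Context dT (T : measurableType dT) (P : probability T R).
Variable W : H -> {RV P >-> R}.
Hypothesis hW : isonormal dot W.

Lemma measurable_integral_pow_tensor k h :
  measurable_fun setT (integral_pow_tensor W k h).
Proof.
apply: measurable_funM; first exact: measurable_cst.
under eq_fun do rewrite horner_coef.
apply: measurable_sum => i; apply: measurable_funM; first exact: measurable_cst.
by apply: measurable_funX; apply: measurable_funM => //; exact: measurable_cst.
Qed.

Lemma multiple_integral_approx k (f : ('I_k -> H) -> R) (X : {RV P >-> R}) (e : R) : 0 < e ->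
  multiple_integral dot W f X -> exists c : seq (R * H),
    intg P (fun w => (X w - \sum_(a <- c) a.1 * integral_pow_tensor W k a.2 w) ^+ 2) /\
    Ex P (fun w => (X w - \sum_(a <- c) a.1 * integral_pow_tensor W k a.2 w) ^+ 2) <= e.
Proof.
move=> e0 [c [_ lim]].
pose F N := 'E_P[fun w => ((X w - \sum_(a <- c N) a.1 * integral_pow_tensor W k a.2 w) ^+ 2)%R]%E.
have nb : nbhs (0%E : \bar R) [set y | (y < e%:E)%E].
  by apply: open_nbhs_nbhs; split; [exact: open_ereal_lt_ereal|rewrite /= lte_fin].
have nbF : \forall N \near \oo, (F N < e%:E)%E := lim _ nb.
have [N hN] := filter_ex nbF.
exists (c N); apply: intg_expectation_le; [|by move=> w; exact: sqr_ge0|exact: ltW].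
apply: measurable_funX; apply: measurable_funB; first exact: measurable_funPT.
apply: measurable_sum => a; apply: measurable_funM; first exact: measurable_cst.
exact: measurable_integral_pow_tensor.
Qed.

Definition l2_close (X x : T -> R) (e : R) :=
  intg P (fun w => (X w - x w) ^+ 2) /\ Ex P (fun w => (X w - x w) ^+ 2) <= e.

(** All components must be polynomials in the same Gaussian variables, so the vectors occurring in
    all their approximations are orthonormalized together. *)
Lemma polynomial_approx (I : finType) (q : I -> nat) (X : I -> {RV P >-> R}) (e : R) : 0 < e ->
  (forall i, exists f : ('I_(q i) -> H) -> R, multiple_integral dot W f (X i)) ->
  exists n (g : 'I_n -> T -> R) (x : I -> mpoly n R), gaussian_family P g /\
    forall i, [/\ pdeg (q i) (x i), ou (x i) = - ((q i)%:R *: x i) &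
      l2_close (X i) (fun w => meval (g^~ w) (x i)) e].
Proof.
move=> e0 hX.
have /choice[c hc] : forall i, exists c : seq (R * H),
    l2_close (X i) (fun w => \sum_(a <- c) a.1 * integral_pow_tensor W (q i) a.2 w) e.
  by move=> i; have [f hf] := hX i; exact: multiple_integral_approx e0 hf.
have [m [b [ob hb]]] := gram_schmidt dotn (flatten [seq [seq a.2 | a <- c i] | i <- enum I]).
have gf := isonormal_gaussian_family hW ob.
pose x i := \sum_(a <- c i) a.1 *: hermite_mpoly (fun j => dot a.2 (b j)) (q i).
exists m, (fun j => (W (b j) : T -> R)), x; split=> // i.
have ae : {ae P, forall w, \sum_(a <- c i) a.1 * integral_pow_tensor W (q i) a.2 w =
    meval (fun j => W (b j) w) (x i)}.
  apply: (integral_pow_tensor_ae dotn hW ob) => a ac; apply: hb.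
  by apply/flatten_mapP; exists i; [rewrite mem_enum|exact: map_f].
split.
- by apply: pdeg_sum => a _; apply: pdegZ; exact: pdeg_hermite.
- rewrite /x ou_sum scaler_sumr -sumrN; apply: eq_bigr => a _.
  by rewrite ouZ ou_hermite scalerN !scalerA mulrC.
have [I1 E1] := hc i.
have [| |I2 E2] := @ae_intg R _ _ P _ (fun w => (X i w - meval (fun j => W (b j) w) (x i)) ^+ 2) _ _ I1.
- apply: measurable_funX; apply: measurable_funB; first exact: measurable_funPT.
  exact: intg_meas (intg_pg gf (pg_meval (x i))).
- by apply: filterS ae => w ->.
by split=> //; rewrite E2.
Qed.

End Approximation.

(** * Stability of product tests and factorization under independence *)

Section Products.
Context {R : realType} (I : Type) (b db : I -> R -> R) (K : R).
Hypothesis hb : forall i, c1bound K (b i) (db i).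

Lemma prod_test_lipschitz (r : seq I) (u v : I -> R) :
  `|\prod_(i <- r) b i (u i) - \prod_(i <- r) b i (v i)| <=
  K ^+ size r * \sum_(i <- r) `|u i - v i|.
Proof.
elim: r => [|j s ih]; first by rewrite !big_nil subrr normr0 mulr0.
have K0 := c1bound_ge0 (hb j).
rewrite !big_cons; set U := \prod_(i <- s) _; set V := \prod_(i <- s) _.
have -> : b j (u j) * U - b j (v j) * V = (b j (u j) - b j (v j)) * U + b j (v j) * (U - V) by ring.
apply: (le_trans (ler_normD _ _)); rewrite !normrM mulrDr lerD//= exprS.
  rewrite mulrAC ler_pM//; first exact: (c1bound_lipschitz (hb j)).
  exact: prod_test_abs hb _ _.
by rewrite -mulrA ler_pM// (c1_bnd (hb j)).
Qed.

End Products.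

Section Close.
Context {R : realType} d (T : measurableType d) (P : probability T R).
Variables (I : finType) (X x : nat -> I -> T -> R).
Hypotheses (mX : forall N i, measurable_fun setT (X N i))
  (mx : forall N i, measurable_fun setT (x N i))
  (Xx : forall N i, l2_close P (X N i) (x N i) (N.+1%:R^-1)).

(** A product of bounded Lipschitz functions is Lipschitz in its arguments, so the error is of the
    order of the mean absolute errors, hence of [Num.sqrt N.+1%:R^-1]. *)
Lemma prod_close_cvg (b : I -> R -> R) : (forall i, c1b (b i)) ->
  Ex P (fun w => \prod_i b i (X N i w)) - Ex P (fun w => \prod_i b i (x N i w))
    @[N --> \oo] --> 0.
Proof.
move=> cb; have [K [db hb]] := c1b_family cb.
pose r := index_enum I; pose c := K ^+ size r * (size r)%:R.
have c0 : 0 <= K ^+ size r by apply: le_trans (prod_test_abs hb r (fun=> 0)).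
have lim : c * Num.sqrt N.+1%:R^-1 @[N --> \oo] --> 0.
  rewrite -[X in _ --> X](mulr0 c); apply: cvgM; first exact: cvg_cst.
  rewrite -[X in _ --> X]sqrtr0.
  exact: (continuous_cvg _ (@sqrt_continuous R 0) cvg_harmonic).
apply/cvgr0Pnorm_le => e e0; have /cvgr0Pnorm_le/(_ _ e0) := lim.
apply: filterS => N; apply: le_trans; apply: le_trans (ler_norm _).
have mpX : measurable_fun setT (fun w => \prod_i b i (X N i w)) by exact: measurable_prod_test.
have mpx : measurable_fun setT (fun w => \prod_i b i (x N i w)) by exact: measurable_prod_test.
have IX := intg_prod_test P cb (mX N).
have Ix := intg_prod_test P cb (mx N).
have md i : measurable_fun setT (fun w => X N i w - x N i w) by exact: measurable_funB.
have Id i : intg P (fun w => `|X N i w - x N i w|).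
  have [I2 _] := Xx N i.
  apply: (@intg_le _ _ _ P _ (fun w => 1 + (X N i w - x N i w) ^+ 2)).
  - exact: measurableT_comp.
  - move=> w; rewrite normr_id; set z := _ - _; rewrite -(real_normK (num_real z)).
    have := normr_ge0 z; move: `|z| => y y0; nra.
  - by apply: intgD => //; exact: intg_cst.
rewrite -ExB//; apply: (@le_trans _ _ (Ex P (fun w => K ^+ size r * \sum_(i <- r) `|X N i w - x N i w|))).
  apply: Ex_norm_le; first exact: measurable_funB.
    by move=> w; exact: prod_test_lipschitz.
  by apply: intgZ; exact: (intg_sum r Id).
rewrite ExZ; last exact: (intg_sum r Id).
rewrite (@Ex_sum _ _ _ P _ r _ Id) /c -mulrA ler_wpM2l//.
elim: r {c c0 lim} => [|i r ih]; first by rewrite big_nil mul0r.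
rewrite big_cons -(nat1r (size r)) mulrDl mul1r lerD//.
have [I2 E2] := Xx N i; apply: (le_trans (Ex_sqr_le (md i) I2)).
by rewrite ler_wsqrtr.
Qed.

End Close.

Section Independence.
Context {R : realType} d (T : measurableType d) (P : probability T R).

Lemma Ex_mul_indep (a : R -> R) (X Y : T -> R) (c c' : R) :
  measurable_fun setT X -> measurable_fun setT Y ->
  measurable_fun setT a -> (forall x, `|a x| <= c) -> (forall w, `|Y w| <= c') ->
  (forall A B, measurable A -> measurable B ->
    P (X @^-1` A `&` Y @^-1` B) = (P (X @^-1` A) * P (Y @^-1` B))%E) ->
  Ex P (fun w => a (X w) * Y w) = Ex P (fun w => a (X w)) * Ex P Y.
Proof.
move=> mX mY ma ac Yc indep.
pose X' : {RV P >-> R} := HB.pack X (@isMeasurableFun.Build _ _ _ _ X mX).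
pose Y' : {RV P >-> R} := HB.pack Y (@isMeasurableFun.Build _ _ _ _ Y mY).
(* Clipping leaves [Y] unchanged and makes the integrand bounded on the whole plane, where the
   product law lives. *)
pose clip (y : R) := Num.max (- c') (Num.min y c').
have mclip : measurable_fun setT clip.
  by apply: measurable_maxr => //; apply: measurable_minr.
have clipY w : clip (Y w) = Y w.
  have := Yc w; rewrite ler_norml => /andP[h1 h2].
  by rewrite /clip min_l// max_r.
have c0 : 0 <= c' by apply: le_trans (Yc point).
have clipc y : `|clip y| <= c'.
  by rewrite ler_norml /clip le_max lexx/= ge_max ge_min lexx orbT andbT lerNl (le_trans _ c0)// oppr_le0.
pose Q := (distribution P X' \x distribution P Y')%E.
pose f (z : R * R) := a z.1 * clip z.2.
have mf : measurable_fun setT f.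
  by apply: measurable_funM; apply: measurableT_comp => //.
have fc z : `|f z| <= c * c' by rewrite normrM ler_pM.
have If : intg Q f := @intg_bounded _ _ _ Q _ _ mf fc.
have mXY : measurable_fun setT (fun w => (X w, Y w)) by exact/measurable_fun_pairP.
have law (A : set (R * R)) : measurable A -> P ((fun w => (X w, Y w)) @^-1` A) = Q A.
  move=> mA; apply/esym.
  have := @product_measure_unique _ _ _ _ _ (distribution P X') (distribution P Y')
    (measure_function_pushforward__canonical__measure_function_Measure P mXY).
  by apply=> // B C mB mC; rewrite /= /pushforward -[RHS]indep.
have [_ e1] := intg_transfer mXY law If.
have -> : Ex P (fun w => a (X w) * Y w) = Ex P (f \o (fun w => (X w, Y w))).
  by apply: eq_Ex => w; rewrite /f /= clipY.
rewrite e1.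
have Ia : intg (distribution P X') a := @intg_bounded _ _ _ (distribution P X') _ _ ma ac.
have Ic : intg (distribution P Y') clip := @intg_bounded _ _ _ (distribution P Y') _ _ mclip clipc.
have [_ eX] := intg_transfer mX (fun A _ => erefl (distribution P X' A)) Ia.
have [_ eY] := intg_transfer mY (fun A _ => erefl (distribution P Y' A)) Ic.
have -> : Ex P Y = Ex P (clip \o Y) by apply: eq_Ex => w; rewrite /= clipY.
rewrite -[X in _ = X * _]/(Ex P (a \o X)) eX eY.
have [|_ e2] := @Ex_prod1 _ _ _ _ _ (distribution P X') (distribution P Y') f If.
  by move=> x; exact: (intgZ (a x) Ic).
transitivity (Ex (distribution P X') (fun x => Ex (distribution P Y') (fun y => f (x, y)))); first exact: e2.
rewrite mulrC -ExZ//; apply: eq_Ex => x.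
by rewrite /f/= ExZ// mulrC.
Qed.

End Independence.

(** * Convergence in distribution from product test functions *)

Section UniformContinuity.
Context {R : realType}.

(** Only [x] is confined to [K]: the grid nodes used later as second argument may lie outside the
    box. *)
Lemma compact_uniform_continuity (E : pseudoMetricType R) (K : set E) (phi : E -> R) (e : R) :
  continuous phi -> compact K -> 0 < e ->
  exists2 r : R, 0 < r & forall x y, K x -> ball x r y -> `|phi x - phi y| <= e.
Proof.
move=> cphi /compact_near_coveringP cK e0.
have e2 : 0 < e / 2 by rewrite divr_gt0.
pose Q (r : R) x := forall y, ball x r y -> `|phi x - phi y| <= e.
have near_Q : \forall r \near 0^'+, K `<=` Q r.
  apply: (cK R (0^'+) Q) => x Kx.
  have /cvgrPdist_le/(_ _ e2)/nbhs_ballP[s s0 hs] := cphi x.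
  near=> x' r => y xy.
  have bx : ball x (s / 2) x' by near: x'; apply: nbhsx_ballx; rewrite divr_gt0.
  have rs : r <= s / 2 by near: r; apply: nbhs_right_le; rewrite divr_gt0.
  have bxy : ball x s y.
    have -> : s = s / 2 + s / 2 by field.
    exact: ball_triangle bx (le_ball rs xy).
  have bx' : ball x s x' by apply: le_ball bx; rewrite ler_pdivrMr// ler_peMr ?ler1n// ltW.
  have -> : phi x' - phi y = (phi x - phi y) - (phi x - phi x') by ring.
  apply: (le_trans (ler_normB _ _)).
  have -> : e = e / 2 + e / 2 by field.
  by rewrite lerD//; exact: hs.
near (0 : R)^'+ => r.
have hr : K `<=` Q r by near: r.
by exists r => // x y Kx; exact: hr.
Unshelve. all: by end_near. Qed.

End UniformContinuity.

(** * A smooth partition of unity on a grid *)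

Section PartitionOfUnity.
Context {R : realType}.
Variables (m r : R).
Hypotheses (m0 : 0 <= m) (r0 : 0 < r).

Let l0 : 0 < r^-1. Proof. by rewrite invr_gt0. Qed.

Definition bump_node (k : nat) : R := k%:R * r - (m + 1).

(** Consecutive differences of one step rescaled to width [r], so that the sum over [k] telescopes;
    the nodes start at [- (m + 1)] with spacing [r]. *)
Definition bump_fun (k : nat) (x : R) : R :=
  (sstep (r^-1 * x + (r^-1 * (m + 1) - k%:R + 1)) -
   sstep (r^-1 * x + (r^-1 * (m + 1) - k%:R))) * cutoff m x.

Lemma c1b_bump_fun k : c1b (bump_fun k).
Proof. by apply: c1bM; [apply: c1bB; exact: c1b_affine c1b_sstep|exact: c1b_cutoff]. Qed.

Lemma bump_fun_ge0 k x : 0 <= bump_fun k x.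
Proof.
rewrite mulr_ge0//; last by have /andP[] := cutoff_range x m0.
by rewrite subr_ge0 sstep_nd// lerD2l lerDl.
Qed.

Lemma bump_fun_supp k x : bump_fun k x != 0 -> `|x| <= m + 1 /\ `|x - bump_node k| < r.
Proof.
move=> h; split.
  rewrite leNgt; apply: contra h => h.
  by rewrite /bump_fun cutoff_eq0 ?mulr0// ltW.
have e : r^-1 * x + (r^-1 * (m + 1) - k%:R) = r^-1 * (x - bump_node k).
  by rewrite /bump_node; field; rewrite gt_eqF.
rewrite /bump_fun addrA e in h.
have h1 : r^-1 * (x - bump_node k) < 1.
  rewrite ltNge; apply: contra h => h.
  by rewrite !sstep_ge1 ?subrr ?mul0r// ler_wpDr.
have h2 : - 1 < r^-1 * (x - bump_node k).
  rewrite ltNge; apply: contra h => h.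
  by rewrite !sstep_le0 ?subrr ?mul0r//; lra.
rewrite -(ltr_pM2l l0) mulVf ?gt_eqF// -[X in X * _ < _](gtr0_norm l0) -normrM ltr_norml.
by rewrite h2.
Qed.

Lemma bump_fun_sum (n : nat) x : r^-1 * (2 * (m + 1)) <= n%:R ->
  \sum_(k < n.+1) bump_fun k x = cutoff m x.
Proof.
move=> hn; rewrite -mulr_suml.
have [xm|xm] := leP (m + 1) `|x|; first by rewrite cutoff_eq0// !mulr0.
rewrite [X in X * _](_ : _ = 1) ?mul1r//.
pose F (k : nat) := - sstep (r^-1 * x + (r^-1 * (m + 1) + 1 - k%:R)).
rewrite (eq_bigr (fun k : 'I_n.+1 => F k.+1 - F k)); last first.
  move=> k _; rewrite /F opprK addrC; congr (- sstep _ + sstep _).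
    by rewrite -natr1; ring.
  by ring.
rewrite -(big_mkord xpredT (fun k => F k.+1 - F k)) telescope_sumr// /F.
move: xm; rewrite ltr_norml => /andP[x1 x2].
have lx1 : 0 <= r^-1 * (x + (m + 1)) by rewrite mulr_ge0 ?(ltW l0)//; lra.
have lx2 : r^-1 * (x + (m + 1)) <= r^-1 * (2 * (m + 1)) by rewrite ler_pM2l//; lra.
rewrite sstep_le0 ?sstep_ge1; [by rewrite oppr0 opprK add0r| |].
- by rewrite subr0 addrA -mulrDr lerDr.
- by rewrite !addrA -mulrDr -natr1; lra.
Qed.

(** Expanding the product of one-dimensional partitions of unity writes the product of cutoffs as a
    sum over grid points. Where a term does not vanish, [psi v] is within [e] of its value at the
    node, and the nonnegative weights add up to at most 1. *)
Lemma product_approx (I : finType) (psi : (I -> R) -> R) (e : R) : 0 <= e ->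
  (forall u v, (forall i, `|u i| <= m + 1) -> (forall i, `|u i - v i| < r) ->
    `|psi u - psi v| <= e) ->
  exists n, forall v,
  `|psi v * \prod_i cutoff m (v i) -
    \sum_(f : {ffun I -> 'I_n}) psi (fun i => bump_node (f i)) * \prod_i bump_fun (f i) (v i)| <= e.
Proof.
move=> e0 hpsi.
pose n := Num.truncn (r^-1 * (2 * (m + 1))).
have hn : r^-1 * (2 * (m + 1)) <= n.+1%:R by rewrite ltW// truncnS_gt.
exists n.+2 => v.
have -> : \prod_i cutoff m (v i) = \sum_(f : {ffun I -> 'I_n.+2}) \prod_i bump_fun (f i) (v i).
  by rewrite -(bigA_distr_bigA (fun i (k : 'I_n.+2) => bump_fun k (v i)))/=; apply: eq_bigr => i _; rewrite bump_fun_sum.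
rewrite mulr_sumr -sumrB.
have c1 := prod_cutoff_range v m0.
apply: (le_trans (ler_norm_sum _ _ _)).
apply: (@le_trans _ _ (\sum_(f : {ffun I -> 'I_n.+2}) e * \prod_i bump_fun (f i) (v i))); last first.
  have -> : \sum_(f : {ffun I -> 'I_n.+2}) e * \prod_i bump_fun (f i) (v i) = e * \prod_i cutoff m (v i).
    by rewrite -mulr_sumr -(bigA_distr_bigA (fun i (k : 'I_n.+2) => bump_fun k (v i)))/=; congr (_ * _); apply: eq_bigr => i _; rewrite bump_fun_sum.
  by rewrite ler_piMr//; have /andP[] := c1.
apply: ler_sum => f _; rewrite -mulrBl normrM.
have p0 : 0 <= \prod_i bump_fun (f i) (v i) by apply: prodr_ge0 => i _; exact: bump_fun_ge0.
rewrite (ger0_norm p0).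
have [->|pn] := eqVneq (\prod_i bump_fun (f i) (v i)) 0; first by rewrite !mulr0.
have h i : `|v i| <= m + 1 /\ `|v i - bump_node (f i)| < r.
  by apply: bump_fun_supp; move/prodf_neq0 : pn; exact.
by rewrite ler_wpM2r//; apply: hpsi => i; have [] := h i.
Qed.

End PartitionOfUnity.

(** * Product test functions determine convergence in law *)

Section ProductTests.
Context {R : realType} (I : finType).

Definition compact_test (b : R -> R) := c1b b /\ exists2 m : R, 0 < m & forall x, m < `|x| -> b x = 0.

Definition product_combination (F : (I -> R) -> R) := exists n (c : {ffun I -> 'I_n} -> R) (b : nat -> R -> R),
  (forall k, compact_test (b k)) /\ F = fun v => \sum_f c f * \prod_i b (f i) (v i).

Lemma product_combination_intg F d (T : measurableType d) (P : probability T R) (V : I -> T -> R) :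
  product_combination F -> (forall i, measurable_fun setT (V i)) -> intg P (fun w => F (V^~ w)).
Proof.
move=> [n [c [b [hb ->]]]] mV; apply: intg_sum => f; apply: intgZ.
exact: (intg_prod_test P (fun i => (hb (f i)).1)).
Qed.

Variable psi : (I -> R) -> R.
Hypothesis unif : forall m e : R, 0 <= m -> 0 < e -> exists2 r, 0 < r &
  forall u v, (forall i, `|u i| <= m) -> (forall i, `|u i - v i| < r) -> `|psi u - psi v| <= e.

Lemma product_combination_approx (m e : R) : 0 <= m -> 0 < e ->
  exists F, product_combination F /\ forall v, `|psi v * \prod_i cutoff m (v i) - F v| <= e.
Proof.
move=> m0 e0; have [r r0 hr] := unif (addr_ge0 m0 ler01) e0.
have [n hn] := product_approx m0 r0 (ltW e0) hr.
exists (fun v => \sum_(f : {ffun I -> 'I_n}) psi (fun i => bump_node m r (f i)) * \prod_i bump_fun m r (f i) (v i)).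
split=> //; exists n, (fun f : {ffun I -> 'I_n} => psi (fun i => bump_node m r (f i))), (bump_fun m r); split=> // k.
split; first exact: c1b_bump_fun.
exists (m + 1); first by rewrite ltr_wpDl.
move=> x mx; apply/eqP; apply: contraT => /(bump_fun_supp m0 r0)[].
by rewrite leNgt mx.
Qed.

(** Product combinations over growing boxes converge to [psi] pointwise, and measurability passes to
    the limit. *)
Lemma measurable_psi d (T : measurableType d) (V : I -> T -> R) :
  (forall i, measurable_fun setT (V i)) -> measurable_fun setT (fun w => psi (V^~ w)).
Proof.
move=> mV.
have /choice[F hF] : forall k : nat, exists F, product_combination F /\
    forall v, `|psi v * \prod_i cutoff k%:R (v i) - F v| <= k.+1%:R^-1.
  by move=> k; exact: product_combination_approx.
apply: (@measurable_fun_cvg _ _ _ setT (fun k w => F k (V^~ w))) => // [k|w _].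
  have [[n [c [b [hb ->]]]] _] := hF k.
  apply: measurable_sum => f; apply: measurable_funM; first exact: measurable_cst.
  have cb i : c1b (b (f i)) by have [] := hb (f i).
  exact: (measurable_prod_test (index_enum I) cb mV).
apply/cvgrPdist_le => e e0.
pose S := \sum_i `|V i w|.
near=> k.
have [_ /(_ (V^~ w))] := hF k.
have -> : \prod_i cutoff k%:R (V i w) = 1.
  apply: big1 => i _; apply: cutoff_eq1; rewrite lerBrDr.
  apply: (@le_trans _ _ (S + 1)); last by near: k; exact: nbhs_infty_ger.
  by rewrite lerD2r /S (bigD1 i)//= lerDl sumr_ge0.
rewrite mulr1 => h; apply: (le_trans h).
have ek : e^-1 <= k.+1%:R by apply: (@le_trans _ _ k%:R); [near: k; exact: nbhs_infty_ger|rewrite ler_nat].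
by rewrite -[leRHS]invrK lef_pV2 ?posrE// invr_gt0.
Unshelve. all: by end_near. Qed.

(** No mass escapes: the product of cutoffs is itself a product test, so the mass of [V N] in a
    large box is asymptotically that of the limit. Inside the box [psi] is uniformly close to a
    product combination. *)
Lemma cvg_product_tests d (T : measurableType d) (P : probability T R) (V : nat -> I -> T -> R)
    d' (T' : measurableType d') (P' : probability T' R) (V' : I -> T' -> R) (M : R) :
  (forall N i, measurable_fun setT (V N i)) -> (forall i, measurable_fun setT (V' i)) ->
  (forall v, `|psi v| <= M) ->
  (forall b : I -> R -> R, (forall i, compact_test (b i)) ->
    Ex P (fun w => \prod_i b i (V N i w)) @[N --> \oo] --> Ex P' (fun w => \prod_i b i (V' i w))) ->
  Ex P (fun w => psi ((V N)^~ w)) @[N --> \oo] --> Ex P' (fun w => psi (V'^~ w)).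
Proof.
move=> mV mV' psiM lim.
have M0 : 0 <= M by apply: le_trans (psiM (fun=> 0)).
have limF F : product_combination F ->
    Ex P (fun w => F ((V N)^~ w)) @[N --> \oo] --> Ex P' (fun w => F (V'^~ w)).
  move=> [n [c [b [hb eF]]]]; rewrite eF.
  have ImF (f : {ffun I -> 'I_n}) d0 (T0 : measurableType d0) (P0 : probability T0 R) (V0 : I -> T0 -> R) :
      (forall i, measurable_fun setT (V0 i)) -> intg P0 (fun w => \prod_i b (f i) (V0 i w)).
    exact: (intg_prod_test P0 (fun i => (hb (f i)).1)).
  have eE d0 (T0 : measurableType d0) (P0 : probability T0 R) (V0 : I -> T0 -> R) :
      (forall i, measurable_fun setT (V0 i)) ->
      Ex P0 (fun w => \sum_f c f * \prod_i b (f i) (V0 i w)) =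
      \sum_f c f * Ex P0 (fun w => \prod_i b (f i) (V0 i w)).
    move=> mV0; rewrite (@Ex_sum _ _ _ P0 _ _ (fun f w => c f * \prod_i b (f i) (V0 i w))).
      by apply: eq_bigr => f _; rewrite ExZ//; exact: ImF.
    by move=> f; apply: intgZ; exact: ImF.
  rewrite eE// (_ : (fun N => _) = fun N => \sum_f c f * Ex P (fun w => \prod_i b (f i) (V N i w))).
    apply: cvg_sum_seq => f; apply: cvgM; first exact: cvg_cst.
    by apply: (lim (fun i => b (f i))) => i; exact: hb.
  by apply/funext => N; rewrite eE.
pose theta m (v : I -> R) := \prod_i cutoff m (v i).
have thetaP m v : 0 <= m -> 0 <= theta m v <= 1 by exact: prod_cutoff_range.
have Itheta m d0 (T0 : measurableType d0) (P0 : probability T0 R) (V0 : I -> T0 -> R) :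
    (forall i, measurable_fun setT (V0 i)) -> intg P0 (fun w => theta m (V0^~ w)).
  exact: (intg_prod_test P0 (fun=> c1b_cutoff m)).
apply/cvgrPdist_le => e e0.
(* Two shares go to the approximation for the limit, three to that for the sequence, whose mass
   outside the box is known only up to a further [eta], and one to the convergence of [F]. *)
pose e1 := e / 6; have e10 : 0 < e1 by rewrite divr_gt0.
pose eta := e1 / (M + 1).
have eta0 : 0 < eta by rewrite divr_gt0// ltr_wpDl.
have Meta : M * eta <= e1.
  by rewrite /eta mulrCA ler_piMr ?(ltW e10)// ler_pdivrMr ?mul1r ?lerDl// ltr_wpDl.
pose U w := \sum_i `|V' i w|.
have mU : measurable_fun setT U by apply: measurable_sum => i; exact: measurableT_comp.
have [m' m'0 hm'] := tight_cutoff P' mU eta0.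
(* Where the cutoff of [U] at [m'] does not vanish, each [|V' i|] is below [m' + 1 = m - 1], so
   every factor of [theta m] equals 1. *)
pose m := m' + 2; have m0 : 0 <= m by rewrite addr_ge0.
have theta_lim : 1 - eta <= Ex P' (fun w => theta m (V'^~ w)).
  apply: (le_trans (hm' m' (lexx m'))).
  apply: Ex_le => //; [exact: intg_cutoff|exact: Itheta|].
  move=> w; have [Um|Um] := leP (m' + 1) `|U w|.
    by rewrite cutoff_eq0//; have /andP[] := thetaP m (V'^~ w) m0.
  rewrite /theta big1; first by have /andP[] := cutoff_range (U w) m'0.
  move=> i _; apply: cutoff_eq1; apply: (@le_trans _ _ (U w)).
    by rewrite /U (bigD1 i)//= lerDl sumr_ge0.
  by rewrite (le_trans (ler_norm _))// (le_trans (ltW Um))// /m; lra.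
have [F [pF hF]] := product_combination_approx m0 e10.
have key d0 (T0 : measurableType d0) (P0 : probability T0 R) (V0 : I -> T0 -> R) :
    (forall i, measurable_fun setT (V0 i)) ->
    `|Ex P0 (fun w => psi (V0^~ w)) - Ex P0 (fun w => F (V0^~ w))| <=
    M * (1 - Ex P0 (fun w => theta m (V0^~ w))) + e1.
  move=> mV0; have I1 : intg P0 (fun w => psi (V0^~ w)).
    by apply: (@intg_bounded _ _ _ P0 _ M) => //; exact: measurable_psi.
  have I2 := product_combination_intg P0 pF mV0.
  have I3 := Itheta m _ _ P0 _ mV0.
  rewrite -ExB// -(Ex_cst P0 1) -ExB ?Ex_cst//; last exact: intg_cst.
  rewrite -(Ex_cst P0 e1) -ExZ; last by apply: intgB => //; exact: intg_cst.
  rewrite -ExD; [|by apply: intgZ; apply: intgB => //; exact: intg_cst|exact: intg_cst].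
  apply: Ex_norm_le; first exact: intg_meas (intgB I1 I2).
    move=> w; set v := V0^~ w; have /andP[h0 h1] := thetaP m v m0.
    have -> : psi v - F v = psi v * (1 - theta m v) + (psi v * theta m v - F v) by ring.
    have a2 : `|psi v * theta m v - F v| <= e1 := hF v.
    apply: (le_trans (ler_normD _ _)); apply: lerD a2.
    by rewrite normrM (@ger0_norm _ (1 - _)) ?subr_ge0// ler_wpM2r ?subr_ge0.
  by apply: intgD; [apply: intgZ; apply: intgB => //; exact: intg_cst|exact: intg_cst].
have limt : Ex P (fun w => theta m ((V N)^~ w)) @[N --> \oo] --> Ex P' (fun w => theta m (V'^~ w)).
  apply: (lim (fun=> cutoff m)) => i; split; first exact: c1b_cutoff.
  exists (m + 1); first by rewrite ltr_wpDl.
  by move=> x mx; rewrite cutoff_eq0// ltW.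
have /cvgrPdist_le/(_ _ eta0) near1 := limt.
have /cvgrPdist_le/(_ _ e10) near2 := limF _ pF.
apply: filterS2 near1 near2 => N.
have k1 := key _ _ P' _ mV'; have k2 := key _ _ P _ (mV N).
move: k1 k2; set a1 := Ex P' _; set a2 := Ex P' _; set a3 := Ex P _; set a4 := Ex P _.
set t1 := Ex P' _ in theta_lim *; set t2 := Ex P _.
move=> k1 k2 h1 h2.
have s1 : M * (1 - t1) <= e1.
  by apply: le_trans Meta; rewrite ler_wpM2l//; lra.
have s2 : M * (1 - t2) <= 2 * e1.
  apply: (@le_trans _ _ (M * (2 * eta))); last by rewrite mulrCA ler_pM2l.
  rewrite ler_wpM2l//; move: h1; rewrite ler_norml => /andP[h1 h1']; lra.
have {}k1 := le_trans k1 (lerD s1 (lexx e1)).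
have {}k2 := le_trans k2 (lerD s2 (lexx e1)).
move: k1 k2 h2; rewrite !ler_norml => /andP[? ?] /andP[? ?] /andP[? ?].
have ee : e = 6 * e1 by rewrite /e1; field.
by apply/andP; split; lra.
Qed.

End ProductTests.

(** * Continuity and Borel sets for row vectors *)

Section RowVectors.
Context {R : realType} (d : nat).

Lemma continuous_prod_test (b : 'I_d -> R -> R) : (forall j, c1b (b j)) ->
  continuous (fun v : 'rV[R]_d => \prod_j b j (v ord0 j)).
Proof.
move=> hb; elim: (index_enum _) => [|j s ih].
  rewrite (_ : (fun v => _) = cst 1); first exact: cst_continuous.
  by apply/funext => v; rewrite big_nil.
rewrite (_ : (fun v => _) = (fun v : 'rV[R]_d => b j (v ord0 j) * \prod_(i <- s) b i (v ord0 i))); last first.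
  by apply/funext => v; rewrite big_cons.
have cc : continuous (b j \o (fun v : 'rV[R]_d => v ord0 j)).
  move=> v; apply: continuous_comp; first exact: coord_continuous.
  exact: c1b_continuous (hb j) _.
by move=> x; exact: cvgM (cc x) (ih x).
Qed.

Lemma continuous_preimage_borel (F : 'rV[R]_d -> R) (B : set R) : continuous F ->
  measurable B -> <<s [set U : set 'rV[R]_d | open U] >> (F @^-1` B).
Proof.
move=> cF mB.
pose F' : g_sigma_algebraType [set U : set 'rV[R]_d | open U] -> R := F.
have mF : measurable_fun setT F'.
  apply: (measurability _ (RGenOpens.measurableE R)) => _ [_ [a [b ->] <-]].
  apply: sub_sigma_algebra; rewrite /= setTI; move/continuousP : cF; apply.
  exact: interval_open.
by have := mF measurableT B mB; rewrite setTI.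
Qed.

Lemma box_uniform_continuity (phi : R * 'rV[R]_d -> R) (m e : R) : continuous phi ->
  0 <= m -> 0 < e -> exists2 r : R, 0 < r &
  forall u v : 'I_d.+1 -> R, (forall i, `|u i| <= m) -> (forall i, `|u i - v i| < r) ->
  `|phi (u ord0, \row_j u (lift ord0 j)) - phi (v ord0, \row_j v (lift ord0 j))| <= e.
Proof.
move=> cphi m0 e0.
pose K : set (R * 'rV[R]_d) := `[- m, m]%classic `*` [set v : 'rV[R]_d | forall i, `[- m, m]%classic (v ord0 i)].
have cK : compact K.
  apply: compact_setX; first exact: segment_compact.
  by apply: (@rV_compact R d (fun=> `[- m, m]%classic)) => i; exact: segment_compact.
have [r r0 hr] := compact_uniform_continuity cphi cK e0.
exists r => // u v um uv; apply: hr.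
  split=> [|i] /=; rewrite ?mxE in_itv/=; rewrite -ler_norml; exact: um.
split; first exact: uv.
by split=> // i j; rewrite !mxE; exact: uv.
Qed.

End RowVectors.

Lemma cvg_diff0r (R : realType) (u v : nat -> R) (l : R) :
  u N - v N @[N --> \oo] --> 0 -> u N @[N --> \oo] --> l -> v N @[N --> \oo] --> l.
Proof.
move=> h1 h2; rewrite (_ : v = fun N => u N - (u N - v N)).
  by have := cvgB h2 h1; rewrite subr0; apply.
by apply/funext => N; rewrite subKr.
Qed.

Lemma cvg_diff0l (R : realType) (u v : nat -> R) (l : R) :
  u N - v N @[N --> \oo] --> 0 -> v N @[N --> \oo] --> l -> u N @[N --> \oo] --> l.
Proof.
move=> h1 h2; rewrite (_ : u = fun N => (u N - v N) + v N).
  by have := cvgD h1 h2; rewrite add0r; apply.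
by apply/funext => N; rewrite subrK.
Qed.

Section ConvergenceInDistribution.
Context {R : realType} (E : topologicalType).
Context d (T : measurableType d) (P : probability T R) (X : nat -> T -> E).
Context d' (T' : measurableType d') (P' : probability T' R) (X' : T' -> E).

Lemma cvg_in_distribution_Ex (phi : E -> R) (M : R) : cvg_in_distribution P X P' X' ->
  continuous phi -> (forall x, `|phi x| <= M) ->
  (forall N, measurable_fun setT (phi \o X N)) -> measurable_fun setT (phi \o X') ->
  Ex P (phi \o X N) @[N --> \oo] --> Ex P' (phi \o X').
Proof.
move=> lim cphi phiM mX mX'.
have h := lim _ cphi (ex_intro _ M phiM).
have I' : intg P' (phi \o X') := @intg_bounded _ _ _ P' _ M mX' (fun w => phiM _).
have IN N : intg P (phi \o X N) := @intg_bounded _ _ _ P _ M (mX N) (fun w => phiM _).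
rewrite expectation_Ex// in h.
rewrite (_ : (fun N => _) = fine \o (fun N => 'E_P[phi \o X N]%E)); first exact: fine_cvg h.
by apply/funext => N /=; rewrite expectation_Ex.
Qed.

End ConvergenceInDistribution.

Unset Implicit Arguments.

Theorem proposition1
  (R : realType)
  (H : completeNormedModType R) (dot : {dot H for idfun})
  (hH : separable_hilbert dot)
  (dT : measure_display) (T : measurableType dT) (P : probability T R)
  (W : H -> {RV P >-> R}) (hW : isonormal dot W)
  (p : nat) (hp : (2 <= p)%N)
  (f : nat -> ('I_p -> H) -> R) (hf : forall N : nat, sym_tensor dot (f N))
  (X : nat -> {RV P >-> R})
  (hX : forall N : nat, multiple_integral dot W (f N) (X N))
  (sigma : R) (hsigma : 0 < sigma ^+ 2)
  (hXlim : cvg_in_distribution P (fun N (w : T) => X N w)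
             (normal_prob 0 sigma) (fun x : R => x))
  (d : nat) (q : 'I_d -> nat) (hq : forall j : 'I_d, (q j < p)%N)
  (Y : nat -> 'I_d -> {RV P >-> R})
  (hY : forall (N : nat) (j : 'I_d), wiener_chaos dot W (q j) (Y N j))
  (dT' : measure_display) (T' : measurableType dT') (P' : probability T' R)
  (Ylim : 'I_d -> {RV P' >-> R})
  (hYlim : cvg_in_distribution P (fun N w => \row_(j < d) Y N j w)
             P' (fun w' => \row_(j < d) Ylim j w'))
  (Z : {RV P' >-> R})
  (hZ : forall A : set R, measurable A ->
          distribution P' Z A = normal_prob 0 sigma A)
  (hZY : independent_rv_vector P' Z (fun w' => \row_(j < d) Ylim j w')) :
  cvg_in_distribution P (fun N w => (X N w, \row_(j < d) Y N j w))
    P' (fun w' => (Z w' : R, \row_(j < d) Ylim j w')).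
Proof.
have [dotn _] := hH.
have s0 : sigma != 0 by apply: contraTneq hsigma => ->; rewrite expr0n ltxx.
(* The variables are gathered in one family, with [X] at index 0, so that one approximation and one
   class of product tests serve for all of them. *)
pose XY N (i : 'I_d.+1) := if unlift ord0 i is Some j then Y N j else X N.
pose qq (i : 'I_d.+1) := if unlift ord0 i is Some j then q j else p.
have XY0 N : XY N ord0 = X N by rewrite /XY unlift_none.
have XYS N j : XY N (lift ord0 j) = Y N j by rewrite /XY liftK.
have qq0 : qq ord0 = p by rewrite /qq unlift_none.
have qqS j : qq (lift ord0 j) = q j by rewrite /qq liftK.
have hXY N i : exists g : ('I_(qq i) -> H) -> R, multiple_integral dot W g (XY N i).
  case: (unliftP ord0 i) => [j|] ->; last by rewrite XY0 qq0; exists (f N).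
  by rewrite XYS qqS; have [g [_ hg]] := hY N j; exists g.
have eN N : 0 < N.+1%:R^-1 :> R by rewrite invr_gt0.
(* The number of Gaussian variables depends on [N], hence the dependent pair. *)
have /choice[A hA] : forall N, exists A : {n : nat & (('I_n -> T -> R) * ('I_d.+1 -> mpoly n R))%type},
    gaussian_family P (projT2 A).1 /\ forall i, [/\ pdeg (qq i) ((projT2 A).2 i),
      ou ((projT2 A).2 i) = - ((qq i)%:R *: (projT2 A).2 i) &
      l2_close P (XY N i) (fun w => meval ((projT2 A).1^~ w) ((projT2 A).2 i)) (N.+1%:R^-1)].
  move=> N; have [n [g [x [gf hx]]]] := polynomial_approx dotn hW (eN N) (hXY N).
  by exists (existT _ n (g, x)).
pose n N := projT1 (A N); pose g N : 'I_(n N) -> T -> R := (projT2 (A N)).1.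
pose x N : 'I_d.+1 -> mpoly (n N) R := (projT2 (A N)).2.
have gf N : gaussian_family P (g N) by have [] := hA N.
pose xr N i w := meval ((g N)^~ w) (x N i).
have mXY N i : measurable_fun setT (XY N i) by exact: measurable_funPT.
have mx N i : measurable_fun setT (xr N i) by exact: (measurable_meval gf (x N i)).
have close N i : l2_close P (XY N i) (xr N i) (N.+1%:R^-1).
  by have [_ /(_ i)[]] := hA N.
pose V' i : T' -> R := if unlift ord0 i is Some j then Ylim j else Z.
have V'0 : V' ord0 = Z by rewrite /V' unlift_none.
have V'S j : V' (lift ord0 j) = Ylim j by rewrite /V' liftK.
have mV' i : measurable_fun setT (V' i).
  by rewrite /V'; case: (unlift _ _) => [j|]; exact: measurable_funPT.
have rowE (v : 'I_d -> R) j : (\row_j v j) ord0 j = v j by rewrite mxE.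
have lim_close i b (l : R) : c1b b -> Ex P (fun w => b (XY N i w)) @[N --> \oo] --> l ->
    Ex P (fun w => b (xr N i w)) @[N --> \oo] --> l.
  move=> cb; apply: cvg_diff0r.
  have := @prod_close_cvg R _ T P 'I_1 (fun N _ => XY N i) (fun N _ => xr N i)
    (fun N _ => mXY N i) (fun N _ => mx N i) (fun N _ => close N i) (fun=> b) (fun=> cb).
  by under eq_fun do (rewrite (eq_Ex _ (fun w => big_ord1 _ _)) (eq_Ex _ (fun w => big_ord1 _ _))).
have limX b : c1b b -> Ex P (fun w => b (X N w)) @[N --> \oo] --> Ex (gaussian sigma) b.
  move=> cb; have [K bK] := c1b_bounded cb; have mb := c1b_measurable cb.
  apply: (cvg_in_distribution_Ex hXlim (c1b_continuous cb) bK) => // N.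
  exact: measurableT_comp.
have limY (F : 'rV[R]_d -> R) K : continuous F -> (forall v, `|F v| <= K) ->
    (forall N, measurable_fun setT (fun w => F (\row_j Y N j w))) ->
    measurable_fun setT (fun w => F (\row_j Ylim j w)) ->
    Ex P (fun w => F (\row_j Y N j w)) @[N --> \oo] --> Ex P' (fun w => F (\row_j Ylim j w)).
  by move=> cF FK mF mF'; exact: (cvg_in_distribution_Ex hYlim cF FK mF mF').
have limYprod (b : 'I_d -> R -> R) : (forall j, c1b (b j)) ->
    Ex P (fun w => \prod_j b j (Y N j w)) @[N --> \oo] --> Ex P' (fun w => \prod_j b j (Ylim j w)).
  move=> cb; have [K [db hb]] := c1b_family cb.
  pose F (v : 'rV[R]_d) := \prod_j b j (v ord0 j).
  have eF d0 (T0 : measurableType d0) (U : 'I_d -> T0 -> R) :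
      (fun w => F (\row_j U j w)) = fun w => \prod_j b j (U j w).
    by apply/funext => w; apply: eq_bigr => j _; rewrite rowE.
  have mF d0 (T0 : measurableType d0) (U : 'I_d -> T0 -> R) : (forall j, measurable_fun setT (U j)) ->
      measurable_fun setT (fun w => F (\row_j U j w)).
    by move=> mU; rewrite eF; exact: measurable_prod_test.
  have := limY F _ (continuous_prod_test cb) (fun v => prod_test_abs hb _ _) _ _.
  rewrite -(eF _ _ (fun j => (Ylim j : T' -> R))).
  under [X in _ -> X @ _ --> _]eq_fun do rewrite -(eF _ _ (fun j => (Y _ j : T -> R))).
  by apply; [move=> N|]; apply: mF => j; exact: measurable_funPT.
have mYlim j : measurable_fun setT (Ylim j) by exact: measurable_funPT.
(* Convergence in law of the vector gives convergence of each coordinate against cutoffs, which then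
   passes to the polynomial approximations. *)
have tightY j : tight P (fun N => xr N (lift ord0 j)).
  move=> eta eta0; have e2 : 0 < eta / 2 by rewrite divr_gt0.
  have [m m0 hm] := tight_cutoff P' (mYlim j) e2.
  have cc : continuous (cutoff m \o (fun v : 'rV[R]_d => v ord0 j)).
    move=> v; apply: continuous_comp; first exact: coord_continuous.
    exact: c1b_continuous (c1b_cutoff m) _.
  have bc (v : 'rV[R]_d) : `|(cutoff m \o (fun v : 'rV[R]_d => v ord0 j)) v| <= 1.
    by have /andP[h0 h1] := cutoff_range (v ord0 j) m0; rewrite /= ger0_norm.
  have mc d0 (T0 : measurableType d0) (U : 'I_d -> T0 -> R) : (forall j, measurable_fun setT (U j)) ->
      measurable_fun setT (fun w => (cutoff m \o (fun v : 'rV[R]_d => v ord0 j)) (\row_j U j w)).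
    move=> mU; rewrite (_ : (fun w => _) = fun w => cutoff m (U j w)).
      by apply: measurableT_comp => //; exact: c1b_measurable (c1b_cutoff m).
    by apply/funext => w /=; rewrite rowE.
  have l1 : Ex P (fun w => cutoff m (XY N (lift ord0 j) w)) @[N --> \oo] -->
      Ex P' (fun w => cutoff m (Ylim j w)).
    have := limY _ 1 cc bc (fun N => mc _ _ _ (fun j => measurable_funPT (Y N j))) (mc _ _ _ mYlim).
    rewrite (_ : (fun N => _) = fun N => Ex P (fun w => cutoff m (XY N (lift ord0 j) w))).
      by rewrite (_ : Ex P' _ = Ex P' (fun w => cutoff m (Ylim j w)))//; apply: eq_Ex => w /=; rewrite rowE.
    by apply/funext => N; rewrite XYS; apply: eq_Ex => w /=; rewrite rowE.
  have /cvgrPdist_le/(_ _ e2) near1 := lim_close _ _ _ (c1b_cutoff m) l1.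
  exists m => //; apply: filterS near1 => N.
  have := hm m (lexx m) => h1; rewrite ler_norml => /andP[_ h2]; lra.
have p0 : (0 < p)%N by exact: ltnW.
have degX N : pdeg p (x N ord0) by have [_ /(_ ord0)[]] := hA N; rewrite qq0.
have eigX N : ou (x N ord0) = - (p%:R *: x N ord0).
  by have [_ /(_ ord0)[]] := hA N; rewrite qq0.
have degY N j : pdeg (q j) (x N (lift ord0 j)).
  by have [_ /(_ (lift ord0 j))[]] := hA N; rewrite qqS.
have eigY N j : ou (x N (lift ord0 j)) = - ((q j)%:R *: x N (lift ord0 j)).
  by have [_ /(_ (lift ord0 j))[]] := hA N; rewrite qqS.
have limx b : c1b b -> Ex P (fun w => b (xr N ord0 w)) @[N --> \oo] --> Ex (gaussian sigma) b.
  move=> cb; apply: lim_close => //.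
  have := limX b cb; rewrite (_ : (fun N => _) = fun N => Ex P (fun w => b (XY N ord0 w)))//.
  by apply/funext => N; rewrite XY0.
have tests (b : 'I_d.+1 -> R -> R) : (forall i, compact_test (b i)) ->
    Ex P (fun w => \prod_i b i (XY N i w)) @[N --> \oo] --> Ex P' (fun w => \prod_i b i (V' i w)).
  move=> hb; have cb i : c1b (b i) by have [] := hb i.
  have [ca [m m0 am]] := hb ord0.
  have cb' j : c1b (b (lift ord0 j)) by [].
  pose B N := Ex P (fun w => \prod_j b (lift ord0 j) (xr N (lift ord0 j) w)).
  pose L := Ex P' (fun w => \prod_j b (lift ord0 j) (Ylim j w)).
  have limB : B N @[N --> \oo] --> L.
    apply: cvg_diff0r (limYprod _ cb').
    apply: (prod_close_cvg _ _ _ cb') => N j; [exact: measurable_funPT|exact: mx|].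
    by have := close N (lift ord0 j); rewrite XYS.
  have asym := asymptotic_independence gf s0 p0 hq degX eigX degY eigY limx tightY cb' m0 ca am.
  have [K [db hb']] := c1b_family cb'.
  have [K0 bK0] := c1b_bounded ca.
  have mprod : measurable_fun setT (fun w => \prod_j b (lift ord0 j) (Ylim j w)).
    exact: (measurable_prod_test _ cb' mYlim).
  (* Independence of [Z] and the limit vector factors the target; the product of the remaining tests
     is a continuous function of the row, so its preimages are Borel. *)
  have -> : Ex P' (fun w => \prod_i b i (V' i w)) = Ex (gaussian sigma) (b ord0) * L.
    have [_ <-] := @intg_transfer R _ _ P' _ _ (gaussian sigma) Z (b ord0) (measurable_funPT Z) hZ
      (@intg_bounded _ _ _ (gaussian sigma) _ _ (c1b_measurable ca) bK0).
    rewrite -(Ex_mul_indep (measurable_funPT Z) mprod (c1b_measurable ca) bK0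
      (fun w => prod_test_abs hb' _ _)).
      apply: eq_Ex => w; rewrite big_ord_recl V'0; congr (_ * _).
      by apply: eq_bigr => j _; rewrite V'S.
    move=> C C' mC mC'.
    have := hZY _ _ mC (continuous_preimage_borel (continuous_prod_test cb') mC').
    rewrite (_ : (fun w => \row_j Ylim j w) @^-1` _ =
      (fun w => \prod_j b (lift ord0 j) (Ylim j w)) @^-1` C')//.
    by apply/funext => w; rewrite /preimage /mkset; congr (C' _); apply: eq_bigr => j _; rewrite mxE.
  (* Two vanishing differences are chained: from the variables to their polynomial approximations,
     then from the joint expectation to the product of expectations. *)
  apply: cvg_diff0l (prod_close_cvg mXY mx close cb) _.
  apply: (@cvg_diff0l _ _ (fun N => Ex (gaussian sigma) (b ord0) * B N)); last first.
    by apply: cvgM => //; exact: cvg_cst.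
  move: asym; rewrite (_ : (fun N => _ - _) = fun N => Ex P (fun w => \prod_i b i (xr N i w)) -
    Ex (gaussian sigma) (b ord0) * B N)//.
  by apply/funext => N; congr (_ - _); apply: eq_Ex => w; rewrite big_ord_recl.
move=> phi cphi [M phiM].
pose psi (v : 'I_d.+1 -> R) := phi (v ord0, \row_j v (lift ord0 j)).
have unif (m e : R) := @box_uniform_continuity R d phi m e cphi.
have psiM v : `|psi v| <= M by exact: phiM.
have := @cvg_product_tests R 'I_d.+1 psi unif _ T P (fun N i => XY N i) _ T' P' V' M mXY mV' psiM tests.
have eXY N : (fun w => psi (fun i => XY N i w)) = phi \o (fun w => (X N w, \row_j Y N j w)).
  apply/funext => w; rewrite /psi /= XY0; congr (phi (_, _)).
  by apply/rowP => j; rewrite !mxE XYS.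
have eV' : (fun w => psi (fun i => V' i w)) = phi \o (fun w => (Z w : R, \row_j Ylim j w)).
  apply/funext => w; rewrite /psi /= V'0; congr (phi (_, _)).
  by apply/rowP => j; rewrite !mxE V'S.
have mpX N := measurable_psi unif (mXY N).
have mpV := measurable_psi unif mV'.
move=> lim.
rewrite -eV' expectation_Ex; last exact: (@intg_bounded _ _ _ P' _ M mpV).
rewrite (_ : (fun N => _) = fun N => (Ex P (fun w => psi (fun i => XY N i w)))%:E).
  by apply: cvg_EFin => //; exact: nearW.
apply/funext => N; rewrite -eXY expectation_Ex//.
exact: (@intg_bounded _ _ _ P _ M (mpX N)).
Qed.
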